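(* Consider the $L$-factor normal-inverse-Gamma Markov grove (NIG-MG) model on the tree $\mathcal{T}$ with data $\mathcal{D}=\{\boldsymbol{d}_{j,k}:(j,k)\in\mathcal{T}\}$, as described in the context. Write $\boldsymbol r=(r_1,\dots,r_L)\in\{0,1\}^L$ and $\boldsymbol R_{j,k}=(R_{1\,j,k},\dots,R_{L\,j,k})$. Define mappings $\phi_{j,k},\xi_{j,k}:\{0,1\}^{L+1}\to[0,+\infty)$ recursively from $j=J$ down to $j=0$ by $$\phi_{j,k}(s,\boldsymbol r)=\begin{cases} m_{j,k}(s,\boldsymbol r)\,\xi_{j+1,2k}(s,\boldsymbol r)\,\xi_{j+1,2k+1}(s,\boldsymbol r) & j=0,\ldots,J-1,\\ m_{j,k}(s,\boldsymbol r) & j=J,\end{cases}$$ $$\xi_{j,k}(s,\boldsymbol r)=\begin{cases}\sum_{s',\boldsymbol r'}\rho_{j,k}(s,s')\prod_{l=1}^L\kappa_{j,k}(r_l,r_l')\cdot\phi_{j,k}(s',\boldsymbol r') & j=1,\ldots,J,\\ \sum_{s',\boldsymbol r'}\rho_{0,0}(s')\prod_{l=1}^L\kappa_{0,0}(r_l')\cdot\phi_{0,0}(s',\boldsymbol r') & j=0.\end{cases}$$ Then the joint posterior of $\{z_{j,k},\boldsymbol\beta_{j,k},S_{j,k},\boldsymbol R_{j,k},\sigma_{j,k}^2:(j,k)\in\mathcal{T}\}$ given $\mathcal{D}$ is as follows. (i) The marginal posterior of the hidden states $\{(S_{j,k},\boldsymbol R_{j,k}):(j,k)\in\mathcal{T}\}$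 is a Markov tree on the state space $\{0,1\}^{L+1}$ with state transition probabilities $$\Pr(S_{j,k}=s',\boldsymbol R_{j,k}=\boldsymbol r'\mid S_{j-1,\lfloor k/2\rfloor}=s,\boldsymbol R_{j-1,\lfloor k/2\rfloor}=\boldsymbol r,\mathcal{D})=\rho_{j,k}(s,s')\prod_{l=1}^L\kappa_{j,k}(r_l,r_l')\cdot\frac{\phi_{j,k}(s',\boldsymbol r')}{\xi_{j,k}(s,\boldsymbol r)},\quad j=1,\ldots,J,$$ and initial state probabilities $$\Pr(S_{0,0}=s,\boldsymbol R_{0,0}=\boldsymbol r\mid\mathcal{D})=\rho_{0,0}(s)\prod_{l=1}^L\kappa_{0,0}(r_l)\cdot\frac{\phi_{0,0}(s,\boldsymbol r)}{\xi_{0,0}(0,\boldsymbol 0)}.$$ (ii) Given the hidden states and $\mathcal{D}$, the triples $(z_{j,k},\boldsymbol\beta_{j,k},\sigma_{j,k}^2)$ are independent across nodes, and for each node $$[\sigma_{j,k}^2\mid S_{j,k},\boldsymbol R_{j,k},\mathcal{D}]\sim\text{Inv-Gamma}\left(\nu+1+\frac n2,\ \nu\sigma_0^2+\Upsilon_{j,k}(S_{j,k},\boldsymbol R_{j,k})\right),$$ (iii) $$[(z_{j,k},\beta_{1\,j,k}^{(2)},\ldots,\beta_{1\,j,k}^{(G_1)},\ldots,\beta_{L\,j,k}^{(2)},\ldots,\beta_{L\,j,k}^{(G_L)})'\mid\sigma_{j,k}^2,S_{j,k},\boldsymbol R_{j,k},\mathcal{D}]\sim\mathrm{N}\left(\boldsymbol\mu_{j,k}^*(S_{j,k},\boldsymbol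 R_{j,k}),\ \sigma_{j,k}^2\,M(S_{j,k},\boldsymbol R_{j,k})\circ[\Lambda_j^*(S_{j,k},\boldsymbol R_{j,k})]^{-1}\right),$$ where $\circ$ denotes the Hadamard (entrywise) product.
   Context: Tree. Fix an integer $J\ge 0$ and let $\mathcal{T}=\{(j,k): 0\le j\le J,\ 0\le k\le 2^j-1\}$ be the bifurcating tree with root $(0,0)$; the children of $(j,k)$ (for $j<J$) are $(j+1,2k)$ and $(j+1,2k+1)$, and the parent of $(j,k)$ (for $j\ge1$) is $(j-1,\lfloor k/2\rfloor)$. Markov tree (MT). For a finite state space $E$, an initial probability vector $q_{0,0}$ on $E$ and, for each $(j,k)$ with $j\ge1$, a stochastic matrix $q_{j,k}(\cdot,\cdot)$ on $E$, a collection $\{X_{j,k}:(j,k)\in\mathcal{T}\}$ of $E$-valued random variables is an MT with these initial and transition probabilities if for all $(x_{j,k})\in E^{\mathcal{T}}$, $\Pr(X_{j,k}=x_{j,k}\ \forall (j,k)\in\mathcal{T})=q_{0,0}(x_{0,0})\prod_{(j,k):\,j\ge1}q_{j,k}(x_{j-1,\lfloor k/2\rfloor},x_{j,k})$. Conventions. Normal laws may be degenerate (singular covariance); $\mathrm{N}(\mu,0)$ is the point mass at $\mu$. $\text{Inv-Gamma}(a,b)$ has density $\frac{b^a}{\Gamma(a)}x^{-a-1}e^{-b/x}$ on $(0,\infty)$. A prime on a vector or matrix denotes transpose; $\mathbf 1_m$ is the vector of $m$ ones. NIG-MG prior ($L\ge1$ factors, the $l$th having $G_l\ge2$ levels). Hyperparameters: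 $\nu>0$, $\sigma_0^2>0$, $\tau_j=2^{-\alpha j}\tau$, $\upsilon_j^{(l)}=2^{-\alpha j}\upsilon_l$ with $\alpha,\tau,\upsilon_1,\dots,\upsilon_L>0$; probability vectors $\rho_{0,0},\kappa_{0,0}$ on $\{0,1\}$; and $2\times2$ stochastic matrices $\rho_{j,k},\kappa_{j,k}$ (indexed by $\{0,1\}$) for $j\ge1$. The $L+1$ families $\{S_{j,k}\}$, $\{R_{1\,j,k}\},\dots,\{R_{L\,j,k}\}$ are independent $\{0,1\}$-valued MTs, the first with initial/transition probabilities $\rho$, each of the others with initial/transition probabilities $\kappa$. The $\sigma_{j,k}^2$ are independent $\text{Inv-Gamma}(\nu+1,\nu\sigma_0^2)$, independent of the hidden states. Given all hidden states and variances, all the $z_{j,k}$ and $\beta_{l\,j,k}^{(g)}$ ($1\le l\le L$, $2\le g\le G_l$) are independent with $z_{j,k}\sim\mathrm{N}(0,S_{j,k}\tau_j\sigma_{j,k}^2)$ and $\beta_{l\,j,k}^{(g)}\sim\mathrm{N}(0,R_{l\,j,k}\,\upsilon_j^{(l)}\sigma_{j,k}^2)$. Set $\beta_{l\,j,k}^{(1)}=0$, and let $\boldsymbol\beta_{j,k}$ collect all $\beta_{l\,j,k}^{(g)}$ with $g\ge2$. Data model. For each factor combination $\boldsymbol g=(g_1,\dots,g_L)\in\prod_l\{1,\dots,G_l\}$ there are $n_{\boldsymbol g}$ observations; $n=\sum_{\boldsymbol g}n_{\boldsymbol g}$ is the total number. Given all parameters and hidden states, $d_{j,k}^{(\boldsymbol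 g,i)}=z_{j,k}+\sum_{l=1}^L\beta_{l\,j,k}^{(g_l)}+u_{j,k}^{(\boldsymbol g,i)}$, $i=1,\dots,n_{\boldsymbol g}$, with $u_{j,k}^{(\boldsymbol g,i)}\sim\mathrm{N}(0,\sigma_{j,k}^2)$ independent over $\boldsymbol g,i,j,k$. Let $\boldsymbol d_{j,k}\in\mathbb{R}^n$ be the vector of all $d_{j,k}^{(\boldsymbol g,i)}$. Matrices. $\boldsymbol e_g^{(l)}\in\{0,1\}^n$ has $h$th entry $1$ iff the $h$th observation is at level $g$ of factor $l$. For $(s,\boldsymbol r)\in\{0,1\}^{L+1}$: $X(s,\boldsymbol r)=(s\mathbf 1_n,r_1\boldsymbol e_2^{(1)},\dots,r_1\boldsymbol e_{G_1}^{(1)},\dots,r_L\boldsymbol e_2^{(L)},\dots,r_L\boldsymbol e_{G_L}^{(L)})$; $\Lambda_j$ is the diagonal matrix with diagonal $1/\tau_j$, followed by $G_1-1$ copies of $1/\upsilon_j^{(1)}$, ..., followed by $G_L-1$ copies of $1/\upsilon_j^{(L)}$; $M(s,\boldsymbol r)=w w'$ with $w=(s,r_1\mathbf 1_{G_1-1}',\dots,r_L\mathbf 1_{G_L-1}')'$; $\Lambda_j^*(s,\boldsymbol r)=X(s,\boldsymbol r)'X(s,\boldsymbol r)+\Lambda_j$; $\boldsymbol\mu_{j,k}^*(s,\boldsymbol r)=[\Lambda_j^*(s,\boldsymbol r)]^{-1}X(s,\boldsymbol r)'\boldsymbol d_{j,k}$; $\Upsilon_{j,k}(s,\boldsymbol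 r)=\frac12\{\boldsymbol d_{j,k}'\boldsymbol d_{j,k}-[\boldsymbol\mu_{j,k}^*(s,\boldsymbol r)]'\Lambda_j^*(s,\boldsymbol r)\boldsymbol\mu_{j,k}^*(s,\boldsymbol r)\}$. Node-specific marginal likelihood. $m_{j,k}(s,\boldsymbol r)$ is the marginal density of $\boldsymbol d_{j,k}$ given $S_{j,k}=s,\boldsymbol R_{j,k}=\boldsymbol r$ (with $z_{j,k},\boldsymbol\beta_{j,k},\sigma_{j,k}^2$ integrated out); explicitly $$m_{j,k}(s,\boldsymbol r)=\frac{(\nu\sigma_0^2)^{\nu+1}\Gamma(\nu+n/2+1)}{(2\pi)^{n/2}\Gamma(\nu+1)}\cdot\frac{|\Lambda_j|^{1/2}}{|\Lambda_j^*(s,\boldsymbol r)|^{1/2}}\cdot[\nu\sigma_0^2+\Upsilon_{j,k}(s,\boldsymbol r)]^{-\nu-n/2-1}.$$ *)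

(* Defs.v *)
From HB Require Import structures.
From mathcomp Require Import all_boot all_order all_algebra.
From mathcomp Require Import all_classical all_reals all_analysis.

Set Implicit Arguments.
Unset Strict Implicit.
Unset Printing Implicit Defensive.

Import Order.TTheory GRing.Theory Num.Theory.
Import numFieldNormedType.Exports.

Local Open Scope classical_set_scope.
Local Open Scope ring_scope.

(* The node (j, k) has level j and position k.  Families indexed by the tree
   are functions on all of [node]; only their values on [tree J] matter. *)
Definition node := (nat * nat)%type.

Definition tree (J : nat) : seq node :=
  [seq (j, k) | j <- iota 0 J.+1, k <- iota 0 (2 ^ j)].

Lemma mem_tree J (v : node) : (v \in tree J) = (v.1 <= J)%N && (v.2 < 2 ^ v.1)%N.
Proof.
apply/allpairsPdep/andP => [[j [k]]|[hj hk]].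
  by rewrite !mem_iota !add0n ltnS /= => -[hj hk ->].
by exists v.1, v.2; rewrite !mem_iota !add0n ltnS /=; case: v hj hk.
Qed.

Definition rootn : node := (0, 0)%N.
Definition parent (v : node) : node := (v.1.-1, v.2./2).
Definition lchild (v : node) : node := (v.1.+1, v.2.*2).
Definition rchild (v : node) : node := (v.1.+1, v.2.*2.+1).

Definition prob_vec (R : realType) (E : finType) (q : E -> R) : Prop :=
  (forall x, 0 <= q x) /\ \sum_x q x = 1.

Definition MT_prob (R : realType) (E : Type) (J : nat) (q0 : E -> R)
    (q : node -> E -> E -> R) (x : node -> E) : R :=
  q0 (x rootn) * \prod_(v <- tree J | (0 < v.1)%N) q v (x (parent v)) (x v).

Section laws.
Context {R : realType}.

(* [normal_prob] takes a standard deviation and is not a point mass when that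
   is 0, hence the case distinction; the second argument here is a variance. *)
Definition normal_law (m v : R) : set R -> \bar R :=
  if 0 < v then normal_prob m (Num.sqrt v) else \d_m.

Definition gamma_fun (a : R) : R :=
  Rintegral lebesgue_measure `]0, +oo[ (fun x => x `^ (a - 1) * expR (- x)).

Definition inv_gamma_pdf (a b x : R) : R :=
  b `^ a / gamma_fun a * x `^ (- a - 1) * expR (- (b / x)).

Definition inv_gamma (a b : R) (A : set R) : \bar R :=
  (\int[lebesgue_measure]_(x in A `&` [set x | (0 < x)%R]) (inv_gamma_pdf a b x)%:E)%E.

(* Q is N(mu, Sigma), possibly degenerate: under Q every linear combination
   t'x of the coordinates is N(t' mu, t' Sigma t). *)
Definition is_mvnormal (p : nat) (mu : 'cV[R]_p) (Sigma : 'M[R]_p)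
    (Q : set (p.-tuple R) -> \bar R) : Prop :=
  forall (t : 'cV[R]_p) (B : set R), measurable B ->
    Q [set x | B (\sum_(i < p) t i 0 * tnth x i)] =
    normal_law ((t^T *m mu) 0 0) ((t^T *m Sigma *m t) 0 0) B.

Definition hadamard (m n : nat) (A B : 'M[R]_(m, n)) : 'M[R]_(m, n) :=
  map2_mx *%R A B.

End laws.

Section conditioning.
Context {R : realType} {d : measure_display} {Omega : measurableType d}.
Variable P : probability Omega R.

(* Sub-sigma-algebras are passed as generating systems G. *)
Definition gen (d' : measure_display) (T : measurableType d')
    (Y : Omega -> T) : set (set Omega) :=
  preimage_set_system setT Y measurable.

Definition genfam (d' : measure_display) (T : measurableType d') (I : eqType)
    (s : seq I) (Y : I -> Omega -> T) : set (set Omega) :=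
  \bigcup_(i in [set` s]) gen (Y i).

(* f is a version of P(E | sigma(G)) *)
Definition cond_prob (G : set (set Omega)) (E : set Omega) (f : Omega -> R) :
    Prop :=
  (forall B : set R, measurable B -> <<s G >> (f @^-1` B)) /\
  (forall F, <<s G >> F -> P (F `&` E) = (\int[P]_(w in F) (f w)%:E)%E).

(* w |-> K w is a version of the conditional law of Y given sigma(G) *)
Definition cond_law (G : set (set Omega)) (d' : measure_display)
    (T : measurableType d') (Y : Omega -> T) (K : Omega -> set T -> \bar R) :
    Prop :=
  forall B : set T, measurable B ->
    cond_prob G (Y @^-1` B) (fun w => fine (K w B)).

(* Given sigma(G), the Y i (i in s) are independent with laws K i w *)
Definition cond_indep_laws (G : set (set Omega)) (I : eqType) (s : seq I)
    (Y : I -> Omega -> R) (K : I -> Omega -> set R -> \bar R) : Prop :=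
  forall B : I -> set R, (forall i, measurable (B i)) ->
    cond_prob G [set w | forall i, i \in s -> B i (Y i w)]
      (fun w => \prod_(i <- s) fine (K i w (B i))).

(* Given sigma(G), the sigma-algebras sigma(C i) (i in s) are independent *)
Definition cond_indep (G : set (set Omega)) (I : eqType) (s : seq I)
    (C : I -> set (set Omega)) : Prop :=
  forall E : I -> set Omega, (forall i, i \in s -> <<s C i >> (E i)) ->
    exists f : I -> Omega -> R,
      (forall i, i \in s -> cond_prob G (E i) (f i)) /\
      cond_prob G (\bigcap_(i in [set` s]) E i)
        (fun w => \prod_(i <- s) f i w).

Definition indep (I : eqType) (s : seq I) (C : I -> set (set Omega)) : Prop :=
  forall E : I -> set Omega, (forall i, i \in s -> <<s C i >> (E i)) ->
    fine (P (\bigcap_(i in [set` s]) E i)) = \prod_(i <- s) fine (P (E i)).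

Definition is_MT (E : Type) (J : nat) (q0 : E -> R) (q : node -> E -> E -> R)
    (X : node -> Omega -> E) : Prop :=
  forall x : node -> E,
    P [set w | forall v, v \in tree J -> X v w = x v] = (MT_prob J q0 q x)%:E.

(* Given sigma(G), X is an MT with the (random) initial and transition
   probabilities q0 w, q w *)
Definition cond_is_MT (G : set (set Omega)) (E : Type) (J : nat)
    (q0 : Omega -> E -> R) (q : Omega -> node -> E -> E -> R)
    (X : node -> Omega -> E) : Prop :=
  forall x : node -> E,
    cond_prob G [set w | forall v, v \in tree J -> X v w = x v]
      (fun w => MT_prob J (q0 w) (q w) x).

End conditioning.

Record hyper (R : realType) (L : nat) := Hyper {
  nu : R;
  sigma02 : R;
  alpha : R;
  tau : R;
  upsilon : 'I_L -> R;
  rho0 : bool -> R;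
  kappa0 : bool -> R;
  rho : node -> bool -> bool -> R;
  kappa : node -> bool -> bool -> R }.

Record valid_hyper (R : realType) (L J : nat) (h : hyper R L) : Prop := {
  nu_gt0 : 0 < nu h;
  sigma02_gt0 : 0 < sigma02 h;
  alpha_gt0 : 0 < alpha h;
  tau_gt0 : 0 < tau h;
  upsilon_gt0 : forall l, 0 < upsilon h l;
  rho0_prob : prob_vec (rho0 h);
  kappa0_prob : prob_vec (kappa0 h);
  rho_stoch : forall v, v \in tree J -> (0 < v.1)%N ->
    forall s, prob_vec (rho h v s);
  kappa_stoch : forall v, v \in tree J -> (0 < v.1)%N ->
    forall r, prob_vec (kappa h v r) }.

Definition state (L : nat) := (bool * {ffun 'I_L -> bool})%type.

(* Combinations (g_1, ..., g_L) of levels, stored 0-based: the element i of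
   'I_(G l) stands for level i + 1 of factor l. *)
Definition combo (L : nat) (G : 'I_L -> nat) := {dffun forall l, 'I_(G l)}.

(* All observations (g, i), 1 <= i <= n_g *)
Definition obs (L : nat) (G : 'I_L -> nat) (ng : combo G -> nat) :=
  {g : combo G & 'I_(ng g)}.

Definition level (L : nat) (G : 'I_L -> nat) (ng : combo G -> nat)
    (o : obs ng) (l : 'I_L) : nat := (tag o l).+1.

Section model_matrices.
Context {R : realType} {L : nat}.
Variables (J : nat) (G : 'I_L -> nat) (ng : combo G -> nat) (h : hyper R L).

(* Total number of observations; the observation number i is [enum_val i] *)
Definition nobs : nat := #|{: obs ng}|.

Lemma nobsE : nobs = (\sum_(g : combo G) ng g)%N.
Proof.
rewrite /nobs card_tagged sumnE big_map big_enum.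
by apply: eq_bigr => g _; rewrite card_ord.
Qed.

(* Number of coefficients at a node: z and all beta_l^(g) with g >= 2 *)
Definition ncoef : nat := (1 + \sum_(l < L) (G l).-1)%N.

Definition tau_at (j : nat) : R := 2 `^ (- (alpha h * j%:R)) * tau h.
Definition upsilon_at (j : nat) (l : 'I_L) : R :=
  2 `^ (- (alpha h * j%:R)) * upsilon h l.

Definition evec (l : 'I_L) (g : nat) : 'cV[R]_nobs :=
  \col_i (level (enum_val i : obs ng) l == g)%:R.

Definition Xmat (x : state L) : 'M[R]_(nobs, ncoef) :=
  row_mx (const_mx x.1%:R)
    (\mxrow_(l < L) \matrix_(i < nobs, g < (G l).-1)
       ((x.2 l)%:R * evec l g.+2 i 0)).

Definition Lambda (j : nat) : 'M[R]_ncoef :=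
  diag_mx (row_mx (const_mx (tau_at j)^-1)
             (\mxrow_(l < L) (const_mx (upsilon_at j l)^-1 : 'rV_(G l).-1))).

Definition Mmat (x : state L) : 'M[R]_ncoef :=
  let w : 'cV[R]_ncoef :=
    col_mx (const_mx x.1%:R)
      (\mxcol_(l < L) (const_mx (x.2 l)%:R : 'cV_(G l).-1)) in
  w *m w^T.

Definition Lambda_star (j : nat) (x : state L) : 'M[R]_ncoef :=
  (Xmat x)^T *m Xmat x + Lambda j.

Definition mu_star (j : nat) (dv : 'cV[R]_nobs) (x : state L) : 'cV[R]_ncoef :=
  invmx (Lambda_star j x) *m (Xmat x)^T *m dv.

Definition Upsilon (j : nat) (dv : 'cV[R]_nobs) (x : state L) : R :=
  2^-1 * (dv^T *m dv
          - (mu_star j dv x)^T *m Lambda_star j x *m mu_star j dv x) 0 0.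

Definition marg_lik (j : nat) (dv : 'cV[R]_nobs) (x : state L) : R :=
  ((nu h * sigma02 h) `^ (nu h + 1) * gamma_fun (nu h + nobs%:R / 2 + 1))
    / ((2 * pi) `^ (nobs%:R / 2) * gamma_fun (nu h + 1))
  * (Num.sqrt (\det (Lambda j)) / Num.sqrt (\det (Lambda_star j x)))
  * (nu h * sigma02 h + Upsilon j dv x) `^ (- nu h - nobs%:R / 2 - 1).

Definition prior_trans (v : node) (x y : state L) : R :=
  rho h v x.1 y.1 * \prod_(l < L) kappa h v (x.2 l) (y.2 l).
Definition prior_init (y : state L) : R :=
  rho0 h y.1 * \prod_(l < L) kappa0 h (y.2 l).

(* Here D v is the data vector at node v.  [phi_rec i] is phi at a node of
   level J - i. *)
Fixpoint phi_rec (i : nat) (D : node -> 'cV[R]_nobs) (v : node) (x : state L) :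
    R :=
  match i with
  | 0 => marg_lik v.1 (D v) x
  | i'.+1 =>
      marg_lik v.1 (D v) x
      * (\sum_(y : state L) prior_trans (lchild v) x y
                            * phi_rec i' D (lchild v) y)
      * (\sum_(y : state L) prior_trans (rchild v) x y
                            * phi_rec i' D (rchild v) y)
  end.

Definition phi (D : node -> 'cV[R]_nobs) (v : node) (x : state L) : R :=
  phi_rec (J - v.1) D v x.

Definition xi (D : node -> 'cV[R]_nobs) (v : node) (x : state L) : R :=
  if (0 < v.1)%N then \sum_(y : state L) prior_trans v x y * phi D v y
  else \sum_(y : state L) prior_init y * phi D v y.

Lemma phi_leaf D v x : v.1 = J -> phi D v x = marg_lik v.1 (D v) x.
Proof.
move=> vJ; have e : (J - v.1)%N = 0%N by rewrite vJ subnn.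
by rewrite /phi e.
Qed.

Lemma phi_inner D v x : (v.1 < J)%N ->
  phi D v x = marg_lik v.1 (D v) x * xi D (lchild v) x * xi D (rchild v) x.
Proof.
move=> vJ; have e : (J - v.1)%N = (J - v.1.+1).+1 by rewrite subnSK.
by rewrite /xi /phi e.
Qed.

Definition post_trans (D : node -> 'cV[R]_nobs) (v : node) (x y : state L) :
    R :=
  prior_trans v x y * (phi D v y / xi D v x).
Definition post_init (D : node -> 'cV[R]_nobs) (y : state L) : R :=
  prior_init y * (phi D rootn y / xi D rootn (false, [ffun=> false])).

End model_matrices.

Section model.
Context {R : realType} {d : measure_display} {Omega : measurableType d}.
Variable P : probability Omega R.
Variables (J L : nat) (G : 'I_L -> nat) (ng : combo G -> nat) (h : hyper R L).
(* beta l g v is beta_{l,v}^(g), with g numbered from 1 as in the model *)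
Variables (S : node -> {RV P >-> bool}) (Rh : 'I_L -> node -> {RV P >-> bool})
  (sig2 z : node -> {RV P >-> R}) (beta : 'I_L -> nat -> node -> {RV P >-> R})
  (u data : node -> obs ng -> {RV P >-> R}).

Definition hidden (v : node) (w : Omega) : state L :=
  (S v w, [ffun l => Rh l v w]).

Definition data_vec (w : Omega) (v : node) : 'cV[R]_(nobs ng) :=
  \col_i data v (enum_val i) w.

Definition coef_vec (v : node) (w : Omega) : 'cV[R]_(ncoef G) :=
  col_mx (const_mx (z v w))
    (\mxcol_(l < L) \col_(g < (G l).-1) beta l g.+2 v w).

Definition coef_tuple (v : node) (w : Omega) : (ncoef G).-tuple R :=
  [tuple coef_vec v w i 0 | i < ncoef G].

(* None stands for z, Some (l, g) for beta_l^(g) *)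
Definition coef_idx : seq (option ('I_L * nat)) :=
  None :: [seq Some (l, g) | l <- enum 'I_L, g <- iota 2 (G l).-1].

Definition coef (i : node * option ('I_L * nat)) : Omega -> R :=
  if i.2 is Some (l, g) then beta l g i.1 else z i.1.

Definition coef_prior (i : node * option ('I_L * nat)) (w : Omega) :
    set R -> \bar R :=
  let v := i.1 in
  if i.2 is Some (l, _)
  then normal_law 0 ((Rh l v w)%:R * upsilon_at h v.1 l * sig2 v w)
  else normal_law 0 ((S v w)%:R * tau_at h v.1 * sig2 v w).

Definition gen_hidden (s : seq node) : set (set Omega) :=
  genfam s S `|` \bigcup_(l in [set: 'I_L]) genfam s (Rh l).

Definition gen_coef (s : seq node) : set (set Omega) :=
  genfam [seq (v, c) | v <- s, c <- coef_idx] coef.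

Definition gen_data : set (set Omega) :=
  genfam [seq (v, o) | v <- tree J, o <- enum {: obs ng}]
    (fun i => data i.1 i.2).

Record NIG_MG : Prop := {
  S_MT : is_MT P J (rho0 h) (rho h) S;
  R_MT : forall l, is_MT P J (kappa0 h) (kappa h) (Rh l);
  hidden_indep : indep P (enum {: option 'I_L})
    (fun o => if o is Some l then genfam (tree J) (Rh l)
              else genfam (tree J) S);
  sig2_law : forall v : node, v \in tree J -> forall A, measurable A ->
    P (sig2 v @^-1` A) = inv_gamma (nu h + 1) (nu h * sigma02 h) A;
  sig2_indep : indep P (None :: [seq Some v | v <- tree J])
    (fun o => if o is Some v then gen (sig2 v) else gen_hidden (tree J));
  coef_law : cond_indep_laws P (gen_hidden (tree J) `|` genfam (tree J) sig2)
    [seq (v, c) | v <- tree J, c <- coef_idx] coef coef_prior;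
  beta1 : forall l (v : node) w, v \in tree J -> beta l 1 v w = 0;
  noise_law : cond_indep_laws P
    (gen_hidden (tree J) `|` genfam (tree J) sig2 `|` gen_coef (tree J))
    [seq (v, o) | v <- tree J, o <- enum {: obs ng}]
    (fun i => u i.1 i.2) (fun i w => normal_law 0 (sig2 i.1 w));
  data_eq : forall (v : node) o w, v \in tree J ->
    data v o w = z v w + \sum_(l < L) beta l (level o l) v w + u v o w }.

End model.

(* Main.v *)
(* At a single node write the coefficients as w .* theta, with w the 0/1 vector
   of active coordinates and theta ~ N(0, sigma^2 Lambda^-1) nondegenerate;
   then d = X(s, r) theta + u and everything has a density.  Completing the
   square turns prior density times likelihood into
   marginal(d) * InvGamma(sigma^2) * N(theta; mu*, sigma^2 (Lambda* )^-1),
   and masking theta by w gives the Hadamard product in the covariance.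

   The joint law of hidden states, variances, coefficients and data is
   prior(x) * prod_v Q_v(x_v), with Q_v(e) the law at node v in state e.  Hence
   given all hidden states and the data the nodes separate, which gives (ii)
   and (iii).  For (i), prior(x) * prod_v m_v(x_v) equals the Markov tree
   probability with the posterior transitions times a factor xi_{0,0} that does
   not depend on x, because the xi telescope along the tree; these
   probabilities sum to 1 over x, and marginalising the last nodes of the tree
   one at a time gives the transition probabilities. *)
Require Import Defs.
From HB Require Import structures.
From mathcomp Require Import all_boot all_order all_algebra.
From mathcomp Require Import all_classical all_reals all_analysis.
From mathcomp Require Import measurable_realfun lra ring.

Set Implicit Arguments.
Unset Strict Implicit.
Unset Printing Implicit Defensive.

Import Order.TTheory GRing.Theory Num.Theory.
Import numFieldNormedType.Exports.

Local Open Scope classical_set_scope.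
Local Open Scope ring_scope.

(** * Measures with densities and image measures *)

Section measure_tools.
Context d (T : measurableType d) (R : realType).
Local Open Scope ereal_scope.

(** The coefficients may have atoms and conditioning is on sigma-algebras, so no joint density of
    the whole model is formed. A conditional probability is verified by equating two integrals over
    a pi-system of conditioning events. These events are described node by node, so the check
    reduces to one identity per node and state, integrated against [nodeQ]. That law is used in two
    coordinate systems: (variance, coefficients, noise), in which the model is specified, and the
    data followed by the posterior of the rest, in which Bayes' formula applies.

    For the hidden states the marginal likelihood m_e enters as a test function: for a set C of
    data, the integral of 1_C m_e under the node law in state e' is the Lebesgue integral of 1_C m_e
    m_e', which is symmetric in e and e'. This symmetry takes the place of a density for the data of
    the whole tree.

    Nodes are listed by level, so every parent precedes its children and the last node of an initial
    segment influences no other factor. One summation lemma then serves both probabilities and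
    indicators of hidden states. *)

Definition weighted (mu : {measure set T -> \bar R}) (f : T -> R)
  (f0 : forall x, (0 <= f x)%R) (mf : measurable_fun setT f) :
  set T -> \bar R := fun A => \int[mu]_(x in A) (f x)%:E.

Section weighted.
Variables (mu : {measure set T -> \bar R}) (f : T -> R).
Hypotheses (f0 : forall x, (0 <= f x)%R) (mf : measurable_fun setT f).

Let weighted0 : weighted mu f0 mf set0 = 0.
Proof. by rewrite /weighted integral_set0. Qed.

Let weighted_ge0 A : 0 <= weighted mu f0 mf A.
Proof. by apply: integral_ge0 => x _; rewrite lee_fin. Qed.

Let weighted_sigma_additive : semi_sigma_additive (weighted mu f0 mf).
Proof.
move=> A mA tA mUA; rewrite /weighted ge0_integral_bigcup//; last 2 first.
- exact/measurable_EFinP/measurable_funTS.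
- by move=> x _; rewrite lee_fin.
apply: is_cvg_ereal_nneg_natsum_cond => n _ _; by apply: integral_ge0 => x _; rewrite lee_fin.
Qed.

HB.instance Definition _ := isMeasure.Build _ _ _
  (weighted mu f0 mf) weighted0 weighted_ge0 weighted_sigma_additive.

Import HBNNSimple.

(** Monotone convergence reduces the change of density to simple functions, where both sides are
    finite sums of integrals of indicators. *)
Lemma integral_weighted (g : T -> \bar R) :
  (forall x, 0 <= g x) -> measurable_fun setT g ->
  \int[weighted mu f0 mf]_x g x = \int[mu]_x (g x * (f x)%:E).
Proof.
move=> g0 mg; pose g_ := nnsfun_approx measurableT mg.
transitivity (limn (fun n => \int[weighted mu f0 mf]_x (g_ n x)%:E)).
  rewrite -monotone_convergence//.
  - apply: eq_integral => y _; apply/esym/cvg_lim => //.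
    exact: cvg_nnsfun_approx.
  - by move=> n; exact/measurable_EFinP/measurable_funP.
  - by move=> n y _; rewrite lee_fin.
  - by move=> y _ m n mn; rewrite lee_fin; exact/lefP/nd_nnsfun_approx.
rewrite [X in limn X](_ : _ = (fun n => \int[mu]_x ((g_ n x)%:E * (f x)%:E))).
  rewrite -monotone_convergence//.
  - apply: eq_integral => x _; apply/cvg_lim => //.
    apply: cvgeZr => //; exact: cvg_nnsfun_approx.
  - by move=> n; apply: emeasurable_funM => //; exact/measurable_EFinP.
  - by move=> n x _; rewrite mule_ge0// lee_fin.
  - move=> x _ m n mn; rewrite lee_wpmul2r// lee_fin//.
    exact/lefP/nd_nnsfun_approx.
apply/funext => n.
under [LHS]eq_integral do rewrite fimfunE -fsumEFin//.
rewrite ge0_integral_fsum//; last 2 first.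
  - by move=> y; exact/measurable_EFinP/measurable_funM.
  - by move=> y x _; rewrite nnfun_muleindic_ge0.
have mA r : measurable (g_ n @^-1` [set r]) by exact: measurable_sfunP.
transitivity (\sum_(r \in range (g_ n))
    \int[mu]_x ((r * \1_(g_ n @^-1` [set r]) x)%:E * (f x)%:E)).
  apply: eq_fsbigr => r; rewrite inE => -[t _ rt].
  rewrite integralZl_indic_nnsfun//= integral_indic// setIT.
  under [RHS]eq_integral do rewrite EFinM -muleA.
  rewrite ge0_integralZl//; first last.
  - by rewrite lee_fin -rt.
  - by move=> x _; rewrite mule_ge0// lee_fin.
  - by apply: emeasurable_funM => //; exact/measurable_EFinP.
  congr (_ * _); rewrite [LHS]integral_mkcond; apply: eq_integral => x _.
  by rewrite patchE indicE; case: ifPn => _; rewrite ?mul1e ?mul0e.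
rewrite -ge0_integral_fsum//.
- apply: eq_integral => x _; rewrite [in RHS]fimfunE -fsumEFin//.
  by rewrite ge0_mule_fsuml// => r; rewrite nnfun_muleindic_ge0.
- by move=> r; apply: emeasurable_funM; apply/measurable_EFinP => //; apply: measurable_funM.
- move=> r x _; rewrite mule_ge0 ?lee_fin//.
  by have := nnfun_muleindic_ge0 (g_ n) r x; rewrite -EFinM lee_fin.
Qed.

End weighted.

(** Dynkin's uniqueness theorem; since [setT] lies in [G] and has finite mass, the constant sequence
    [setT] serves as the exhausting sequence. *)
Lemma finite_measure_unique (m1 m2 : {measure set T -> \bar R})
    (G : set (set T)) :
  G `<=` measurable -> setI_closed G -> G setT -> m1 setT < +oo ->
  (forall A, G A -> m1 A = m2 A) -> forall A, <<s G >> A -> m1 A = m2 A.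
Proof.
move=> Gm GI GT m1T m12.
apply: (g_sigma_algebra_measure_unique G Gm (fun=> setT)) => //.
by rewrite bigcup_const.
Qed.

(** The proof of unit mass is part of the term, so that a probability structure can be inferred from
    it; this is how [coefK] becomes a kernel of probabilities. *)
Definition as_probability (m : {measure set T -> \bar R}) of m setT = 1 :
  set T -> \bar R := m.

Section as_probability.
Variables (m : {measure set T -> \bar R}) (m1 : m setT = 1).
HB.instance Definition _ := Measure.on (as_probability m1).
HB.instance Definition _ := Measure_isProbability.Build _ _ _
  (as_probability m1) m1.
End as_probability.

End measure_tools.

(** The measurability proof is part of the term, so that the measure structure can be inferred from
    it. *)
Definition image_measure d1 d2 (T1 : measurableType d1)
    (T2 : measurableType d2) (R : realType) (m : set T1 -> \bar R)
    (f : T1 -> T2) (mf : measurable_fun setT f) : set T2 -> \bar R :=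
  pushforward m f.

Section image_measure.
Context d1 d2 (T1 : measurableType d1) (T2 : measurableType d2) (R : realType).
Variables (m : {measure set T1 -> \bar R}) (f : T1 -> T2).
Hypothesis mf : measurable_fun setT f.

Let image_measure0 : image_measure m mf set0 = 0%E.
Proof. by rewrite /image_measure /pushforward preimage_set0 measure0. Qed.

Let image_measure_ge0 A : (0 <= image_measure m mf A)%E.
Proof. exact: measure_ge0. Qed.

Let image_measure_sigma_additive : semi_sigma_additive (image_measure m mf).
Proof.
have mpre A : measurable A -> measurable (f @^-1` A).
  by move=> mA; rewrite -[X in measurable X]setTI; exact: mf.
move=> F mF tF mUF; rewrite /image_measure /pushforward preimage_bigcup.
apply: measure_semi_sigma_additive.
- by move=> n; exact: mpre.
- apply/trivIsetP => /= i j _ _ ij; rewrite -preimage_setI.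
  by move/trivIsetP : tF => /(_ _ _ _ _ ij) ->//; rewrite preimage_set0.
- by rewrite -preimage_bigcup; exact: mpre.
Qed.

HB.instance Definition _ := isMeasure.Build _ _ _ (image_measure m mf)
  image_measure0 image_measure_ge0 image_measure_sigma_additive.

Lemma integral_image_measure (g : T2 -> \bar R) :
  (forall x, 0 <= g x)%E -> measurable_fun setT g ->
  (\int[image_measure m mf]_x g x = \int[m]_x g (f x))%E.
Proof. by move=> g0 mg; rewrite ge0_integral_pushforward. Qed.

End image_measure.

(** * Lebesgue measure on tuples *)

Section lebR.
Context (R : realType).
Local Open Scope ereal_scope.

Let measurable_idR : measurable_fun [set: measurableTypeR R] (id : measurableTypeR R -> R).
Proof. by move=> _ A mA; rewrite setTI preimage_id. Qed.

(* [lebesgue_measure] lives on [measurableTypeR R], whose display differs from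
   that of the canonical measurable structure of [R]; this is its copy there. *)
Definition lebR : set R -> \bar R := image_measure (@lebesgue_measure R) measurable_idR.

HB.instance Definition _ := Measure.on lebR.

Lemma lebRE A : lebR A = lebesgue_measure A.
Proof. by rewrite /lebR /image_measure /pushforward preimage_id. Qed.

Let lebR_sigma_finite : sigma_finite setT lebR.
Proof.
have /sigma_finiteP[F [TF ndF Foo]] := sigma_finiteT (@lebesgue_measure R).
exists F => // k; have [mF Fk] := Foo k; split => //.
Qed.

HB.instance Definition _ := Measure_isSigmaFinite.Build _ _ _ lebR lebR_sigma_finite.

Lemma integral_lebR (f : R -> \bar R) :
  (forall x, 0 <= f x) -> measurable_fun setT f ->
  \int[lebR]_x f x = \int[lebesgue_measure]_x f x.
Proof. by move=> f0 mf; rewrite /lebR integral_image_measure. Qed.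

Lemma lebR_unique (m : {measure set R -> \bar R}) :
  (forall X, ocitv X -> lebR X = m X) -> forall A, measurable A -> lebR A = m A.
Proof.
have mid : measurable_fun [set: R] (id : R -> measurableTypeR R).
  by move=> _ A mA; rewrite setTI preimage_id.
move=> h A mA; rewrite lebRE.
rewrite (lebesgue_measure_unique (mu := image_measure m mid))// => X; exact: h.
Qed.

Let measurable_affine (a b : R) : measurable_fun setT (fun x : R => (a * x + b)%R).
Proof. by apply: measurable_funD => //; exact: measurable_funM. Qed.

Lemma integral_lebR_affine (a b : R) (f : R -> \bar R) : (a != 0)%R ->
  measurable_fun setT f -> (forall x, 0 <= f x) ->
  \int[lebR]_x f (a * x + b)%R = (`|a|^-1)%:E * \int[lebR]_x f x.
Proof.
move=> a0 mf f0.
have na0 : (0 < `|a|)%R by rewrite normr_gt0.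
(* By uniqueness of Lebesgue measure it suffices that |a| times its image under the affine map
   agrees with it on half-open intervals. *)
pose m := mscale (NngNum (normr_ge0 a)) (image_measure lebR (measurable_affine a b)).
have mE A : measurable A -> lebR A = m A.
  apply: lebR_unique => X /ocitvP[->|[[c d]] /= cd ->].
    by rewrite !measure0.
  rewrite /m /mscale /= /image_measure /pushforward.
  have [ap|an] := ltrP 0 a.
    rewrite (_ : _ @^-1` _ = `](c - b) / a, (d - b) / a]%classic%R).
      rewrite !lebRE !lebesgue_measure_itv/= !lte_fin cd ltr_pM2r ?invr_gt0// ltrD2r cd.
      by rewrite gtr0_norm// -!EFinD -EFinM; congr EFin; field; rewrite gt_eqF.
    apply/seteqP; split => x /=; rewrite !in_itv/=;
      by rewrite ltr_pdivrMr// ler_pdivlMr// ltrBlDr lerBrDr mulrC.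
  have {}an : (a < 0)%R by rewrite lt_neqAle a0.
  (* For negative [a] the endpoints are swapped and the preimage is closed on the left instead; its
     length is the same. *)
  rewrite (_ : _ @^-1` _ = `[(d - b) / a, (c - b) / a[%classic%R).
    rewrite !lebRE !lebesgue_measure_itv/= !lte_fin cd ltr_nM2r ?invr_lt0// ltrD2r cd.
    by rewrite ltr0_norm// -!EFinD -EFinM; congr EFin; field; rewrite lt_eqF.
  apply/seteqP; split => x /=; rewrite !in_itv/=;
    by rewrite ltr_ndivlMr// ler_ndivrMr// ltrBlDr lerBrDr andbC mulrC.
have -> : \int[lebR]_x f x = \int[m]_x f x.
  by apply: eq_measure_integral => A mA _; exact: mE.
rewrite /m ge0_integral_mscale//=.
rewrite (integral_image_measure lebR (measurable_affine a b))// muleA -EFinM.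
by rewrite mulVf ?gt_eqF// mul1e.
Qed.

Lemma integral_lebRD (b : R) (f : R -> \bar R) :
  measurable_fun setT f -> (forall x, 0 <= f x) ->
  \int[lebR]_x f (x + b)%R = \int[lebR]_x f x.
Proof.
move=> mf f0; have := integral_lebR_affine b (oner_neq0 R) mf f0.
rewrite normr1 invr1 mul1e => <-.
by apply: eq_integral => x _; rewrite mul1r.
Qed.

End lebR.
Arguments lebR {R}.

Section prodm.
Context d1 d2 (T1 : measurableType d1) (T2 : measurableType d2) (R : realType).
Variables (m1 : {sigma_finite_measure set T1 -> \bar R})
  (m2 : {sigma_finite_measure set T2 -> \bar R}).

(* The canonical [{sigma_finite_measure _}] structure that the library attaches
   to [m1 \x m2] only applies to sub-probabilities. *)
Definition prodm : set (T1 * T2) -> \bar R := (m1 \x m2)%E.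

HB.instance Definition _ := Measure.on prodm.

Let prodm_sigma_finite : sigma_finite setT prodm.
Proof.
have [F TF Foo] := sigma_finiteT m1; have [G TG Goo] := sigma_finiteT m2.
(* The doubly indexed rectangles are enumerated by coding pairs as integers; a number that codes no
   pair yields the empty set. *)
pose FG k := if unpickle k is Some (i, j) then F i `*` G j else set0.
exists FG.
  apply/seteqP; split => // -[x y] _.
  have : [set: T1] x by []. rewrite TF => -[i _ Fx].
  have : [set: T2] y by []. rewrite TG => -[j _ Gy].
  by exists (pickle (i, j)) => //; rewrite /FG pickleK.
move=> k; rewrite /FG; case: unpickle => [[i j]|]; last by rewrite measure0.
have [mF Fi] := Foo i; have [mG Gj] := Goo j; split; first exact: measurableX.
by rewrite /prodm product_measure1E// lte_mul_pinfty// ge0_fin_numE.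
Qed.

HB.instance Definition _ :=
  Measure_isSigmaFinite.Build _ _ _ prodm prodm_sigma_finite.

Section tonelli.
Variable f : T1 -> T2 -> \bar R.
Hypotheses (f0 : forall x y, (0 <= f x y)%E)
  (mf : measurable_fun setT (fun p : T1 * T2 => f p.1 p.2)).

Let f0' (p : T1 * T2) : (0 <= f p.1 p.2)%E. Proof. exact: f0. Qed.

Lemma measurable_integralr : measurable_fun setT (fun x => (\int[m2]_y f x y)%E).
Proof.
exact: (measurable_fun_fubini_tonelli_F _ mf f0').
Qed.

Lemma tonelli :
  (\int[m1]_x \int[m2]_y f x y = \int[m2]_y \int[m1]_x f x y)%E.
Proof. exact: (fubini_tonelli (m1 := m1) (m2 := m2) _ mf f0'). Qed.

Lemma integral_prodm :
  (\int[prodm]_p f p.1 p.2 = \int[m1]_x \int[m2]_y f x y)%E.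
Proof. exact: (fubini_tonelli1 (m1 := m1) (m2 := m2) _ mf f0'). Qed.

End tonelli.

End prodm.

Section lebn.
Context (R : realType).
Local Notation mu := (@lebR R).
Local Open Scope ereal_scope.

Lemma measurable_cons_tuple n :
  measurable_fun [set: R * n.-tuple R]
    (fun p : R * n.-tuple R => [tuple of p.1 :: p.2]).
Proof. exact: measurable_cons. Qed.

Definition cons_lebesgue n (m : {sigma_finite_measure set (n.-tuple R) -> \bar R}) :
  set (n.+1.-tuple R) -> \bar R := image_measure (prodm mu m) (@measurable_cons_tuple n).

Section cons_lebesgue.
Variables (n : nat) (m : {sigma_finite_measure set (n.-tuple R) -> \bar R}).
HB.instance Definition _ := Measure.on (cons_lebesgue m).

Let cons_lebesgue_sigma_finite : sigma_finite setT (cons_lebesgue m).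
Proof.
have /sigma_finiteP[F [TF ndF Foo]] := sigma_finiteT (prodm mu m).
pose un (t : n.+1.-tuple R) := (thead t, [tuple of behead t]).
have mun : measurable_fun [set: n.+1.-tuple R] un.
  by apply: measurable_fun_pair; [exact: measurable_tnth|exact: measurable_behead].
exists (fun k => un @^-1` (F k)).
  apply/seteqP; split => // t _.
  have : [set: R * n.-tuple R] (un t) by [].
  by rewrite TF => -[k _ Fk]; exists k.
move=> k; have [mF Fk] := Foo k; split.
  by rewrite -[X in measurable X]setTI; exact: mun.
rewrite /cons_lebesgue /image_measure /pushforward.
rewrite -comp_preimage (_ : un \o _ = id) ?preimage_id//.
by apply/funext => -[x t]; rewrite /un /= theadE; congr pair; exact/val_inj.
Qed.

HB.instance Definition _ := Measure_isSigmaFinite.Build _ _ _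
  (cons_lebesgue m) cons_lebesgue_sigma_finite.
End cons_lebesgue.

(** Lebesgue measure on R^n, built coordinate by coordinate from the unit mass on the empty tuple,
    so that integrals can be treated by induction on the dimension. *)
Fixpoint lebn n : {sigma_finite_measure set (n.-tuple R) -> \bar R} :=
  if n is n'.+1 then cons_lebesgue (lebn n') else \d_ [tuple].

Lemma measurable_tuple0 d (T : measurableType d) (f : 0.-tuple R -> T) :
  measurable_fun setT f.
Proof.
rewrite (_ : f = cst (f [tuple])); first exact: measurable_cst.
by apply/funext => t; rewrite (tuple0 t).
Qed.

Lemma integral_lebn0 (f : 0.-tuple R -> \bar R) : \int[lebn 0]_t f t = f [tuple].
Proof. by rewrite integral_dirac ?diracT ?mul1e//; exact: measurable_tuple0. Qed.

Lemma integral_lebnS n (f : n.+1.-tuple R -> \bar R) :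
  (forall t, 0 <= f t) -> measurable_fun setT f ->
  \int[lebn n.+1]_t f t = \int[mu]_x \int[lebn n]_t f [tuple of x :: t].
Proof.
move=> f0 mf; rewrite /= /cons_lebesgue integral_image_measure//.
apply: (integral_prodm mu (lebn n) (f := fun x (t : n.-tuple R) => f [tuple of x :: t])) => //.
exact: (measurableT_comp mf (@measurable_cons_tuple n)).
Qed.

Lemma integral_lebnS2 n (f : n.+1.-tuple R -> \bar R) :
  (forall t, 0 <= f t) -> measurable_fun setT f ->
  \int[lebn n.+1]_t f t = \int[lebn n]_t \int[mu]_x f [tuple of x :: t].
Proof.
move=> f0 mf; rewrite integral_lebnS//.
apply: (tonelli mu (lebn n) (f := fun x (t : n.-tuple R) => f [tuple of x :: t])) => //.
exact: (measurableT_comp mf (@measurable_cons_tuple n)).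
Qed.

Lemma measurable_tuple_map2 n (g : 'I_n -> R -> R) :
  (forall i, measurable_fun setT (g i)) ->
  measurable_fun [set: n.-tuple R]
    (fun t => [tuple g i (tnth t i) | i < n]).
Proof.
move=> mg; apply/measurable_fun_tnthP => i.
rewrite (_ : _ \o _ = g i \o (fun t => tnth t i)).
  apply: measurableT_comp => //; exact: measurable_tnth.
by apply/funext => t /=; rewrite tnth_mktuple.
Qed.

Lemma integral_lebn_prod n (f : 'I_n -> R -> R) :
  (forall i x, (0 <= f i x)%R) -> (forall i, measurable_fun setT (f i)) ->
  (forall i, \int[mu]_x (f i x)%:E < +oo) ->
  \int[lebn n]_t (\prod_(i < n) f i (tnth t i))%:E =
  (\prod_(i < n) fine (\int[mu]_x (f i x)%:E))%:E.
Proof.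
elim: n f => [|n IH] f f0 mf foo.
  by rewrite integral_lebn0 !big_ord0.
have mp k (F : 'I_k -> R -> R) : (forall i, measurable_fun setT (F i)) ->
    measurable_fun [set: k.-tuple R] (fun t => (\prod_(i < k) F i (tnth t i))%:E).
  move=> mF; apply/measurable_EFinP; apply: measurable_prod => i _.
  by apply: measurableT_comp => //; exact: measurable_tnth.
rewrite integral_lebnS//; first last.
- exact: mp.
- by move=> t; rewrite lee_fin prodr_ge0.
under eq_integral => x _.
  under eq_integral => t _ do (rewrite big_ord_recl (tnth0 x); under eq_bigr => i _ do rewrite tnthS; rewrite EFinM).
  rewrite ge0_integralZl//; first last.
  - by rewrite lee_fin.
  - by move=> t _; rewrite lee_fin prodr_ge0.
  - exact: (mp n (fun i => f (lift ord0 i))).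
  rewrite (IH (fun i => f (lift ord0 i)))//.
  over.
rewrite ge0_integralZr//; first last.
- by rewrite lee_fin prodr_ge0// => i _; rewrite fine_ge0// integral_ge0// => y _; rewrite lee_fin.
- by move=> x _; rewrite lee_fin.
- exact/measurable_EFinP.
rewrite big_ord_recl EFinM fineK// ge0_fin_numE//.
by apply: integral_ge0 => x _; rewrite lee_fin.
Qed.

End lebn.
Arguments lebn {R} n.

(** * Normal laws *)

Section real_measurability.
Context d (T : measurableType d) (R : realType).
Implicit Types f g : T -> R.

(** Real powers are measurable, and the power -1 is the inverse on nonnegative reals, including 0
    where both conventions give 0. Negative values follow because inversion is odd. *)
Lemma measurable_inv f : measurable_fun setT f ->
  measurable_fun setT (fun x => (f x)^-1).
Proof.
move=> mf; rewrite (_ : (fun _ => _) = fun x =>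
    if 0 <= f x then f x `^ (-1) else - ((- f x) `^ (-1))).
  apply: measurable_fun_ifT => /=.
  - exact: measurable_fun_ler.
  - exact: (measurableT_comp (measurable_powR _) mf).
  - apply: measurable_funN; apply: (measurableT_comp (measurable_powR _)).
    exact: measurable_funN.
apply/funext => x; case: ifPn => [fx|]; first by rewrite powR_inv1.
by rewrite -ltNge => fx; rewrite powR_inv1 ?oppr_ge0 ?ltW// invrN opprK.
Qed.

Lemma measurable_sqrt f : measurable_fun setT f ->
  measurable_fun setT (fun x => Num.sqrt (f x)).
Proof.
move=> mf; rewrite (_ : (fun _ => _) = fun x =>
    if 0 <= f x then f x `^ 2^-1 else 0).
  apply: measurable_fun_ifT => //=.
  - exact: measurable_fun_ler.
  - exact: (measurableT_comp (measurable_powR _) mf).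
apply/funext => x; case: ifPn => [fx|]; first by rewrite powR12_sqrt.
by rewrite -ltNge => fx; rewrite ltr0_sqrtr.
Qed.

Lemma measurable_div f g : measurable_fun setT f -> measurable_fun setT g ->
  measurable_fun setT (fun x => f x / g x).
Proof. by move=> mf mg; apply: measurable_funM => //; exact: measurable_inv. Qed.

Lemma measurable_powR_fun f (p : R) : measurable_fun setT f ->
  measurable_fun setT (fun x => f x `^ p).
Proof. by move=> mf; exact: (measurableT_comp (measurable_powR _) mf). Qed.

Lemma measurable_indic_comp d' (T' : measurableType d') (g : T -> T')
    (A : set T') : measurable_fun setT g -> measurable A ->
  measurable_fun setT (fun x => \1_A (g x) : R).
Proof. by move=> mg mA; apply: (measurableT_comp _ mg); exact: measurable_indic. Qed.

End real_measurability.

(** * One-dimensional normal densities and mixtures *)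

Section npdf.
Context {R : realType}.
Implicit Types m v x y k t : R.

(** Parametrised by the variance, as in [normal_law], and given by a single formula for all [v],
    which makes joint measurability in the three arguments direct. *)
Definition npdf (m v x : R) : R :=
  (Num.sqrt (2 * pi * v))^-1 * expR (- ((x - m) ^+ 2 / (2 * v))).

Lemma npdfE m v x : 0 < v -> normal_pdf m (Num.sqrt v) x = npdf m v x.
Proof.
move=> v0; rewrite normal_pdfE ?gt_eqF ?sqrtr_gt0// /normal_peak /normal_fun.
rewrite sqr_sqrtr ?ltW// /npdf; congr (_ ^-1 * expR _).
  by congr Num.sqrt; rewrite -mulr_natl; ring.
by rewrite mulNr -mulr_natl.
Qed.

Lemma npdf_ge0 m v x : 0 <= npdf m v x.
Proof. by rewrite mulr_ge0 ?invr_ge0 ?sqrtr_ge0 ?expR_ge0. Qed.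

Lemma measurable_npdf d (T : measurableType d) (m v x : T -> R) :
  measurable_fun setT m -> measurable_fun setT v -> measurable_fun setT x ->
  measurable_fun setT (fun w => npdf (m w) (v w) (x w)).
Proof.
move=> mm mv mx; apply: measurable_funM.
  by apply: measurable_inv; apply: measurable_sqrt; exact: measurable_funM.
apply: (measurableT_comp (@measurable_expR R)); apply: measurable_funN.
apply: measurable_div; last exact: measurable_funM.
by apply: measurable_funX; exact: measurable_funB.
Qed.

Lemma measurable_npdf1 m v : measurable_fun setT (npdf m v).
Proof. exact: measurable_npdf. Qed.

Lemma integral_npdf m v : 0 < v -> (\int[lebR]_x (npdf m v x)%:E = 1)%E.
Proof.
move=> v0; rewrite integral_lebR.
- rewrite -[RHS](integral_normal_pdf m (Num.sqrt v)).
  by apply: eq_integral => x _; rewrite npdfE.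
- by move=> x; rewrite lee_fin npdf_ge0.
- by apply/measurable_EFinP; exact: measurable_npdf1.
Qed.

Lemma normal_lawE m v (B : set R) : 0 < v -> measurable B ->
  normal_law m v B = (\int[lebR]_x (npdf m v x * \1_B x)%:E)%E.
Proof.
move=> v0 mB; rewrite /normal_law v0 /normal_prob integral_mkcond.
rewrite integral_lebR.
- apply: eq_integral => x _; rewrite patchE indicE npdfE//.
  by case: ifP; rewrite ?mulr1 ?mulr0.
- by move=> x; rewrite lee_fin mulr_ge0// npdf_ge0.
- apply/measurable_EFinP; apply: measurable_funM; first exact: measurable_npdf1.
  exact: measurable_indic.
Qed.

Lemma normal_law0 m v (B : set R) : v <= 0 -> normal_law m v B = (\1_B m)%:E.
Proof. by move=> v0; rewrite /normal_law ltNge v0 /= diracE indicE. Qed.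

Lemma normal_lawT m v : normal_law m v setT = 1%E.
Proof.
have [v0|v0] := ltP 0 v; last by rewrite normal_law0// indicT.
by rewrite normal_lawE//; under eq_integral do rewrite indicT mulr1; exact: integral_npdf.
Qed.

Lemma normal_law_ge0 m v (B : set R) : (0 <= normal_law m v B)%E.
Proof. by rewrite /normal_law; case: ifP. Qed.

Lemma normal_law_fin m v (B : set R) : measurable B ->
  normal_law m v B \is a fin_num.
Proof.
move=> mB; have [v0|v0] := ltP 0 v; last by rewrite normal_law0.
rewrite ge0_fin_numE ?normal_law_ge0// (@le_lt_trans _ _ 1%E) ?ltry//.
rewrite -[leRHS](normal_lawT m v) !normal_lawE//.
apply: ge0_le_integral => //.
- by move=> x _; rewrite lee_fin mulr_ge0// npdf_ge0.
- apply/measurable_EFinP; apply: measurable_funM; first exact: measurable_npdf1.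
  exact: measurable_indic.
- apply/measurable_EFinP; apply: measurable_funM; first exact: measurable_npdf1.
  exact: measurable_indic.
- by move=> x _; rewrite lee_fin indicT ler_wpM2l ?npdf_ge0// indicE; case: (_ \in _).
Qed.

Lemma measurable_normal_law d (T : measurableType d) (m v : T -> R)
    (B : set R) :
  measurable_fun setT m -> measurable_fun setT v -> measurable B ->
  measurable_fun setT (fun w => normal_law (m w) (v w) B).
Proof.
move=> mm mv mB; rewrite (_ : (fun _ => _) = fun w => if 0 < v w then
    (\int[lebR]_x (npdf (m w) (v w) x * \1_B x)%:E)%E else (\1_B (m w))%:E).
  apply: measurable_fun_ifT => //=.
  - exact: measurable_fun_ltr.
  - apply: (measurable_integralr lebR
      (f := fun w x => (npdf (m w) (v w) x * \1_B x)%:E)).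
      by move=> w x; rewrite lee_fin mulr_ge0// npdf_ge0.
    apply/measurable_EFinP; apply: measurable_funM.
      by apply: measurable_npdf => //; exact: measurableT_comp.
    exact: measurable_indic_comp.
  - by apply/measurable_EFinP; exact: measurable_indic_comp.
apply/funext => w; case: ifPn => [v0|]; first exact: normal_lawE.
by rewrite -leNgt => v0; rewrite normal_law0.
Qed.

(* Completing the square in x. *)
Lemma npdf_swap e v1 t k v0 x y : 0 < v1 -> 0 < v0 ->
  npdf e v1 x * npdf (t * x + k) v0 y =
  npdf (t * e + k) (t ^+ 2 * v1 + v0) y *
  npdf ((e * v0 + t * v1 * (y - k)) / (t ^+ 2 * v1 + v0))
    (v0 * v1 / (t ^+ 2 * v1 + v0)) x.
Proof.
move=> v1p v0p; set V := t ^+ 2 * v1 + v0.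
have Vp : 0 < V by rewrite ltr_wpDl// mulr_ge0 ?sqr_ge0 ?ltW.
have pip := pi_gt0 R.
rewrite /npdf mulrACA -expRD [RHS]mulrACA -expRD -!invfM; congr (_^-1 * expR _).
  rewrite -!sqrtrM; last 2 first.
  - by rewrite !mulr_ge0// ltW.
  - by rewrite !mulr_ge0// ltW.
  by congr Num.sqrt; field; rewrite gt_eqF.
rewrite /V; field; rewrite -/V !gt_eqF//.
Qed.

(** This is the law of t X + k plus independent noise of variance v0, for X normal. If v0 is 0 it is
    a point mass or an affine image according to whether [t] vanishes; otherwise [npdf_swap] and
    Tonelli leave an inner density in [x] of integral 1. The case v0 = 0 starts the computation of
    Gaussian linear forms. *)
Lemma normal_law_mix e v1 t k v0 (B : set R) : 0 < v1 -> 0 <= v0 ->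
  measurable B ->
  (\int[lebR]_x ((npdf e v1 x)%:E * normal_law (t * x + k) v0 B) =
   normal_law (t * e + k) (t ^+ 2 * v1 + v0) B)%E.
Proof.
move=> v1p; rewrite le_eqVlt => /predU1P[<- mB|v0p mB].
  have [->|t0] := eqVneq t 0.
    under eq_integral do rewrite mul0r.
    rewrite ge0_integralZr//; last 3 first.
    - by apply/measurable_EFinP; exact: measurable_npdf1.
    - by move=> x _; rewrite lee_fin npdf_ge0.
    - exact: normal_law_ge0.
    by rewrite integral_npdf// mul1e !mul0r expr0n/= mul0r addr0.
  have V0 : 0 < t ^+ 2 * v1 by rewrite mulr_gt0// exprn_even_gt0.
  rewrite addr0 normal_lawE//.
  pose g y := (npdf (t * e + k) (t ^+ 2 * v1) y * \1_B y)%:E.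
  transitivity (\int[lebR]_x (`|t|%:E * g (t * x + k)%R))%E.
    apply: eq_integral => x _; rewrite normal_law0// /g -!EFinM mulrA.
    congr ((_ * _)%:E); rewrite /npdf [RHS]mulrA; congr (_ * _); last first.
      by congr expR; field; rewrite t0 gt_eqF.
    rewrite (_ : 2 * pi * (t ^+ 2 * v1) = `|t| ^+ 2 * (2 * pi * v1)); last first.
      by rewrite real_normK ?num_real//; ring.
    rewrite [in RHS]sqrtrM ?sqr_ge0// sqrtr_sqr normr_id invfM mulrA divff ?mul1r//.
    by rewrite normr_eq0.
  have g0 y : (0 <= g y)%E by rewrite lee_fin mulr_ge0// npdf_ge0.
  have mg : measurable_fun setT g.
    apply/measurable_EFinP; apply: measurable_funM; first exact: measurable_npdf1.
    exact: measurable_indic.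
  rewrite ge0_integralZl//; last first.
    by apply: measurableT_comp => //; apply: measurable_funD => //; exact: measurable_funM.
  by rewrite integral_lebR_affine// muleA -EFinM divff ?mul1e// normr_eq0.
have V0 : 0 < t ^+ 2 * v1 + v0 by rewrite ltr_wpDl// mulr_ge0 ?sqr_ge0 ?ltW.
have m1 : measurable_fun setT (fun p : R * R => npdf (t * p.1 + k) v0 p.2 * \1_B p.2).
  apply: measurable_funM; last exact: measurable_indic_comp.
  apply: measurable_npdf => //; apply: measurable_funD => //; exact: measurable_funM.
transitivity (\int[lebR]_x \int[lebR]_y
    (npdf e v1 x * (npdf (t * x + k) v0 y * \1_B y))%:E)%E.
  apply: eq_integral => x _; rewrite normal_lawE//.
  under [RHS]eq_integral do rewrite EFinM.
  rewrite ge0_integralZl//.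
  - apply/measurable_EFinP; apply: measurable_funM; first exact: measurable_npdf1.
    exact: measurable_indic.
  - by move=> y _; rewrite lee_fin mulr_ge0// npdf_ge0.
  - by rewrite lee_fin npdf_ge0.
rewrite tonelli; last 2 first.
- by move=> x y; rewrite lee_fin !mulr_ge0// npdf_ge0.
- apply/measurable_EFinP; apply: measurable_funM => //.
  exact: (measurableT_comp (measurable_npdf1 _ _)).
rewrite normal_lawE//; apply: eq_integral => y _.
under eq_integral do rewrite mulrA npdf_swap// mulrAC EFinM.
rewrite ge0_integralZl//.
- rewrite integral_npdf ?mule1//.
  by rewrite divr_gt0// mulr_gt0.
- by apply/measurable_EFinP; exact: measurable_npdf1.
- by move=> x _; rewrite lee_fin npdf_ge0.
- by rewrite lee_fin mulr_ge0// npdf_ge0.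
Qed.

End npdf.

(** * Positive definite matrices and Schur complements *)

Section positive_definite.
Context {R : realType}.

Definition bilin p (A : 'M[R]_p) (y x : 'cV[R]_p) : R := (y^T *m A *m x) 0 0.

Definition posdef p (A : 'M[R]_p) : Prop :=
  A^T = A /\ forall x : 'cV[R]_p, x != 0 -> 0 < bilin A x x.

Lemma bilinDr p (A : 'M[R]_p) y x1 x2 :
  bilin A y (x1 + x2) = bilin A y x1 + bilin A y x2.
Proof. by rewrite /bilin mulmxDr mxE. Qed.

Lemma bilinNr p (A : 'M[R]_p) y x : bilin A y (- x) = - bilin A y x.
Proof. by rewrite /bilin mulmxN mxE. Qed.

Lemma bilinC p (A : 'M[R]_p) y x : A^T = A -> bilin A y x = bilin A x y.
Proof.
move=> AT; rewrite /bilin.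
have <- : (x^T *m A *m y)^T = y^T *m A *m x.
  by rewrite !trmx_mul trmxK AT mulmxA.
by rewrite mxE.
Qed.

Lemma mul11 (M N : 'M[R]_1) : (M *m N) 0 0 = M 0 0 * N 0 0.
Proof. by rewrite mxE big_ord1. Qed.

Section schur.
Variables (p : nat) (A : 'M[R]_(1 + p)).
Hypothesis AP : posdef A.

Let a := A 0 0.
Let b : 'cV[R]_p := dlsubmx A.
Let S : 'M[R]_p := drsubmx A - a^-1 *: (b *m b^T).
Let beta (x : 'cV[R]_p) : R := (b^T *m x) 0 0.

Let AE : A = block_mx a%:M b^T b (drsubmx A).
Proof.
rewrite -[LHS]submxK; congr block_mx.
  by apply/matrixP => i j; rewrite !mxE !ord1 !lshift0 eqxx.
by rewrite -[in LHS](proj1 AP) -[LHS]trmxK trmx_ursub trmxK.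
Qed.

Lemma schur_pivot_gt0 : 0 < a.
Proof.
have /(proj2 AP) : (delta_mx 0 0 : 'cV[R]_(1 + p)) != 0.
  apply/eqP => /matrixP/(_ 0 0); rewrite !mxE eqxx => /eqP.
  by rewrite oner_eq0.
by rewrite /bilin trmx_delta -rowE -colE !mxE.
Qed.

Let a0 : a != 0. Proof. by rewrite gt_eqF// schur_pivot_gt0. Qed.

(** Completing the square in the first coordinate leaves the Schur complement [S] as the form in the
    remaining ones. *)
Lemma schur_bilin (y1 x1 : R) (y2 x2 : 'cV[R]_p) :
  bilin A (col_mx y1%:M y2) (col_mx x1%:M x2) =
  a * (y1 + beta y2 / a) * (x1 + beta x2 / a) + bilin S y2 x2.
Proof.
have bC (x : 'cV[R]_p) : (x^T *m b) 0 0 = beta x.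
  rewrite /beta; have <- : (x^T *m b)^T = b^T *m x by rewrite trmx_mul trmxK.
  by rewrite [RHS]mxE.
have -> : bilin S y2 x2 = (y2^T *m drsubmx A *m x2) 0 0 - a^-1 * (beta y2 * beta x2).
  rewrite /bilin /S mulmxBr mulmxBl [LHS]mxE; congr (_ + _).
  rewrite [LHS]mxE; congr (- _).
  rewrite -scalemxAr -scalemxAl [LHS]mxE -!mulmxA mulmxA mul11.
  by rewrite bC.
have -> : bilin A (col_mx y1%:M y2) (col_mx x1%:M x2) =
    a * y1 * x1 + x1 * beta y2 + y1 * beta x2 + (y2^T *m drsubmx A *m x2) 0 0.
  rewrite {1}AE /bilin tr_col_mx mul_row_block mul_row_col tr_scalar_mx.
  rewrite !mulmxDl [LHS]mxE [in LHS]mxE [X in _ + X]mxE !mul_scalar_mx !mul_mx_scalar.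
  have mxZ c (M : 'M[R]_1) : (c *: M) 0 0 = c * M 0 0 by rewrite mxE.
  rewrite -!scalemxAl !mxZ bC -/(beta x2) [a%:M 0 0]mxE eqxx mulr1n; ring.
by field.
Qed.

Let schur_posdef : posdef S.
Proof.
split.
  rewrite /S linearB/= linearZ/= trmx_mul trmxK; congr (_ - _).
  by rewrite trmx_drsub (proj1 AP).
(* This first coordinate annihilates the pivot square, so that a value of the form of [S] is a value
   of the form of [A]. *)
move=> x x0; have := schur_bilin (- (beta x / a)) (- (beta x / a)) x x.
rewrite addNr !(mulr0, mul0r) add0r => <-.
apply: (proj2 AP); apply: contra_neq x0 => /(congr1 dsubmx).
by rewrite col_mxKd linear0.
Qed.

Let schur_det : \det A = a * \det S.
Proof.
rewrite [in LHS](_ : A = block_mx 1%:M 0 (a^-1 *: b) 1%:M *m block_mx a%:M b^T 0 S).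
  by rewrite det_mulmx det_lblock det_ublock !det1 !mul1r det_scalar1.
rewrite mulmx_block !mul1mx !mul0mx !addr0 mul_mx_scalar scalerA divff// scale1r.
by rewrite -scalemxAl /S addrC subrK -AE.
Qed.

(** The dimension-reduction step, packaged for the inductions on determinants and on Gaussian
    integrals. *)
Lemma posdef_schur : exists (a : R) (S : 'M[R]_p) (c : 'cV[R]_p),
  [/\ 0 < a, posdef S, \det A = a * \det S &
    forall (y1 x1 : R) (y2 x2 : 'cV[R]_p),
      bilin A (col_mx y1%:M y2) (col_mx x1%:M x2) =
      a * (y1 + (c^T *m y2) 0 0) * (x1 + (c^T *m x2) 0 0) + bilin S y2 x2].
Proof.
exists a, S, (a^-1 *: b); split => //; first exact: schur_pivot_gt0.
move=> y1 x1 y2 x2; rewrite schur_bilin.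
have e x : ((a^-1 *: b)^T *m x) 0 0 = beta x / a.
  by rewrite linearZ/= -scalemxAl [LHS]mxE mulrC.
by rewrite !e.
Qed.

End schur.

Lemma posdef_det_gt0 p (A : 'M[R]_p) : posdef A -> 0 < \det A.
Proof.
elim: p A => [|p IH] A AP; first by rewrite det_mx00.
have [a [S [c [a0 SP -> _]]]] := posdef_schur (AP : posdef (A : 'M[R]_(1 + p))).
by rewrite mulr_gt0// IH.
Qed.

End positive_definite.

(** * Multivariate Gaussian densities *)

Section gaussian.
Context {R : realType}.

Definition tcol n (t : n.-tuple R) : 'cV[R]_n := \col_i tnth t i.

Lemma tcol_cons n x (t : n.-tuple R) :
  tcol [tuple of x :: t] = col_mx x%:M (tcol t) :> 'cV_(1 + n).
Proof.
apply/matrixP => i j; rewrite !mxE; case: splitP => k ik; rewrite !mxE.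
  rewrite !ord1 eqxx mulr1n (_ : i = ord0) ?tnth0//; apply/val_inj.
  by rewrite /= ik ord1.
by rewrite (_ : i = lift ord0 k) ?tnthS//; exact/val_inj.
Qed.

Definition vmeasurable d (T : measurableType d) n (f : T -> 'cV[R]_n) : Prop :=
  forall i, measurable_fun setT (fun w => f w i 0).

Lemma vmeasurable_tcol d (T : measurableType d) n (f : T -> n.-tuple R) :
  measurable_fun setT f -> vmeasurable (fun w => tcol (f w)).
Proof.
move=> mf i; under eq_fun do rewrite mxE.
exact: (measurableT_comp (measurable_tnth i) mf).
Qed.

Lemma vmeasurableB d (T : measurableType d) n (f g : T -> 'cV[R]_n) :
  vmeasurable f -> vmeasurable g -> vmeasurable (fun w => f w - g w).
Proof.
move=> mf mg i; under eq_fun do rewrite !mxE.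
exact: measurable_funB.
Qed.

Lemma vmeasurable_mul d (T : measurableType d) m n (M : 'M[R]_(m, n))
    (f : T -> 'cV[R]_n) :
  vmeasurable f -> vmeasurable (fun w => M *m f w).
Proof.
move=> mf i; under eq_fun do rewrite mxE.
by apply: measurable_sum => j; exact: measurable_funM.
Qed.

Lemma measurable_bilin d (T : measurableType d) n (A : 'M[R]_n)
    (f g : T -> 'cV[R]_n) :
  vmeasurable f -> vmeasurable g ->
  measurable_fun setT (fun w => bilin A (f w) (g w)).
Proof.
move=> mf mg; rewrite (_ : (fun _ => _) =
    fun w => \sum_i f w i 0 * (A *m g w) i 0).
  apply: measurable_sum => i; apply: measurable_funM => //.
  exact: vmeasurable_mul.
apply/funext => w; rewrite /bilin -mulmxA mxE.
by apply: eq_bigr => i _; rewrite mxE.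
Qed.

(* The density of N(mu, s A^-1): A is a precision matrix. *)
Definition gdens p (A : 'M[R]_p) (mu : 'cV[R]_p) (s : R) (t : p.-tuple R) : R :=
  Num.sqrt (\det A) / Num.sqrt (2 * pi * s) ^+ p *
  expR (- (bilin A (tcol t - mu) (tcol t - mu) / (2 * s))).

Lemma gdens_ge0 p (A : 'M[R]_p) mu s t : 0 <= gdens A mu s t.
Proof.
by rewrite /gdens mulr_ge0 ?expR_ge0// divr_ge0 ?exprn_ge0 ?sqrtr_ge0.
Qed.

Lemma measurable_gdens d (T : measurableType d) p (A : 'M[R]_p)
    (mu : T -> 'cV[R]_p) (s : T -> R) (t : T -> p.-tuple R) :
  vmeasurable mu -> measurable_fun setT s -> measurable_fun setT t ->
  measurable_fun setT (fun w => gdens A (mu w) (s w) (t w)).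
Proof.
move=> mmu ms mt; apply: measurable_funM.
  apply: measurable_div => //; apply: measurable_funX.
  by apply: measurable_sqrt; exact: measurable_funM.
apply: (measurableT_comp (@measurable_expR R)); apply: measurable_funN.
apply: measurable_div; last exact: measurable_funM.
by apply: measurable_bilin; apply: vmeasurableB => //; exact: vmeasurable_tcol.
Qed.

Lemma cvmeasurable d (T : measurableType d) n (v : 'cV[R]_n) :
  vmeasurable (fun _ : T => v).
Proof. by move=> i; exact: measurable_cst. Qed.

(** By induction on the dimension, integrating the first coordinate given the others. Writing the
    linear form as an [A]-product with [y] makes its variance s y'Ay, so no inverse of [A] appears.
    The offset [k] and the variance [v0] collect what the integrated coordinates leave behind. *)
Lemma gdens_linear p (A : 'M[R]_p) (mu y : 'cV[R]_p) (s k v0 : R) (B : set R) :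
  posdef A -> 0 < s -> 0 <= v0 -> measurable B ->
  (\int[lebn p]_t ((gdens A mu s t)%:E *
     normal_law (bilin A y (tcol t) + k)%R v0 B) =
   normal_law (bilin A y mu + k)%R (s * bilin A y y + v0)%R B)%E.
Proof.
move=> AP s0; elim: p A mu y k v0 AP => [|p IH] A mu y k v0 AP v00 mB.
  have e0 (u w : 'cV[R]_0) : bilin A u w = 0.
    by rewrite /bilin mxE big_ord0.
  rewrite integral_lebn0 /gdens !e0 mul0r oppr0 expR0 det_mx00 sqrtr1 expr0.
  by rewrite divr1 mulr1 mul1e mulr0 !add0r.
have [a [S [c [a0 SP detA bA]]]] := posdef_schur (AP : posdef (A : 'M[R]_(1 + p))).
pose mu1 := mu 0 0; pose mu2 : 'cV[R]_p := dsubmx (mu : 'cV_(1 + p)).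
pose y1 := y 0 0; pose y2 : 'cV[R]_p := dsubmx (y : 'cV_(1 + p)).
have split_col (v : 'cV[R]_(1 + p)) : v = col_mx (v 0 0)%:M (dsubmx v).
  rewrite -[LHS]vsubmxK; congr col_mx; apply/matrixP => i j.
  by rewrite !mxE !ord1 lshift0 eqxx.
have muE : mu = col_mx mu1%:M mu2 :> 'cV_(1 + p) by exact: split_col.
have yE : y = col_mx y1%:M y2 :> 'cV_(1 + p) by exact: split_col.
pose g (v : 'cV[R]_p) := (c^T *m v) 0 0.
pose cc := a * (y1 + g y2).
have gB v w : g (v - w) = g v - g w by rewrite /g mulmxBr [LHS]mxE [X in _ + X]mxE.
(* The density splits into that of the first coordinate given the rest and the marginal of the rest,
   whose precision is the Schur complement. *)
have gdE x (t : p.-tuple R) : gdens A mu s [tuple of x :: t] =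
    npdf (mu1 - g (tcol t - mu2)) (s / a) x * gdens S mu2 s t.
  have -> : gdens A mu s [tuple of x :: t] = Num.sqrt (\det A) /
      Num.sqrt (2 * pi * s) ^+ p.+1 *
      expR (- (bilin A (col_mx (x - mu1)%:M (tcol t - mu2))
                       (col_mx (x - mu1)%:M (tcol t - mu2)) / (2 * s))).
    rewrite /gdens (_ : tcol _ - mu = col_mx (x - mu1)%:M (tcol t - mu2))//.
    rewrite [RHS](_ : _ = col_mx x%:M (tcol t) - col_mx mu1%:M mu2).
      by rewrite -tcol_cons -muE.
    by rewrite opp_col_mx add_col_mx raddfB.
  rewrite bA -/(g _).
  rewrite detA /npdf [RHS]mulrACA -expRD; congr (_ * expR _); last first.
    by field; rewrite !gt_eqF.
  rewrite exprS invfM sqrtrM ?ltW// mulrACA; congr (_ * _).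
  have -> : 2 * pi * (s / a) = a^-1 * (2 * pi * s) by field; rewrite gt_eqF.
  by rewrite [in RHS]sqrtrM ?invr_ge0 ?ltW// invfM sqrtrV ?ltW// invrK.
have blE x (t : p.-tuple R) : bilin A y (tcol [tuple of x :: t]) + k =
    cc * x + (cc * g (tcol t) + bilin S y2 (tcol t) + k).
  by rewrite tcol_cons yE bA -/(g _) -/(g _) /cc; ring.
rewrite integral_lebnS2; first last.
- apply: emeasurable_funM.
    apply/measurable_EFinP; apply: measurable_gdens => //; exact: cvmeasurable.
  apply: measurable_normal_law => //; apply: measurable_funD => //.
  by apply: measurable_bilin; [exact: cvmeasurable|exact: vmeasurable_tcol].
- by move=> t; rewrite mule_ge0 ?normal_law_ge0// lee_fin gdens_ge0.
under eq_integral => t _.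
  under eq_integral => x _ do rewrite gdE blE mulrC EFinM -muleA.
  rewrite ge0_integralZl//; first last.
  - by rewrite lee_fin gdens_ge0.
  - by move=> x _; rewrite mule_ge0 ?normal_law_ge0// lee_fin npdf_ge0.
  - apply: emeasurable_funM; first by apply/measurable_EFinP; exact: measurable_npdf1.
    by apply: measurable_normal_law => //; apply: measurable_funD.
  (* The integrated coordinate contributes cc^2 s / a to the variance; in the mean the terms with
     [g (tcol t)] cancel, which leaves a linear form for [S]. *)
  rewrite normal_law_mix ?divr_gt0//.
  rewrite (_ : cc * (mu1 - g (tcol t - mu2)) + _ =
    bilin S y2 (tcol t) + (cc * mu1 + cc * g mu2 + k)); last by rewrite gB; ring.
  over.
rewrite IH//; last by rewrite addr_ge0// mulr_ge0 ?sqr_ge0// divr_ge0// ltW.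
rewrite muE yE !bA -/(g y2) -/(g mu2); congr (normal_law _ _ _).
  by rewrite /cc; ring.
by rewrite /cc; field; rewrite gt_eqF.
Qed.

Lemma integral_gdens p (A : 'M[R]_p) mu s : posdef A -> 0 < s ->
  (\int[lebn p]_t (gdens A mu s t)%:E = 1)%E.
Proof.
move=> AP s0; have := @gdens_linear p A mu 0 s 0 0 setT AP s0 (lexx _) measurableT.
rewrite normal_lawT => <-; apply: eq_integral => t _.
by rewrite normal_lawT mule1.
Qed.

End gaussian.

(** * The inverse gamma law *)

Section inverse_gamma.
Context {R : realType}.
Implicit Types a b x : R.

Definition gamma_kernel a x : R := x `^ (a - 1) * expR (- x).

Lemma measurable_gamma_kernel a : measurable_fun setT (gamma_kernel a).
Proof.
apply: measurable_funM; first exact: measurable_powR.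
by apply: (measurableT_comp (@measurable_expR R)); exact: measurable_funN.
Qed.

Lemma gamma_kernel_ge0 a x : 0 <= gamma_kernel a x.
Proof. by rewrite mulr_ge0 ?powR_ge0 ?expR_ge0. Qed.

(* From y <= e^y at y = x / (2 (a - 1)). *)
Lemma gamma_kernel_le a x : 1 < a -> 0 <= x ->
  gamma_kernel a x <= (2 * (a - 1)) `^ (a - 1) * expR (- (2^-1) * x).
Proof.
move=> a1 x0; set p := a - 1; have p0 : 0 < p by rewrite subr_gt0.
have -> : gamma_kernel a x = (2 * p) `^ p * ((x / (2 * p)) `^ p * expR (- x)).
  have p2 : 0 <= 2 * p by rewrite mulr_ge0// ltW.
  rewrite mulrA -powRM ?divr_ge0// /gamma_kernel -/p.
  by congr (_ `^ _ * _); field; rewrite gt_eqF.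
rewrite ler_wpM2l ?powR_ge0//.
have -> : expR (- 2^-1 * x) = expR (x / (2 * p)) `^ p * expR (- x).
  by rewrite -expRM -expRD; congr expR; field; rewrite gt_eqF.
rewrite ler_wpM2r ?expR_ge0// ge0_ler_powR ?(ltW p0) ?nnegrE ?expR_ge0//.
  by rewrite divr_ge0 ?mulr_ge0// ltW.
by rewrite (le_trans _ (expR_ge1Dx _))// lerDr.
Qed.

Lemma integral_gamma_kernel_lty a : 1 < a ->
  (\int[lebesgue_measure]_(x in `]0%R, +oo[) (gamma_kernel a x)%:E < +oo)%E.
Proof.
(* The last factor 2 cancels the rate 1/2 in the exponential density and so restores the bound of
   [gamma_kernel_le]. *)
move=> a1; pose C := (2 * (a - 1)) `^ (a - 1) * 2.
apply: (@le_lt_trans _ _ (\int[lebesgue_measure]_x (C * exponential_pdf (2^-1) x)%:E)%E).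
  rewrite integral_mkcond; apply: ge0_le_integral => //.
  - by move=> x _; rewrite patchE; case: ifP => // _; rewrite lee_fin gamma_kernel_ge0.
  - apply/(measurable_restrictT _ _).1 => //.
    apply/measurable_funTS/measurable_EFinP; exact: measurable_gamma_kernel.
  - apply/measurable_EFinP; apply: measurable_funM => //.
    exact: measurable_exponential_pdf.
  - move=> x _; rewrite patchE; case: ifPn => [|_].
      rewrite inE/= in_itv/= andbT => x0; rewrite lee_fin exponential_pdfE ?(ltW x0)//.
      rewrite (le_trans (gamma_kernel_le a1 (ltW x0)))// /C.
      by rewrite -mulrA (mulrA 2) divff// mul1r.
    have -> : (point : \bar R) = 0%E by [].
    by rewrite lee_fin !mulr_ge0 ?powR_ge0 ?exponential_pdf_ge0.
under eq_integral do rewrite EFinM.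
rewrite ge0_integralZl//.
- by rewrite integral_exponential_pdf ?invr_gt0// mule1 ltry.
- by apply/measurable_EFinP; exact: measurable_exponential_pdf.
- by move=> x _; rewrite lee_fin exponential_pdf_ge0.
- by rewrite lee_fin mulr_ge0 ?powR_ge0.
Qed.

(** A real-valued integral is 0 by convention when it diverges, so convergence has to be known.
    Shapes above 1 are enough: the model has nu + 1 and nu + 1 + n/2. *)
Lemma gamma_funE a : 1 < a -> ((gamma_fun a)%:E =
  \int[lebesgue_measure]_(x in `]0%R, +oo[) (gamma_kernel a x)%:E)%E.
Proof.
move=> a1; rewrite /gamma_fun /Rintegral fineK// ge0_fin_numE.
  exact: integral_gamma_kernel_lty.
by apply: integral_ge0 => x _; rewrite lee_fin gamma_kernel_ge0.
Qed.

Lemma gamma_fun_gt0 a : 1 < a -> 0 < gamma_fun a.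
Proof.
move=> a1; rewrite -lte_fin gamma_funE//.
(* On [1, 2] the kernel is at least e^-2, because x^(a-1) is at least 1 there. *)
apply: (@lt_le_trans _ _ (\int[lebesgue_measure]_(x in `[1%R, 2%R]) (expR (- 2))%:E)%E).
  rewrite integral_cst//= lebesgue_measure_itv/= lte_fin ltr1n -EFinB -EFinM lte_fin.
  by rewrite mulr_gt0 ?expR_gt0// subr_gt0 ltr1n.
apply: (@le_trans _ _ (\int[lebesgue_measure]_(x in `[1%R, 2%R]) (gamma_kernel a x)%:E)%E).
  apply: ge0_le_integral => //.
  - apply/measurable_funTS/measurable_EFinP; exact: measurable_gamma_kernel.
  - move=> x /=; rewrite in_itv/= => /andP[x1 x2]; rewrite lee_fin.
    rewrite -[leLHS]mul1r ler_pM ?expR_ge0 ?ler_expR ?lerN2//.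
    by rewrite -[leLHS](powRr0 x); apply: ler_powR => //; rewrite subr_ge0 ltW.
apply: ge0_subset_integral => //.
- apply/measurable_funTS/measurable_EFinP; exact: measurable_gamma_kernel.
- by move=> x _; rewrite lee_fin gamma_kernel_ge0.
- by apply: subset_itv => //; rewrite bnd_simp.
Qed.

(** Substitution y = 1/x, whose Jacobian x^-2 turns the exponent 1 - a into -a - 1. It is made on
    compact intervals away from 0, where the map is continuously differentiable. *)
Lemma integral_inverse_itv a (u v : R) : 0 < u -> u <= v ->
  (\int[lebesgue_measure]_(y in `[(v^-1)%R, (u^-1)%R]) (gamma_kernel a y)%:E =
   \int[lebesgue_measure]_(x in `[u, v])
     ((x `^ (- a - 1) * expR (- x^-1))%R)%:E)%E.
Proof.
move=> u0 uv; pose F (x : R) := x^-1.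
have v0 : 0 < v := lt_le_trans u0 uv.
have F'E x : x != 0 -> F^`()%classic x = - x ^- 2.
  move=> x0; rewrite /F derive1E deriveV// derive_id.
  by rewrite [LHS]mulr1.
have cF' x : 0 < x -> F^`()%classic @ x --> - x ^- 2.
  move=> x0; apply: (@cvg_trans _ ((fun y => - y ^- 2) @ x)).
    apply: near_eq_cvg; near=> y; rewrite F'E// gt_eqF//.
    by near: y; exact: lt_nbhsr.
  have : derivable (fun y : R => - (y ^+ 2)^-1) x 1.
    by apply: derivableN; apply: derivableV => //; rewrite expf_neq0// gt_eqF.
  by move/derivable1_diffP/differentiable_continuous; apply.
have cF x : 0 < x -> F @ x --> F x.
  by move=> x0; apply: cvgV => //; rewrite gt_eqF.
have inuv x : x \in `]u, v[ -> 0 < x.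
  by rewrite in_itv/= => /andP[/(lt_trans u0)].
rewrite -/(F v) -/(F u) (@integration_by_substitution_decreasing _ F (gamma_kernel a) u v)//.
- apply: eq_integral => x; rewrite inE/= in_itv/= => /andP[ux _].
  have x0 : 0 < x := lt_le_trans u0 ux.
  congr EFin; rewrite fctE [X in _ * X](_ : _ = x ^- 2).
    rewrite /= /gamma_kernel /F mulrAC; congr (_ * _).
    rewrite -[x^-1]powR_inv1 ?ltW// -powRrM -powR_invn ?ltW// -powRD; last first.
      by apply/implyP => _; rewrite gt_eqF.
    by congr (_ `^ _); ring.
  by rewrite -[RHS]opprK -F'E ?gt_eqF.
- move=> x y; rewrite !in_itv/= => /andP[ux _] /andP[uy _] xy.
  by rewrite ltf_pV2 ?posrE ?(lt_le_trans u0).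
- by move=> x /inuv x0; rewrite /continuous_at F'E ?gt_eqF//; exact: cF'.
- by apply/cvg_ex; exists (- u ^- 2); apply: cvg_at_right_filter; exact: cF'.
- by apply/cvg_ex; exists (- v ^- 2); apply: cvg_at_left_filter; exact: cF'.
- split.
  + by move=> x /inuv x0; apply: derivableV => //; rewrite gt_eqF.
  + by apply: cvg_at_right_filter; exact: cF.
  + by apply: cvg_at_left_filter; exact: cF.
- apply: continuous_in_subspaceT => y; rewrite inE/= in_itv/= => /andP[vy _].
  have y0 : 0 < y by rewrite (lt_le_trans _ vy)// invr_gt0.
  apply: (@continuousM _ _ (fun x => x `^ (a - 1)) (fun x => expR (- x)) y).
    have : derivable (fun x => x `^ (a - 1)) y 1.
      by apply: derivable_powR; rewrite in_itv/= andbT.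
    by move/derivable1_diffP/differentiable_continuous; apply.
  apply: (@continuous_comp _ _ _ (fun x : R => - x) expR); last exact: continuous_expR.
  exact: (@continuousN _ R^o).
Unshelve. all: by end_near. Qed.

(** Inversion maps each of these intervals onto itself, so one exhaustion of the half-line serves
    both integrals. *)
Let K (n : nat) : set R := `[n.+1%:R^-1, n.+1%:R]%classic.

Let K_nd : nondecreasing_seq K.
Proof.
move=> m n mn; rewrite subsetEset; apply: subset_itv; rewrite bnd_simp.
  by rewrite lef_pV2 ?posrE// ler_nat.
by rewrite ler_nat.
Qed.

Let K_cover : \bigcup_n K n = `]0, +oo[%classic.
Proof.
apply/seteqP; split => [x [n _]|x]; rewrite /K /= !in_itv/= andbT.
  by case/andP => + _; apply: lt_le_trans; rewrite invr_gt0.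
(* An index beyond both x and 1/x respects both endpoints. *)
move=> x0; pose y := Num.max x x^-1.
exists (Num.truncn y) => //=; rewrite in_itv/=.
have xn : y < (Num.truncn y).+1%:R by rewrite truncnS_gt.
apply/andP; split; last by rewrite (le_trans _ (ltW xn))// le_max lexx.
rewrite -[leRHS]invrK lef_pV2 ?posrE ?invr_gt0//.
by rewrite (le_trans _ (ltW xn))// le_max lexx orbT.
Qed.

Lemma integral_inverse a :
  (\int[lebesgue_measure]_(y in `]0%R, +oo[) (gamma_kernel a y)%:E =
   \int[lebesgue_measure]_(x in `]0%R, +oo[)
     ((x `^ (- a - 1) * expR (- x^-1))%R)%:E)%E.
Proof.
rewrite -K_cover.
have cv (f : R -> R) : (forall x, 0 <= f x) -> measurable_fun setT f ->
    (\int[lebesgue_measure]_(x in K n) (f x)%:E @[n --> \oo] -->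
     \int[lebesgue_measure]_(x in \bigcup_n K n) (f x)%:E)%E.
  move=> f0 mf; apply: ge0_nondecreasing_set_cvg_integral => //.
  - by move=> n; rewrite /K.
  - by move=> n; apply/measurable_funTS/measurable_EFinP.
  - by move=> n x _; rewrite lee_fin.
have c1 := cv _ (gamma_kernel_ge0 a) (measurable_gamma_kernel a).
have c2 := cv (fun x => x `^ (- a - 1) * expR (- x^-1)).
rewrite (_ : (fun n => _) = fun n => \int[lebesgue_measure]_(x in K n)
    ((x `^ (- a - 1) * expR (- x^-1))%R)%:E)%E in c1; last first.
  apply/funext => n; rewrite /K -[X in `[_, X]](invrK n.+1%:R) integral_inverse_itv.
  - by rewrite invrK.
  - by rewrite invr_gt0.
  - by rewrite (@le_trans _ _ 1)// ?invf_le1 ?ler1n.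
apply: (cvg_unique _ c1) => //; apply: c2 => [x|]; first by rewrite mulr_ge0 ?powR_ge0 ?expR_ge0.
apply: measurable_funM; first exact: measurable_powR.
apply: (measurableT_comp (@measurable_expR R)); apply: measurable_funN.
exact: measurable_inv.
Qed.

(** Extended by 0 so that all integrals run over the whole line; the formula itself is not
    meaningful at nonpositive arguments. *)
Definition igpdf (a b x : R) : R := if 0 < x then inv_gamma_pdf a b x else 0.

Lemma igpdf_ge0 a b x : 1 < a -> 0 <= igpdf a b x.
Proof.
move=> a1; rewrite /igpdf /inv_gamma_pdf; case: ifP => // _.
by rewrite !mulr_ge0 ?expR_ge0 ?powR_ge0// invr_ge0 ltW// gamma_fun_gt0.
Qed.

Lemma measurable_igpdf d (T : measurableType d) a (b x : T -> R) :
  measurable_fun setT b -> measurable_fun setT x ->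
  measurable_fun setT (fun w => igpdf a (b w) (x w)).
Proof.
move=> mb mx; apply: measurable_fun_ifT => //=; first exact: measurable_fun_ltr.
apply: measurable_funM; last first.
  apply: (measurableT_comp (@measurable_expR R)); apply: measurable_funN.
  exact: measurable_div.
apply: measurable_funM; last exact: measurable_powR_fun.
by apply: measurable_funM => //; exact: measurable_powR_fun.
Qed.

Lemma inv_gammaE a b (A : set R) : 1 < a -> measurable A ->
  inv_gamma a b A = (\int[lebR]_x (igpdf a b x * \1_A x)%:E)%E.
Proof.
move=> a1 mA; rewrite /inv_gamma integral_mkcond integral_lebR.
- apply: eq_integral => x _; rewrite patchE /igpdf indicE.
  have -> : (x \in A `&` [set y | 0 < y]) = (x \in A) && (0 < x).
    by rewrite in_setI; congr (_ && _); apply/idP/idP; rewrite inE.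
  have [xA|xA] /= := boolP (x \in A); last by rewrite mulr0.
  by rewrite mulr1; case: ifP.
- by move=> x; rewrite lee_fin mulr_ge0// igpdf_ge0.
- apply/measurable_EFinP; apply: measurable_funM; last exact: measurable_indic.
  exact: measurable_igpdf.
Qed.

Lemma integral_igpdf a b : 1 < a -> 0 < b ->
  (\int[lebR]_x (igpdf a b x)%:E = 1)%E.
Proof.
move=> a1 b0; have g0 := gamma_fun_gt0 a1.
pose f x := if 0 < x then x `^ (- a - 1) * expR (- x^-1) else 0.
have f0 x : 0 <= f x by rewrite /f; case: ifP => // _; rewrite mulr_ge0 ?powR_ge0 ?expR_ge0.
have mf : measurable_fun setT f.
  apply: measurable_fun_ifT => //=; first exact: measurable_fun_ltr.
  apply: measurable_funM; first exact: measurable_powR.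
  apply: (measurableT_comp (@measurable_expR R)); apply: measurable_funN.
  exact: measurable_inv.
(* Rescaling by [b] reduces to scale 1, where inversion gives the gamma integral. *)
have fE x : igpdf a b x = (b * gamma_fun a)^-1 * f (b^-1 * x + 0).
  rewrite addr0 /igpdf /f pmulr_rgt0 ?invr_gt0//; case: ifPn => [x0|_]; last by rewrite mulr0.
  have -> : (b^-1 * x)^-1 = b / x by rewrite invfM invrK.
  rewrite /inv_gamma_pdf powRM ?invr_ge0 ?ltW// [RHS]mulrA; congr (_ * _).
  have -> : b^-1 `^ (- a - 1) = b `^ a * b.
    rewrite -[in LHS]powR_inv1 ?ltW// -powRrM -[X in _ = _ * X](powRr1 (ltW b0)).
    rewrite -powRD; last by apply/implyP => _; rewrite gt_eqF.
    by congr (_ `^ _); ring.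
  by rewrite invfM; field; rewrite !gt_eqF.
under eq_integral do rewrite fE EFinM.
rewrite ge0_integralZl//; first last.
- by rewrite lee_fin invr_ge0 mulr_ge0 ?ltW.
- by move=> x _; rewrite lee_fin.
- by apply/measurable_EFinP; apply: (measurableT_comp mf); apply: measurable_funD => //; exact: measurable_funM.
rewrite (@integral_lebR_affine R b^-1 0 (fun x => (f x)%:E))//; last 2 first.
- by rewrite invr_neq0// gt_eqF.
- exact/measurable_EFinP.
rewrite (_ : (\int[lebR]_x (f x)%:E)%E = (gamma_fun a)%:E).
  rewrite -!EFinM gtr0_norm ?invr_gt0// invrK; congr EFin; field.
  by rewrite !gt_eqF.
rewrite integral_lebR; last 2 first.
- by move=> x; rewrite lee_fin.
- exact/measurable_EFinP.
rewrite gamma_funE// integral_inverse [RHS]integral_mkcond.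
apply: eq_integral => x _; rewrite patchE mem_setE in_itv/= andbT /f.
by case: ifP.
Qed.

End inverse_gamma.

(** * Conjugacy at a single node *)

Section conjugate.
Context {R : realType}.
Variables (n p : nat) (X : 'M[R]_(n, p)) (lam : 'rV[R]_p).
Hypothesis lam_gt0 : forall i, 0 < lam 0 i.

Definition prec : 'M[R]_p := X^T *m X + diag_mx lam.
Definition post_mean (d : 'cV[R]_n) : 'cV[R]_p := invmx prec *m X^T *m d.
Definition post_ups (d : 'cV[R]_n) : R :=
  2^-1 * (d^T *m d - (post_mean d)^T *m prec *m post_mean d) 0 0.
Definition sqn m (v : 'cV[R]_m) : R := (v^T *m v) 0 0.

Lemma sqnE m (v : 'cV[R]_m) : sqn v = \sum_i v i 0 ^+ 2.
Proof. by rewrite /sqn mxE; apply: eq_bigr => i _; rewrite mxE expr2. Qed.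

Lemma sqn_ge0 m (v : 'cV[R]_m) : 0 <= sqn v.
Proof. by rewrite sqnE sumr_ge0// => i _; rewrite sqr_ge0. Qed.

Lemma bilin_diag (t : 'cV[R]_p) :
  bilin (diag_mx lam) t t = \sum_i lam 0 i * t i 0 ^+ 2.
Proof.
rewrite /bilin mul_mx_diag mxE; apply: eq_bigr => i _.
by rewrite !mxE; ring.
Qed.

Lemma bilin_prec (t : 'cV[R]_p) :
  bilin prec t t = sqn (X *m t) + bilin (diag_mx lam) t t.
Proof.
rewrite /bilin /prec mulmxDr mulmxDl [LHS]mxE; congr (_ + _).
by rewrite /sqn trmx_mul !mulmxA.
Qed.

Lemma posdef_prec : posdef prec.
Proof.
split; first by rewrite /prec linearD/= trmx_mul trmxK tr_diag_mx.
move=> t t0; rewrite bilin_prec ltr_wpDl ?sqn_ge0// bilin_diag.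
have [i ti] : exists i, t i 0 != 0.
  apply/existsP; apply: contraNT t0; rewrite negb_exists => /forallP h.
  by apply/eqP/matrixP => i j; rewrite ord1 mxE; apply/eqP; have := h i; rewrite negbK.
rewrite (bigD1 i)//= ltr_wpDr//; last by rewrite pmulr_rgt0// exprn_even_gt0.
by rewrite sumr_ge0// => k _; rewrite mulr_ge0 ?sqr_ge0// ltW.
Qed.

Lemma prec_unit : prec \in unitmx.
Proof. by rewrite unitmxE unitfE gt_eqF// posdef_det_gt0//; exact: posdef_prec. Qed.

Lemma prec_post_mean d : prec *m post_mean d = X^T *m d.
Proof. by rewrite /post_mean -mulmxA mulKVmx ?prec_unit. Qed.

(** The normal equations [prec_post_mean] match the terms linear in [t]; the constant that is left
    is twice [post_ups]. *)
Lemma complete_square (t : 'cV[R]_p) (d : 'cV[R]_n) :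
  bilin (diag_mx lam) t t + sqn (d - X *m t) =
  bilin prec (t - post_mean d) (t - post_mean d) + 2 * post_ups d.
Proof.
have AT := proj1 posdef_prec.
set mu := post_mean d.
have tm : bilin prec t mu = (t^T *m X^T *m d) 0 0.
  by rewrite /bilin -mulmxA prec_post_mean mulmxA.
have upsE : 2 * post_ups d = sqn d - bilin prec mu mu.
  by rewrite /post_ups mulrA divff// mul1r [LHS]mxE [X in _ + X]mxE.
have sqB : sqn (d - X *m t) = sqn d - 2 * (t^T *m X^T *m d) 0 0 + sqn (X *m t).
  have dT : (d - X *m t)^T = d^T - (X *m t)^T by rewrite linearB.
  rewrite /sqn dT mulmxBl !mulmxBr.
  have e : (d^T *m (X *m t)) 0 0 = ((X *m t)^T *m d) 0 0.
    have -> : (X *m t)^T *m d = (d^T *m (X *m t))^T by rewrite !trmx_mul trmxK.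
    by rewrite [RHS]mxE.
  rewrite -trmx_mul [LHS]mxE [X in X + _]mxE [X in _ + X]mxE [X in _ - X]mxE.
  rewrite [X in _ + X - _]mxE [X in _ - (_ + X)]mxE e; ring.
have -> : bilin prec (t - mu) (t - mu) =
    bilin prec t t - 2 * bilin prec t mu + bilin prec mu mu.
  rewrite bilinDr bilinNr [bilin _ (_ - _) t]bilinC// [bilin _ (_ - _) mu]bilinC//.
  by rewrite !bilinDr !bilinNr [bilin _ mu t]bilinC//; ring.
rewrite sqB upsE tm bilin_prec; ring.
Qed.

(** At the posterior mean the square vanishes, and twice [post_ups] becomes a sum of two nonnegative
    forms. *)
Lemma post_ups_ge0 d : 0 <= post_ups d.
Proof.
have := complete_square (post_mean d) d; rewrite subrr.
rewrite [bilin prec 0 _]/bilin mulmx0 [X in _ = X + _]mxE add0r => e.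
rewrite -(pmulr_rge0 _ (ltr0Sn _ 1)) -e addr_ge0 ?sqn_ge0// bilin_diag.
by rewrite sumr_ge0// => i _; rewrite mulr_ge0 ?sqr_ge0// ltW.
Qed.

Definition prior_dens (s : R) (t : p.-tuple R) : R :=
  \prod_(i < p) npdf 0 (s / lam 0 i) (tnth t i).
Definition lik_dens (s : R) (t : p.-tuple R) (d : n.-tuple R) : R :=
  \prod_(o < n) npdf ((X *m tcol t) o 0) s (tnth d o).

Lemma prodr_expR m (f : 'I_m -> R) : \prod_i expR (f i) = expR (\sum_i f i).
Proof. by rewrite (big_morph expR (@expRD R) (@expR0 R)). Qed.

Lemma sqrtr_prod m (f : 'I_m -> R) : (forall i, 0 <= f i) ->
  Num.sqrt (\prod_i f i) = \prod_i Num.sqrt (f i).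
Proof.
move=> f0; elim: m f f0 => [|m IH] f f0; first by rewrite !big_ord0 sqrtr1.
by rewrite !big_ord_recl sqrtrM// IH.
Qed.

Lemma prior_lik_dens (s : R) (t : p.-tuple R) (d : n.-tuple R) : 0 < s ->
  prior_dens s t * lik_dens s t d =
  Num.sqrt (\det (diag_mx lam)) / Num.sqrt (\det prec) *
  (Num.sqrt (2 * pi * s) ^+ n)^-1 * expR (- (post_ups (tcol d) / s)) *
  gdens prec (post_mean (tcol d)) s t.
Proof.
move=> s0; have pi0 := pi_gt0 R.
have sp : 0 < 2 * pi * s by rewrite !mulr_gt0.
have dp : 0 < Num.sqrt (\det prec).
  by rewrite sqrtr_gt0 posdef_det_gt0//; exact: posdef_prec.
rewrite /prior_dens /lik_dens /npdf !big_split/= !prodr_expR mulrACA -expRD.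
have -> : \prod_(i < p) (Num.sqrt (2 * pi * (s / lam 0 i)))^-1 =
    Num.sqrt (\det (diag_mx lam)) * (Num.sqrt (2 * pi * s) ^+ p)^-1.
  rewrite det_diag sqrtr_prod => [|i]; last exact: ltW.
  have -> : (Num.sqrt (2 * pi * s) ^+ p)^-1 = \prod_(i < p) (Num.sqrt (2 * pi * s))^-1.
    by rewrite prodfV prodr_const card_ord.
  rewrite -big_split/=; apply: eq_bigr => i _.
  have -> : 2 * pi * (s / lam 0 i) = (lam 0 i)^-1 * (2 * pi * s) by field; rewrite gt_eqF.
  by rewrite [in LHS]sqrtrM ?invr_ge0 ?ltW// invfM sqrtrV ?ltW// invrK.
rewrite prodr_const card_ord /gdens exprVn.
have -> : forall e, expR e = expR (- (post_ups (tcol d) / s)) * expR (e + post_ups (tcol d) / s).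
  by move=> e; rewrite -expRD; congr expR; ring.
rewrite (_ : _ + _ + post_ups (tcol d) / s =
  - (bilin prec (tcol t - post_mean (tcol d)) (tcol t - post_mean (tcol d)) / (2 * s))).
  have : Num.sqrt (2 * pi * s) != 0 by rewrite gt_eqF// sqrtr_gt0.
  move: (expR _) (expR _) (Num.sqrt (2 * pi * s)) => e1 e2 q q0.
  by field; rewrite !expf_neq0// gt_eqF.
have -> : bilin prec (tcol t - post_mean (tcol d)) (tcol t - post_mean (tcol d)) =
    bilin (diag_mx lam) (tcol t) (tcol t) + sqn (tcol d - X *m tcol t)
    - 2 * post_ups (tcol d).
  by rewrite complete_square addrK.
rewrite bilin_diag sqnE !sumrN -!mulr_suml.
have -> : \sum_i (tnth t i - 0) ^+ 2 / (2 * (s / lam 0 i)) =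
   (\sum_i lam 0 i * tcol t i 0 ^+ 2) / (2 * s).
  rewrite mulr_suml; apply: eq_bigr => i _; rewrite subr0 mxE.
  by field; rewrite !gt_eqF.
rewrite (eq_bigr (fun i => (tcol d - X *m tcol t) i 0 ^+ 2)); last first.
  by move=> i _; rewrite !mxE.
by field; rewrite gt_eqF.
Qed.

(** A multivariate Student density: [marg_lik] with shape and scale left as parameters. *)
Definition marg (a b : R) (d : n.-tuple R) : R :=
  (b `^ a * gamma_fun (a + n%:R / 2)) / ((2 * pi) `^ (n%:R / 2) * gamma_fun a)
  * (Num.sqrt (\det (diag_mx lam)) / Num.sqrt (\det prec))
  * (b + post_ups (tcol d)) `^ (- (a + n%:R / 2)).

Lemma sqrt_expr_powR (x : R) k : 0 <= x -> Num.sqrt x ^+ k = x `^ (k%:R / 2).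
Proof.
by move=> x0; rewrite -powR12_sqrt// -powR_mulrn ?powR_ge0// -powRrM mulrC.
Qed.

(** A pointwise identity, prior to any integration; for s <= 0 the inverse gamma densities on both
    sides vanish. *)
Lemma bayes (a b s : R) (t : p.-tuple R) (d : n.-tuple R) : 1 < a -> 0 < b ->
  igpdf a b s * (prior_dens s t * lik_dens s t d) =
  marg a b d * (igpdf (a + n%:R / 2) (b + post_ups (tcol d)) s *
                gdens prec (post_mean (tcol d)) s t).
Proof.
move=> a1 b0; rewrite /igpdf; case: ifPn => [s0|_]; last by rewrite !mul0r mulr0.
rewrite prior_lik_dens//; move: (gdens _ _ _ _) => gd.
rewrite !mulrA; congr (_ * _).
have pi0 := pi_gt0 R.
have u0 := post_ups_ge0 (tcol d).
have bu : 0 < b + post_ups (tcol d) by rewrite ltr_pwDl.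
have g0 : 0 < gamma_fun a by exact: gamma_fun_gt0.
have g1 : 0 < gamma_fun (a + n%:R / 2).
  by apply: gamma_fun_gt0; rewrite ltr_wpDr// divr_ge0.
rewrite /inv_gamma_pdf /marg sqrtrM ?mulr_ge0 ?ltW// exprMn !sqrt_expr_powR ?mulr_ge0 ?ltW//.
rewrite powRN.
have -> : s `^ (- (a + n%:R / 2) - 1) = s `^ (- a - 1) * (s `^ (n%:R / 2))^-1.
  rewrite -powRN -powRD; last by apply/implyP => _; rewrite gt_eqF.
  by congr (_ `^ _); ring.
have -> : expR (- ((b + post_ups (tcol d)) / s)) =
    expR (- (b / s)) * expR (- (post_ups (tcol d) / s)).
  by rewrite -expRD; congr expR; field; rewrite gt_eqF.
have : 0 < s `^ (n%:R / 2) by exact: powR_gt0.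
have : 0 < (2 * (pi : R)) `^ (n%:R / 2) by apply: powR_gt0; rewrite mulr_gt0.
have : 0 < (b + post_ups (tcol d)) `^ (a + n%:R / 2) by exact: powR_gt0.
have : 0 < Num.sqrt (\det prec).
  by rewrite sqrtr_gt0 posdef_det_gt0//; exact: posdef_prec.
(* With powers, exponentials, gamma values and determinants made opaque, a rational identity
   remains. *)
move: (Num.sqrt (\det prec)) (_ `^ (a + _)) ((2 * pi) `^ _) (s `^ (n%:R / 2)).
move=> q1 q2 q3 q4 /gt_eqF/negbT h1 /gt_eqF/negbT h2 /gt_eqF/negbT h3 /gt_eqF/negbT h4.
move/gt_eqF/negbT: g0; move/gt_eqF/negbT: g1.
move: (gamma_fun a) (gamma_fun _) (expR _) (expR _) (b `^ a) (s `^ _) (Num.sqrt _).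
by move=> r1 r2 r3 r4 r5 r6 r7 k1 k2; field; rewrite k1 k2 h1 h2 h3 h4.
Qed.

Lemma marg_gt0 (a b : R) (d : n.-tuple R) : 1 < a -> 0 < b -> 0 < marg a b d.
Proof.
move=> a1 b0; rewrite /marg.
have g0 : 0 < gamma_fun a by exact: gamma_fun_gt0.
have g1 : 0 < gamma_fun (a + n%:R / 2).
  by apply: gamma_fun_gt0; rewrite ltr_wpDr// divr_ge0.
have bu : 0 < b + post_ups (tcol d) by rewrite ltr_pwDl// post_ups_ge0.
have D0 : 0 < \det (diag_mx lam) by rewrite det_diag prodr_gt0.
have D1 : 0 < \det prec by rewrite posdef_det_gt0//; exact: posdef_prec.
have pi0 := pi_gt0 R.
apply: mulr_gt0; last exact: powR_gt0.
apply: mulr_gt0; last by rewrite divr_gt0 ?sqrtr_gt0.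
apply: divr_gt0; apply: mulr_gt0 => //; apply: powR_gt0 => //; exact: mulr_gt0.
Qed.

(** As [post_ups] is nonnegative and the exponent negative, dropping it can only increase the value.
    The bound is free of the data, which makes [marg] integrable under every finite node law, also
    that of another state. *)
Lemma marg_le (a b : R) (d : n.-tuple R) : 1 < a -> 0 < b ->
  marg a b d <=
  (b `^ a * gamma_fun (a + n%:R / 2)) / ((2 * pi) `^ (n%:R / 2) * gamma_fun a)
  * (Num.sqrt (\det (diag_mx lam)) / Num.sqrt (\det prec))
  * b `^ (- (a + n%:R / 2)).
Proof.
move=> a1 b0; rewrite /marg.
have g0 : 0 < gamma_fun a by exact: gamma_fun_gt0.
have g1 : 0 < gamma_fun (a + n%:R / 2).
  by apply: gamma_fun_gt0; rewrite ltr_wpDr// divr_ge0.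
have u0 := post_ups_ge0 (tcol d).
have bu : 0 < b + post_ups (tcol d) by rewrite ltr_pwDl.
have pi0 := pi_gt0 R.
rewrite ler_wpM2l//.
  apply: mulr_ge0; last by rewrite divr_ge0 ?sqrtr_ge0.
  by rewrite divr_ge0 ?mulr_ge0 ?powR_ge0 ?(ltW g0) ?(ltW g1).
rewrite !powRN lef_pV2 ?posrE ?powR_gt0//.
rewrite ge0_ler_powR ?nnegrE//; rewrite ?(ltW b0) ?(ltW bu)//.
- by rewrite addr_ge0 ?divr_ge0// (le_trans _ (ltW a1)).
- by rewrite lerDl.
Qed.

End conjugate.

(** * The joint law at one node and its disintegration *)

Section node_law.
Context {R : realType}.
Variables (n p : nat) (lam : 'rV[R]_p) (a b : R).
Hypotheses (lam_gt0 : forall i, 0 < lam 0 i) (a1 : 1 < a) (b0 : 0 < b).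

Local Notation T := (R * (p.-tuple R * n.-tuple R))%type.
Local Notation base := (prodm lebR (prodm (lebn p) (lebn n))).

Definition mask (w : 'I_p -> bool) (t : p.-tuple R) : p.-tuple R :=
  [tuple (w i)%:R * tnth t i | i < p].

Lemma measurable_mask w : measurable_fun setT (mask w).
Proof.
by apply: (measurable_tuple_map2 (g := fun i x => (w i)%:R * x)) => i; exact: measurable_funM.
Qed.

Definition mask_coef (w : 'I_p -> bool) (q : T) : T := (q.1, (mask w q.2.1, q.2.2)).

Lemma measurable_mask_coef w : measurable_fun setT (mask_coef w).
Proof.
apply: measurable_fun_pair => //; apply: measurable_fun_pair.
  apply: (measurableT_comp (measurable_mask w)).
  exact: (measurableT_comp measurable_fst measurable_snd).
exact: (measurableT_comp measurable_snd measurable_snd).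
Qed.

Let m1 : measurable_fun setT (fun q : T => q.1). Proof. exact: measurable_fst. Qed.
Let m2 : measurable_fun setT (fun q : T => q.2.1).
Proof. exact: (measurableT_comp measurable_fst measurable_snd). Qed.
Let m3 : measurable_fun setT (fun q : T => q.2.2).
Proof. exact: (measurableT_comp measurable_snd measurable_snd). Qed.

Lemma integral_base (f : R -> p.-tuple R -> n.-tuple R -> \bar R) :
  (forall s t d, 0 <= f s t d)%E ->
  measurable_fun setT (fun q : T => f q.1 q.2.1 q.2.2) ->
  (\int[base]_q f q.1 q.2.1 q.2.2 =
   \int[lebR]_s \int[lebn p]_t \int[lebn n]_d f s t d)%E.
Proof.
move=> f0 mf.
rewrite (integral_prodm lebR (prodm (lebn p) (lebn n))
  (f := fun s (q : p.-tuple R * n.-tuple R) => f s q.1 q.2))//.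
apply: eq_integral => s _.
rewrite (integral_prodm (lebn p) (lebn n) (f := fun t d => f s t d))//.
exact: (measurableT_comp mf (pair1_measurable s)).
Qed.

Lemma integral_base_swap (f : R -> p.-tuple R -> n.-tuple R -> \bar R) :
  (forall s t d, 0 <= f s t d)%E ->
  measurable_fun setT (fun q : T => f q.1 q.2.1 q.2.2) ->
  (\int[base]_q f q.1 q.2.1 q.2.2 =
   \int[lebn n]_d \int[lebR]_s \int[lebn p]_t f s t d)%E.
Proof.
move=> f0 mf; rewrite integral_base//.
transitivity (\int[lebR]_s \int[lebn n]_d \int[lebn p]_t f s t d)%E.
  apply: eq_integral => s _; rewrite tonelli//.
  exact: (measurableT_comp mf (pair1_measurable s)).
rewrite tonelli//.
- by move=> s d; exact: integral_ge0.
- apply: (measurable_integralr (lebn p)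
    (f := fun (sd : R * n.-tuple R) t => f sd.1 t sd.2)) => //.
  have mg : measurable_fun setT (fun q : (R * n.-tuple R) * p.-tuple R =>
      (q.1.1, (q.2, q.1.2))).
    apply: measurable_fun_pair.
      exact: (measurableT_comp measurable_fst measurable_fst).
    apply: measurable_fun_pair => //.
    exact: (measurableT_comp measurable_snd measurable_fst).
  exact: (measurableT_comp mf mg).
Qed.

Section state.
Variables (X1 X : 'M[R]_(n, p)) (w : 'I_p -> bool).
Hypothesis XE : X = \matrix_(o, i) (X1 o i * (w i)%:R).

Local Notation A := (prec X lam).
Let a' := a + n%:R / 2.
Let b' (d : n.-tuple R) := b + post_ups X lam (tcol d).

Let a'1 : 1 < a'. Proof. by rewrite ltr_wpDr// divr_ge0. Qed.
Let b'0 d : 0 < b' d. Proof. by rewrite ltr_pwDl// post_ups_ge0. Qed.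

Definition node_dens (q : T) : R :=
  igpdf a b q.1 * (prior_dens lam q.1 q.2.1 * lik_dens X q.1 q.2.1 q.2.2).

Lemma prior_dens_ge0 s t : 0 <= prior_dens lam s t.
Proof. by rewrite prodr_ge0// => i _; exact: npdf_ge0. Qed.

Lemma lik_dens_ge0 s t d : 0 <= lik_dens X s t d.
Proof. by rewrite prodr_ge0// => i _; exact: npdf_ge0. Qed.

Lemma node_dens_ge0 q : 0 <= node_dens q.
Proof. by rewrite !mulr_ge0 ?igpdf_ge0 ?prior_dens_ge0 ?lik_dens_ge0. Qed.

Lemma measurable_prior_dens d (T' : measurableType d) (s : T' -> R) (t : T' -> p.-tuple R) :
  measurable_fun setT s -> measurable_fun setT t ->
  measurable_fun setT (fun q => prior_dens lam (s q) (t q)).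
Proof.
move=> ms mt; apply: measurable_prod => i _; apply: measurable_npdf => //.
  exact: measurable_div.
exact: (measurableT_comp (measurable_tnth i) mt).
Qed.

Lemma measurable_node_dens : measurable_fun setT node_dens.
Proof.
apply: measurable_funM; first exact: measurable_igpdf.
apply: measurable_funM; first exact: measurable_prior_dens.
apply: measurable_prod => i _; apply: measurable_npdf => //.
  by apply: vmeasurable_mul; exact: vmeasurable_tcol.
exact: (measurableT_comp (measurable_tnth i) m3).
Qed.

(* Joint law of the variance, the coefficients and the data at a node; the
   coefficients are the masked coordinates of a nondegenerate latent vector. *)
Definition nodeQ : {measure set T -> \bar R} :=
  image_measure (weighted base node_dens_ge0 measurable_node_dens)
    (measurable_mask_coef w).

Lemma integral_nodeQ (g : T -> \bar R) :
  (forall q, 0 <= g q)%E -> measurable_fun setT g ->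
  (\int[nodeQ]_q g q = \int[base]_q (g (mask_coef w q) * (node_dens q)%:E))%E.
Proof.
move=> g0 mg; rewrite /nodeQ integral_image_measure//.
rewrite integral_weighted; [by []|by move=> q; exact: g0|].
exact: (measurableT_comp mg (measurable_mask_coef w)).
Qed.

Definition post_sc (d : n.-tuple R) (s : R) (t : p.-tuple R) : R :=
  igpdf a' (b' d) s * gdens A (post_mean X lam (tcol d)) s t.

Lemma post_sc_ge0 d s t : 0 <= post_sc d s t.
Proof. by rewrite mulr_ge0 ?igpdf_ge0 ?gdens_ge0. Qed.

Lemma vmeasurable_post_mean d (T' : measurableType d) (f : T' -> n.-tuple R) :
  measurable_fun setT f -> vmeasurable (fun q => post_mean X lam (tcol (f q))).
Proof. by move=> mf; apply: vmeasurable_mul; exact: vmeasurable_tcol. Qed.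

Lemma measurable_post_ups d (T' : measurableType d) (f : T' -> n.-tuple R) :
  measurable_fun setT f ->
  measurable_fun setT (fun q => post_ups X lam (tcol (f q))).
Proof.
move=> mf; rewrite (_ : (fun _ => _) = fun q => 2^-1 *
    (bilin 1%:M (tcol (f q)) (tcol (f q)) -
     bilin A (post_mean X lam (tcol (f q))) (post_mean X lam (tcol (f q))))).
  apply: measurable_funM => //; apply: measurable_funB; apply: measurable_bilin;
    try exact: vmeasurable_tcol; exact: vmeasurable_post_mean.
apply/funext => q; rewrite /post_ups /bilin mulmx1.
by rewrite [X in _ * X = _]mxE [X in _ * (_ + X) = _]mxE.
Qed.

Lemma measurable_post_sc d (T' : measurableType d) (f : T' -> n.-tuple R)
    (s : T' -> R) (t : T' -> p.-tuple R) :
  measurable_fun setT f -> measurable_fun setT s -> measurable_fun setT t ->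
  measurable_fun setT (fun q => post_sc (f q) (s q) (t q)).
Proof.
move=> mf ms mt; apply: measurable_funM.
  by apply: measurable_igpdf => //; apply: measurable_funD => //; exact: measurable_post_ups.
by apply: measurable_gdens => //; exact: vmeasurable_post_mean.
Qed.

Lemma measurable_marg d (T' : measurableType d) (f : T' -> n.-tuple R) :
  measurable_fun setT f ->
  measurable_fun setT (fun q => marg X lam a b (f q)).
Proof.
move=> mf; apply: measurable_funM => //; apply: measurable_powR_fun.
by apply: measurable_funD => //; exact: measurable_post_ups.
Qed.

(** [bayes] under the integral sign, with the data moved outside by Tonelli: the data have density
    [marg], and given them variance and latent coefficients have density [post_sc]. *)
Lemma integral_nodeQ_post (g : R -> p.-tuple R -> n.-tuple R -> R) :
  (forall s c d, 0 <= g s c d) ->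
  measurable_fun setT (fun q : T => g q.1 q.2.1 q.2.2) ->
  (\int[nodeQ]_q (g q.1 q.2.1 q.2.2)%:E =
   \int[lebn n]_d ((marg X lam a b d)%:E *
     \int[lebR]_s \int[lebn p]_t (post_sc d s t * g s (mask w t) d)%:E))%E.
Proof.
move=> g0 mg; rewrite integral_nodeQ//; last 2 first.
- by move=> q; rewrite lee_fin.
- exact/measurable_EFinP.
have mgm := measurableT_comp mg (measurable_mask_coef w).
rewrite (integral_base_swap (f := fun s t d =>
  (g s (mask w t) d * node_dens (s, (t, d)))%:E)); last 2 first.
- by move=> s t d; rewrite lee_fin mulr_ge0// node_dens_ge0.
- apply/measurable_EFinP; apply: measurable_funM => //.
  by rewrite (_ : (fun _ => _) = node_dens); [exact: measurable_node_dens|apply/funext => -[? []]].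
have mpg : measurable_fun setT (fun q : T => post_sc q.2.2 q.1 q.2.1 * g q.1 (mask w q.2.1) q.2.2).
  by apply: measurable_funM => //; exact: measurable_post_sc.
apply: eq_integral => d _.
have msd : measurable_fun setT (fun q : R * p.-tuple R => (post_sc d q.1 q.2 * g q.1 (mask w q.2) d)%:E).
  apply/measurable_EFinP.
  have mi : measurable_fun setT (fun q : R * p.-tuple R => (q.1, (q.2, d))).
    by apply: measurable_fun_pair => //; exact: measurable_fun_pair.
  exact: (measurableT_comp mpg mi).
have sg0 s t : (0 <= (post_sc d s t * g s (mask w t) d)%:E)%E.
  by rewrite lee_fin mulr_ge0// post_sc_ge0.
rewrite -ge0_integralZl//; first last.
- by rewrite lee_fin ltW// marg_gt0.
- by move=> s _; exact: integral_ge0.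
- exact: (measurable_integralr (lebn p) sg0 msd).
apply: eq_integral => s _; rewrite -ge0_integralZl//; first last.
- by rewrite lee_fin ltW// marg_gt0.
- exact: (measurableT_comp msd (pair1_measurable s)).
apply: eq_integral => t _; rewrite -EFinM; congr EFin.
by rewrite /node_dens/= bayes// /post_sc /a' /b'; ring.
Qed.

Definition post_coef (d : n.-tuple R) (s : R) (B : set (p.-tuple R)) : \bar R :=
  (\int[lebn p]_t (gdens A (post_mean X lam (tcol d)) s t * \1_B (mask w t))%:E)%E.

Definition post_joint (d : n.-tuple R) (B : set (R * p.-tuple R)) : \bar R :=
  (\int[lebR]_s \int[lebn p]_t (post_sc d s t * \1_B (s, mask w t))%:E)%E.

Lemma post_coefT d s : 0 < s -> post_coef d s setT = 1%E.
Proof.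
move=> s0; rewrite /post_coef; under eq_integral do rewrite indicT mulr1.
by apply: integral_gdens => //; exact: posdef_prec.
Qed.

Lemma post_coef_ge0 d s B : (0 <= post_coef d s B)%E.
Proof. by apply: integral_ge0 => t _; rewrite lee_fin mulr_ge0// gdens_ge0. Qed.

Lemma measurable_post_coef_fun d (T' : measurableType d) (f : T' -> n.-tuple R)
    (s : T' -> R) (B : set (p.-tuple R)) :
  measurable_fun setT f -> measurable_fun setT s -> measurable B ->
  measurable_fun setT (fun q => post_coef (f q) (s q) B).
Proof.
move=> mf ms mB; apply: (measurable_integralr (lebn p)
  (f := fun q t => (gdens A (post_mean X lam (tcol (f q))) (s q) t * \1_B (mask w t))%:E)).
  by move=> q t; rewrite lee_fin mulr_ge0// gdens_ge0.
apply/measurable_EFinP; apply: measurable_funM.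
  apply: measurable_gdens => //.
    by apply: vmeasurable_post_mean; exact: (measurableT_comp mf measurable_fst).
  exact: (measurableT_comp ms measurable_fst).
apply: measurable_indic_comp => //.
exact: (measurableT_comp (measurable_mask w) measurable_snd).
Qed.

Lemma post_coef_le1 d s B : 0 < s -> measurable B -> (post_coef d s B <= 1)%E.
Proof.
move=> s0 mB; rewrite -(post_coefT d s0); apply: ge0_le_integral => //.
- by move=> t _; rewrite lee_fin mulr_ge0// gdens_ge0.
- apply/measurable_EFinP; apply: measurable_funM.
    by apply: measurable_gdens => //; exact: cvmeasurable.
  by apply: measurable_indic_comp => //; exact: measurable_mask.
- apply/measurable_EFinP; apply: measurable_funM.
    by apply: measurable_gdens => //; exact: cvmeasurable.
  by apply: measurable_indic_comp => //; exact: measurable_mask.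
- by move=> t _; rewrite lee_fin indicT ler_wpM2l ?gdens_ge0// indicE; case: (_ \in _).
Qed.

Lemma integral_post_sc d (g : R -> R) : (forall s, 0 <= g s) -> measurable_fun setT g ->
  (\int[lebR]_s \int[lebn p]_t (post_sc d s t * g s)%:E =
   \int[lebR]_s (igpdf a' (b' d) s * g s)%:E)%E.
Proof.
move=> g0 mg; apply: eq_integral => s _.
(* For s <= 0 the mass of [gdens] is not known to be 1, but the inverse gamma density vanishes. *)
have [s0|s0] := ltP 0 s; last first.
  rewrite /post_sc /igpdf ltNge s0/= mul0r.
  by under eq_integral do rewrite !mul0r; rewrite integral0.
under eq_integral do rewrite /post_sc mulrAC EFinM.
rewrite ge0_integralZl//; first last.
- by rewrite lee_fin mulr_ge0 ?igpdf_ge0.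
- by move=> t _; rewrite lee_fin gdens_ge0.
- by apply/measurable_EFinP; apply: measurable_gdens => //; exact: cvmeasurable.
by rewrite integral_gdens ?mule1//; exact: posdef_prec.
Qed.

Lemma integral_nodeQ_data (g : n.-tuple R -> R) :
  (forall d, 0 <= g d) -> measurable_fun setT g ->
  (\int[nodeQ]_q (g q.2.2)%:E = \int[lebn n]_d (marg X lam a b d * g d)%:E)%E.
Proof.
move=> g0 mg; rewrite (integral_nodeQ_post (g := fun _ _ d => g d))//; last first.
  exact: (measurableT_comp mg m3).
apply: eq_integral => d _; rewrite [RHS]EFinM; congr (_ * _)%E.
rewrite (integral_post_sc d (g := fun _ => g d))//.
under eq_integral do rewrite EFinM.
rewrite ge0_integralZr//; first last.
- by rewrite lee_fin.
- by move=> s _; rewrite lee_fin igpdf_ge0.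
- by apply/measurable_EFinP; exact: measurable_igpdf.
by rewrite integral_igpdf// mul1e.
Qed.

Lemma post_joint_ge0 d B : (0 <= post_joint d B)%E.
Proof.
apply: integral_ge0 => s _; apply: integral_ge0 => t _.
by rewrite lee_fin mulr_ge0// post_sc_ge0.
Qed.

Lemma post_joint_var d (B : set R) : measurable B ->
  post_joint d (fst @^-1` B) = inv_gamma a' (b' d) B.
Proof.
move=> mB; rewrite inv_gammaE// /post_joint.
rewrite (integral_post_sc d (g := fun s => \1_B s))//.
exact: measurable_indic.
Qed.

Lemma post_jointT d : post_joint d setT = 1%E.
Proof.
rewrite -(preimage_setT fst) post_joint_var// inv_gammaE//.
by under eq_integral do rewrite indicT mulr1; exact: integral_igpdf.
Qed.

Let measurable_post_joint_integrand d (T' : measurableType d)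
    (f : T' -> n.-tuple R) (B : set (R * p.-tuple R)) :
  measurable_fun setT f -> measurable B ->
  measurable_fun setT (fun q : T' * (R * p.-tuple R) =>
    (post_sc (f q.1) q.2.1 q.2.2 * \1_B (q.2.1, mask w q.2.2))%:E).
Proof.
move=> mf mB; apply/measurable_EFinP; apply: measurable_funM.
  apply: measurable_post_sc.
  - exact: (measurableT_comp mf measurable_fst).
  - exact: (measurableT_comp measurable_fst measurable_snd).
  - exact: (measurableT_comp measurable_snd measurable_snd).
apply: measurable_indic_comp => //; apply: measurable_fun_pair.
  exact: (measurableT_comp measurable_fst measurable_snd).
apply: (measurableT_comp (measurable_mask w)).
exact: (measurableT_comp measurable_snd measurable_snd).
Qed.

Lemma measurable_post_joint_fun d (T' : measurableType d)
    (f : T' -> n.-tuple R) (B : set (R * p.-tuple R)) :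
  measurable_fun setT f -> measurable B ->
  measurable_fun setT (fun q => post_joint (f q) B).
Proof.
move=> mf mB; have mi := measurable_post_joint_integrand mf mB.
apply: (measurable_integralr lebR (f := fun q s =>
  \int[lebn p]_t (post_sc (f q) s t * \1_B (s, mask w t))%:E)%E).
  by move=> q s; apply: integral_ge0 => t _; rewrite lee_fin mulr_ge0// post_sc_ge0.
apply: (measurable_integralr (lebn p) (f := fun (q : T' * R) t =>
  (post_sc (f q.1) q.2 t * \1_B (q.2, mask w t))%:E)).
  by move=> q t; rewrite lee_fin mulr_ge0// post_sc_ge0.
have mr : measurable_fun setT (fun q : (T' * R) * p.-tuple R => (q.1.1, (q.1.2, q.2))).
  apply: measurable_fun_pair; first exact: (measurableT_comp measurable_fst measurable_fst).
  apply: measurable_fun_pair => //.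
  exact: (measurableT_comp measurable_snd measurable_fst).
exact: (measurableT_comp mi mr).
Qed.

Lemma post_joint_le1 d B : measurable B -> (post_joint d B <= 1)%E.
Proof.
move=> mB.
have mi (C : set (R * p.-tuple R)) : measurable C ->
  measurable_fun setT (fun q : R * p.-tuple R => (post_sc d q.1 q.2 * \1_C (q.1, mask w q.2))%:E).
  move=> mC; have := measurable_post_joint_integrand (@measurable_id _ _ _) mC.
  by move=> h; exact: (measurableT_comp h (pair1_measurable d)).
have i0 (C : set (R * p.-tuple R)) s t : (0 <= (post_sc d s t * \1_C (s, mask w t))%:E)%E.
  by rewrite lee_fin mulr_ge0// post_sc_ge0.
rewrite -(post_jointT d); apply: ge0_le_integral => //.
- by move=> s _; exact: integral_ge0.
- exact: (measurable_integralr (lebn p) (i0 B) (mi _ mB)).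
- exact: (measurable_integralr (lebn p) (i0 setT) (mi _ measurableT)).
- move=> s _; apply: ge0_le_integral => //.
  + exact: (measurableT_comp (mi _ mB) (pair1_measurable s)).
  + exact: (measurableT_comp (mi _ measurableT) (pair1_measurable s)).
  + by move=> t _; rewrite lee_fin indicT ler_wpM2l ?post_sc_ge0// indicE; case: (_ \in _).
Qed.

Lemma post_joint_fin d B : measurable B -> post_joint d B \is a fin_num.
Proof.
move=> mB; rewrite ge0_fin_numE ?post_joint_ge0//.
by rewrite (le_lt_trans (post_joint_le1 d mB))// ltry.
Qed.

Lemma post_coef_fin d s B : 0 < s -> measurable B -> post_coef d s B \is a fin_num.
Proof.
move=> s0 mB; rewrite ge0_fin_numE ?post_coef_ge0//.
by rewrite (le_lt_trans (post_coef_le1 d s0 mB))// ltry.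
Qed.

(** Disintegrating both sides over the data leaves the posterior integral of the indicator of [B] on
    each. Thus [post_joint] is a conditional law of variance and coefficients given the data of the
    node. *)
Lemma nodeQ_joint (B : set (R * p.-tuple R)) (C : set (n.-tuple R)) :
  measurable B -> measurable C ->
  (\int[nodeQ]_q (\1_B (q.1, q.2.1) * \1_C q.2.2)%:E =
   \int[nodeQ]_q (\1_C q.2.2 * fine (post_joint q.2.2 B))%:E)%E.
Proof.
move=> mB mC; rewrite (integral_nodeQ_post (g := fun s c d => \1_B (s, c) * \1_C d)); last 2 first.
- by move=> s c d; rewrite mulr_ge0.
- apply: measurable_funM; apply: measurable_indic_comp => //.
  exact: measurable_fun_pair.
rewrite (integral_nodeQ_data (g := fun d => \1_C d * fine (post_joint d B))); last 2 first.
- by move=> d; rewrite mulr_ge0// fine_ge0// post_joint_ge0.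
- apply: measurable_funM; first exact: measurable_indic.
  apply: (measurableT_comp (fine_measurable measurableT)).
  exact: (measurable_post_joint_fun (@measurable_id _ _ _)).
apply: eq_integral => d _; rewrite [RHS]EFinM; congr (_ * _)%E.
rewrite indicE; case: (d \in C).
  rewrite mul1r fineK; last exact: post_joint_fin.
  by apply: eq_integral => s _; apply: eq_integral => t _; rewrite mulr1.
rewrite mul0r; apply: integral0_eq => s _; apply: integral0_eq => t _.
by rewrite !mulr0.
Qed.

Let coef_measure d s : {measure set (p.-tuple R) -> \bar R} :=
  image_measure (weighted (lebn p) (gdens_ge0 A (post_mean X lam (tcol d)) s)
    (measurable_gdens A (cvmeasurable (post_mean X lam (tcol d)))
      (@measurable_cst _ _ _ _ setT s) (@measurable_id _ _ setT)))
    (measurable_mask w).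

Let coef_measureE d s B : measurable B -> coef_measure d s B = post_coef d s B.
Proof.
move=> mB; rewrite /post_coef.
have -> : coef_measure d s B = (\int[lebn p]_(t in mask w @^-1` B)
    (gdens A (post_mean X lam (tcol d)) s t)%:E)%E by [].
rewrite integral_mkcond; apply: eq_integral => t _; rewrite patchE indicE.
have -> : (t \in mask w @^-1` B) = (mask w t \in B) by apply/idP/idP; rewrite !inE.
by case: (mask w t \in B); rewrite ?mulr1 ?mulr0.
Qed.

Let coef_measureT d s : 0 < s -> coef_measure d s setT = 1%E.
Proof. by move=> s0; rewrite coef_measureE// post_coefT. Qed.

Let zt : p.-tuple R := [tuple of nseq p 0].

(** A kernel must be a probability for every [s], while the masked Gaussian has unit mass only for
    positive [s]; the unit mass at 0 fills the gap, which is negligible for the law of the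
    variance. *)
Definition coefK (d : n.-tuple R) (s : R) : probability (p.-tuple R) R :=
  match pselect (0 < s) with
  | left s0 => as_probability (@coef_measureT d s s0)
  | right _ => \d_zt
  end.

Lemma coefKE d s B : 0 < s -> measurable B -> coefK d s B = post_coef d s B.
Proof.
by move=> s0 mB; rewrite /coefK; case: pselect => // ?; rewrite -coef_measureE.
Qed.

Lemma coefK_nonpos d s B : s <= 0 -> coefK d s B = \d_zt B.
Proof. move=> s0; rewrite /coefK; case: pselect => // s1; exfalso.
by move: (lt_le_trans s1 s0); rewrite ltxx. Qed.

Lemma measurable_coefK d (T' : measurableType d) (f : T' -> n.-tuple R)
    (s : T' -> R) (B : set (p.-tuple R)) :
  measurable_fun setT f -> measurable_fun setT s -> measurable B ->
  measurable_fun setT (fun q => fine (coefK (f q) (s q) B)).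
Proof.
move=> mf ms mB; rewrite (_ : (fun _ => _) = fun q =>
    if 0 < s q then fine (post_coef (f q) (s q) B)
    else fine (\d_zt B)).
  apply: measurable_fun_ifT => //=; first exact: measurable_fun_ltr.
  apply: (measurableT_comp (fine_measurable measurableT)).
  exact: measurable_post_coef_fun.
apply/funext => q; case: ifPn => [s0|]; first by rewrite coefKE.
by rewrite -leNgt => s0; rewrite coefK_nonpos.
Qed.

(** Unlike in [nodeQ_joint], the variance stays among the test variables, so [coefK] is a
    conditional law given variance and data. *)
Lemma nodeQ_coef (D : set R) (B : set (p.-tuple R)) (C : set (n.-tuple R)) :
  measurable D -> measurable B -> measurable C ->
  (\int[nodeQ]_q (\1_D q.1 * \1_B q.2.1 * \1_C q.2.2)%:E =
   \int[nodeQ]_q (\1_D q.1 * \1_C q.2.2 * fine (coefK q.2.2 q.1 B))%:E)%E.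
Proof.
move=> mD mB mC; rewrite (integral_nodeQ_post (g := fun s c d => \1_D s * \1_B c * \1_C d)); last 2 first.
- by move=> s c d; rewrite !mulr_ge0.
- by apply: measurable_funM; [apply: measurable_funM|]; apply: measurable_indic_comp.
have fm (d : n.-tuple R) : measurable_fun setT (fun s => fine (coefK d s B)).
  by apply: (measurable_coefK (f := fun _ => d)).
rewrite (integral_nodeQ_post (g := fun s c d => \1_D s * \1_C d * fine (coefK d s B))); last 2 first.
- by move=> s c d; rewrite !mulr_ge0// fine_ge0.
- apply: measurable_funM; last exact: measurable_coefK.
  by apply: measurable_funM; apply: measurable_indic_comp.
apply: eq_integral => d _; congr (_ * _)%E; apply: eq_integral => s _.
have [s0|s0] := ltP 0 s; last first.
  by rewrite /post_sc /igpdf ltNge s0/=; apply: eq_integral => t _; rewrite !mul0r.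
have mg : measurable_fun setT (fun t => (gdens A (post_mean X lam (tcol d)) s t)%:E).
  by apply/measurable_EFinP; apply: measurable_gdens => //; exact: cvmeasurable.
transitivity ((igpdf a' (b' d) s * (\1_D s * \1_C d))%:E * post_coef d s B)%E.
  rewrite -ge0_integralZl//.
  - by apply: eq_integral => t _; rewrite -EFinM /post_sc; congr EFin; ring.
  - apply/measurable_EFinP; apply: measurable_funM; first exact/measurable_EFinP.
    by apply: measurable_indic_comp => //; exact: measurable_mask.
  - by move=> t _; rewrite lee_fin mulr_ge0// gdens_ge0.
  - by rewrite lee_fin !mulr_ge0// igpdf_ge0.
(* A Gaussian density of integral 1 is inserted to reach the form of the right-hand integral over
   [t]. *)
transitivity ((igpdf a' (b' d) s * (\1_D s * \1_C d) * fine (coefK d s B))%:E *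
    \int[lebn p]_t (gdens A (post_mean X lam (tcol d)) s t)%:E)%E.
  rewrite integral_gdens//; last exact: posdef_prec.
  by rewrite mule1 [RHS]EFinM coefKE// fineK// post_coef_fin.
rewrite -ge0_integralZl//.
- by apply: eq_integral => t _; rewrite -EFinM /post_sc; congr EFin; ring.
- by move=> t _; rewrite lee_fin gdens_ge0.
- by rewrite lee_fin !mulr_ge0 ?igpdf_ge0// fine_ge0.
Qed.

(** Masking the coefficients or the columns of the design has the same effect; hence the latent
    vector and the actual coefficients leave the same residuals. *)
Lemma mask_tcol (t : p.-tuple R) : X1 *m tcol (mask w t) = X *m tcol t.
Proof.
apply/matrixP => o j; rewrite !mxE; apply: eq_bigr => i _.
by rewrite XE !mxE tnth_mktuple mulrA.
Qed.

(* The inactive coordinates of the posterior mean vanish, since the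
   corresponding columns of X do. *)
Lemma post_mean_inactive (d : 'cV[R]_n) i : ~~ w i -> post_mean X lam d i 0 = 0.
Proof.
move=> wi; have X0 (v : 'cV[R]_n) : (X^T *m v) i 0 = 0.
  rewrite mxE big1// => o _; by rewrite XE !mxE (negbTE wi) mulr0 mul0r.
have := congr1 (fun v : 'cV[R]_p => v i 0) (prec_post_mean X lam_gt0 d).
rewrite /= X0 /prec mulmxDl [LHS]mxE -mulmxA X0 add0r mul_diag_mx mxE => /eqP.
by rewrite mulf_eq0 (gt_eqF (lam_gt0 i))/= => /eqP.
Qed.

(** A linear form t of the masked vector is the form w.t of the latent one, and [y] is A^-1(w.t), so
    [gdens_linear] applies with no extra variance. Then y'Ay is the form of ww' o A^-1 at t, and the
    mean needs no mask because its inactive coordinates are 0. *)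
Lemma coefK_normal (W : 'cV[R]_p) d s : 0 < s -> (forall i, W i 0 = (w i)%:R) ->
  is_mvnormal (post_mean X lam (tcol d))
    (s *: hadamard (W *m W^T) (invmx A)) (coefK d s).
Proof.
move=> s0 WE t B mB.
have AU := prec_unit X lam_gt0; have AT := proj1 (posdef_prec X lam_gt0).
pose wt : 'cV[R]_p := \col_i ((w i)%:R * t i 0).
pose y := invmx A *m wt.
have yE (v : 'cV[R]_p) : bilin A y v = (wt^T *m v) 0 0.
  rewrite /bilin; congr ((_ *m v) 0 0).
  by rewrite -[LHS]trmxK trmx_mul trmxK AT /y mulmxA mulmxV// mul1mx.
have mlin : measurable [set c : p.-tuple R | B (\sum_(i < p) t i 0 * tnth c i)].
  have mf : measurable_fun setT (fun c : p.-tuple R => \sum_(i < p) t i 0 * tnth c i).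
    by apply: measurable_sum => i; apply: measurable_funM => //; exact: measurable_tnth.
  by have := mf measurableT _ mB; rewrite setTI.
rewrite coefKE// /post_coef.
have := @gdens_linear R p A (post_mean X lam (tcol d)) y s 0 0 B
  (posdef_prec X lam_gt0) s0 (lexx _) mB.
rewrite !addr0 => gl.
have -> : (t^T *m post_mean X lam (tcol d)) 0 0 = bilin A y (post_mean X lam (tcol d)).
  rewrite yE [LHS]mxE [RHS]mxE; apply: eq_bigr => i _; rewrite [in RHS]mxE [X in X * _ = _]mxE.
  have [wi|wi] := boolP (w i); first by rewrite [X in _ = X * _]mxE wi mul1r.
  by rewrite post_mean_inactive// !mulr0.
have -> : (t^T *m (s *: hadamard (W *m W^T) (invmx A)) *m t) 0 0 = s * bilin A y y.
  rewrite -scalemxAr -scalemxAl [LHS]mxE; congr (_ * _).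
  rewrite yE /y mulmxA [LHS]mxE [RHS]mxE; apply: eq_bigr => j _.
  rewrite [wt j 0]mxE mulrA; congr (_ * _).
  rewrite [LHS]mxE [X in _ = X * _]mxE mulr_suml; apply: eq_bigr => i _.
  by rewrite [hadamard _ _ _ _]mxE [wt^T _ _]mxE [wt _ _]mxE [(W *m _) _ _]mxE big_ord1 !WE [W^T _ _]mxE WE [t^T _ _]mxE; ring.
rewrite -gl; apply: eq_integral => c _; rewrite normal_law0// EFinM; congr (_ * (_)%:E)%E.
rewrite yE mxE !indicE; congr (_%:R); congr nat_of_bool.
have -> : \sum_j wt^T 0 j * tcol c j 0 = \sum_i t i 0 * tnth (mask w c) i.
  by apply: eq_bigr => i _; rewrite !mxE tnth_mktuple; ring.
by rewrite addr0; apply/idP/idP; rewrite !inE.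
Qed.

(** A 0/1 factor equals its square, so it multiplies the variance unchanged, in agreement with the
    prior of the model. *)
Lemma integral_npdf_mask (wi : bool) v (B : set R) : 0 < v -> measurable B ->
  (\int[lebR]_t (npdf 0 v t * \1_B (wi%:R * t))%:E =
   normal_law 0 (wi%:R * v) B)%E.
Proof.
move=> v0 mB; have := @normal_law_mix R 0 v wi%:R 0 0 B v0 (lexx _) mB.
rewrite mulr0 !addr0; have -> : wi%:R ^+ 2 = wi%:R :> R by case: wi; rewrite ?expr1n ?expr0n.
by move=> <-; apply: eq_integral => t _; rewrite addr0 normal_law0// -EFinM.
Qed.

Lemma integral_npdf_shift m v (B : set R) : 0 < v -> measurable B ->
  (\int[lebR]_y (npdf m v y * \1_B (y - m))%:E = normal_law 0 v B)%E.
Proof.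
move=> v0 mB; rewrite normal_lawE//.
rewrite -(@integral_lebRD R m (fun y => (npdf m v y * \1_B (y - m))%:E)).
- by apply: eq_integral => y _; rewrite addrK /npdf addrK subr0.
- apply/measurable_EFinP; apply: measurable_funM; first exact: measurable_npdf1.
  by apply: measurable_indic_comp => //; exact: measurable_funB.
- by move=> y; rewrite lee_fin mulr_ge0// npdf_ge0.
Qed.

(* (variance, coefficients, noise) are the coordinates in which the model is
   specified. *)
Lemma nodeQ_rect (D : set R) (B : 'I_p -> set R) (C : 'I_n -> set R) :
  measurable D -> (forall i, measurable (B i)) -> (forall o, measurable (C o)) ->
  (\int[nodeQ]_q (\1_D q.1 * \prod_i \1_(B i) (tnth q.2.1 i) *
      \prod_o \1_(C o) (tnth q.2.2 o - (X1 *m tcol q.2.1) o 0)%R)%:E =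
   \int[lebR]_s (igpdf a b s * (\1_D s *
      \prod_i fine (normal_law 0 ((w i)%:R * (s / lam 0 i))%R (B i)) *
      \prod_o fine (normal_law 0 s (C o))))%:E)%E.
Proof.
move=> mD mB mC.
have mg : measurable_fun setT (fun q : T => \1_D q.1 * \prod_i \1_(B i) (tnth q.2.1 i) *
      \prod_o \1_(C o) (tnth q.2.2 o - (X1 *m tcol q.2.1) o 0) : R).
  apply: measurable_funM; first apply: measurable_funM.
  - exact: measurable_indic_comp.
  - apply: measurable_prod => i _; apply: measurable_indic_comp => //.
    exact: (measurableT_comp (measurable_tnth i) m2).
  - apply: measurable_prod => o _; apply: measurable_indic_comp => //.
    apply: measurable_funB; first exact: (measurableT_comp (measurable_tnth o) m3).
    by apply: vmeasurable_mul; exact: vmeasurable_tcol.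
have g0 (q : T) : 0 <= \1_D q.1 * \prod_i \1_(B i) (tnth q.2.1 i) *
      \prod_o \1_(C o) (tnth q.2.2 o - (X1 *m tcol q.2.1) o 0) :> R.
  by rewrite !mulr_ge0// prodr_ge0.
rewrite integral_nodeQ; last 2 first.
- by move=> q; rewrite lee_fin.
- exact/measurable_EFinP.
(* In latent coordinates the integrand is a product of one-dimensional factors: one per coefficient
   and one per residual. *)
pose F s (t : p.-tuple R) (d : n.-tuple R) : R :=
  igpdf a b s * \1_D s *
  \prod_i (npdf 0 (s / lam 0 i) (tnth t i) * \1_(B i) ((w i)%:R * tnth t i)) *
  \prod_o (npdf ((X *m tcol t) o 0) s (tnth d o) *
           \1_(C o) (tnth d o - (X *m tcol t) o 0)).
have FE q : (\1_D q.1 * \prod_i \1_(B i) (tnth (mask_coef w q).2.1 i) *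
      \prod_o \1_(C o) (tnth q.2.2 o - (X1 *m tcol (mask w q.2.1)) o 0))
      * node_dens q = F q.1 q.2.1 q.2.2.
  have split_prod m (f g : 'I_m -> R) : \prod_i (f i * g i) = \prod_i f i * \prod_i g i.
    exact: big_split.
  rewrite /F /node_dens mask_tcol /prior_dens /lik_dens.
  rewrite (split_prod p (fun i => npdf 0 (q.1 / lam 0 i) (tnth q.2.1 i))).
  rewrite (split_prod n (fun o => npdf ((X *m tcol q.2.1) o 0) q.1 (tnth q.2.2 o))).
  under [X in _ * X * _ * _]eq_bigr do rewrite tnth_mktuple.
  ring.
transitivity (\int[base]_q (F q.1 q.2.1 q.2.2)%:E)%E.
  by apply: eq_integral => q _; exact: (congr1 EFin (FE q)).
rewrite (integral_base (f := fun s t d => (F s t d)%:E)); last 2 first.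
- move=> s t d; have /= <- := FE (s, (t, d)).
  by rewrite lee_fin mulr_ge0 ?node_dens_ge0//; exact: (g0 (mask_coef w (s, (t, d)))).
- apply/measurable_EFinP; under eq_fun do rewrite -FE.
  apply: measurable_funM; last exact: measurable_node_dens.
  exact: (measurableT_comp mg (measurable_mask_coef w)).
apply: eq_integral => s _; have [s0|s0] := ltP 0 s; last first.
  have ig0 : igpdf a b s = 0 by rewrite /igpdf ltNge s0.
  rewrite ig0 mul0r; apply: integral0_eq => t _.
  by apply: integral0_eq => d _; rewrite /F ig0 !mul0r.
pose K := igpdf a b s * \1_D s.
have K0 : 0 <= K by rewrite mulr_ge0// igpdf_ge0.
pose P1 (t : p.-tuple R) := \prod_i (npdf 0 (s / lam 0 i) (tnth t i) * \1_(B i) ((w i)%:R * tnth t i)).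
pose c := \prod_o fine (normal_law 0 s (C o)).
have c0 : 0 <= c by rewrite prodr_ge0// => o _; rewrite fine_ge0// normal_law_ge0.
have P10 t : 0 <= P1 t by rewrite prodr_ge0// => i _; rewrite mulr_ge0// npdf_ge0.
have mP1 : measurable_fun setT P1.
  apply: measurable_prod => i _; apply: measurable_funM.
    exact: (measurableT_comp (measurable_npdf1 _ _) (measurable_tnth i)).
  apply: measurable_indic_comp => //; apply: measurable_funM => //.
  exact: measurable_tnth.
have mnB m v (E : set R) : measurable E -> measurable_fun setT (fun y => npdf m v y * \1_E (y - m)).
  move=> mE; apply: measurable_funM; first exact: measurable_npdf1.
  by apply: measurable_indic_comp => //; exact: measurable_funB.
(* The data are integrated first; by translation invariance the noise factor [c] does not depend on
   [t]. *)
transitivity (\int[lebn p]_t (K * c * P1 t)%:E)%E.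
  apply: eq_integral => t _.
  under eq_integral do rewrite /F EFinM.
  rewrite ge0_integralZl//; last 3 first.
  - apply/measurable_EFinP; apply: measurable_prod => o _.
    exact: (measurableT_comp (mnB _ _ _ (mC o)) (measurable_tnth o)).
  - by move=> d _; rewrite lee_fin prodr_ge0// => o _; rewrite mulr_ge0// npdf_ge0.
  - by rewrite lee_fin; exact: (mulr_ge0 K0 (P10 t)).
  rewrite (integral_lebn_prod (f := fun o y => npdf ((X *m tcol t) o 0) s y *
     \1_(C o) (y - (X *m tcol t) o 0))); last 3 first.
  - by move=> o y; rewrite mulr_ge0// npdf_ge0.
  - by move=> o; exact: mnB.
  - move=> o; rewrite integral_npdf_shift// -ge0_fin_numE ?normal_law_ge0//.
    exact: normal_law_fin.
  rewrite -EFinM -/K -/(P1 t); congr EFin.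
  rewrite (eq_bigr (fun o => fine (normal_law 0 s (C o)))).
    by rewrite -/c; ring.
  by move=> o _; rewrite integral_npdf_shift.
under eq_integral do rewrite EFinM.
rewrite ge0_integralZl//; last 3 first.
- exact/measurable_EFinP.
- by move=> t _; rewrite lee_fin.
- by rewrite lee_fin mulr_ge0.
have v0 i : 0 < s / lam 0 i by rewrite divr_gt0.
rewrite (integral_lebn_prod (f := fun i y => npdf 0 (s / lam 0 i) y * \1_(B i) ((w i)%:R * y))); last 3 first.
- by move=> i y; rewrite mulr_ge0// npdf_ge0.
- move=> i; apply: measurable_funM; first exact: measurable_npdf1.
  by apply: measurable_indic_comp => //; exact: measurable_funM.
- move=> i; rewrite integral_npdf_mask// -ge0_fin_numE ?normal_law_ge0//.
  exact: normal_law_fin.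
rewrite -EFinM; congr EFin.
rewrite (eq_bigr (fun i => fine (normal_law 0 ((w i)%:R * (s / lam 0 i)) (B i)))).
  by rewrite /K /c; ring.
by move=> i _; rewrite integral_npdf_mask.
Qed.

End state.
End node_law.

(** * The bifurcating tree *)

Section tree_order.
Implicit Types (J : nat) (v u : node).

Lemma parent_tree J v : v \in tree J -> (0 < v.1)%N -> parent v \in tree J.
Proof.
case: v => -[|j] k//; rewrite !mem_tree /= => /andP[jJ k2] _.
by rewrite (leq_trans (leqnSn j))//= ltn_half_double -mul2n -expnS.
Qed.

Lemma treeE J : tree J = rootn :: [seq (j, k) | j <- iota 1 J, k <- iota 0 (2 ^ j)].
Proof. by []. Qed.

Lemma root_tree J : rootn \in tree J.
Proof. by rewrite mem_tree. Qed.

Lemma tree_level0 J v : v \in tree J -> v.1 = 0%N -> v = rootn.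
Proof.
by case: v => j k; rewrite mem_tree/= => /andP[_ +] j0; rewrite j0 expn0 ltnS leqn0 => /eqP ->.
Qed.

Lemma tree_uniq J : uniq (tree J).
Proof.
apply: allpairs_uniq_dep; [exact: iota_uniq|by move=> *; exact: iota_uniq|].
by move=> [j k] [j' k'] _ _ /= [-> ->].
Qed.

Lemma tree_sorted J : pairwise (fun u v => u.1 <= v.1)%N (tree J).
Proof.
suff {J} lvl n m : pairwise (fun u v : node => u.1 <= v.1)%N
    [seq (j, k) | j <- iota m n, k <- iota 0 (2 ^ j)] by exact: lvl.
elim: n m => [|n IH] m //=.
rewrite pairwise_cat IH andbT; apply/andP; split.
  apply/allrelP => u v /mapP[k _ ->] /allpairsPdep[j [k' [+ _ ->]]] /=.
  by rewrite mem_iota => /andP[/ltnW].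
rewrite pairwise_map; elim: (iota _ _) => //= k s ->; rewrite andbT.
by apply/allP => ? _ /=.
Qed.

(** A consequence of listing nodes by increasing level without repetition. It is what allows the
    last node of an initial segment to be summed out. *)
Lemma tree_split J s1 v s2 : tree J = s1 ++ v :: s2 ->
  [/\ v \notin s1, {in s1, forall u, (0 < u.1)%N -> parent u != v} &
    (0 < v.1)%N -> parent v \in s1].
Proof.
move=> e; have := tree_uniq J; have := tree_sorted J.
rewrite e pairwise_cat cat_uniq /= negb_or => /and3P[/allrelP h1 _ /andP[/allP h2 _]].
move=> /and3P[_ /andP[vs1 _] _]; split => //.
- move=> u us1 u0; apply/eqP => pu.
  have := h1 u v us1 (mem_head _ _); rewrite -pu /= => h.
  by move: u0 h; case: (u.1) => // k _ /=; rewrite ltnn.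
- move=> v0; have : parent v \in tree J.
    by apply: parent_tree => //; rewrite e mem_cat mem_head orbT.
  rewrite e mem_cat inE => /or3P[//|/eqP/(congr1 fst)/= h|/h2 /= h].
    by move: v0; rewrite -h; case: (v.1) h => // k /= /n_Sn.
  by move: v0 h; case: (v.1) => // k _; rewrite ltnn.
Qed.

Lemma big_tree (R : comNzRingType) J (F : node -> R) (Q : pred node) :
  \prod_(v <- tree J | Q v) F v =
  \prod_(0 <= j < J.+1) \prod_(0 <= k < 2 ^ j | Q (j, k)) F (j, k).
Proof.
rewrite big_mkcond /tree big_allpairs_dep/= /index_iota subn0.
by apply: eq_bigr => j _; rewrite -big_mkcond/= subn0.
Qed.

Lemma big_root (R : comNzRingType) J (F : node -> R) :
  \prod_(v <- tree J) F v = F rootn * \prod_(v <- tree J | (0 < v.1)%N) F v.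
Proof.
rewrite treeE !big_cons/=; congr (_ * _).
rewrite [LHS]big_seq [RHS]big_seq_cond; apply: eq_bigl => v.
apply/idP/andP => [vt|[]//]; split => //.
case/allpairsPdep: vt => j [k [+ _ ->]]; rewrite mem_iota => /andP[+ _].
by case: j.
Qed.

(** Level j + 1 lists the children of level j in consecutive pairs, so non-root nodes can be
    regrouped by parent. *)
Lemma big_children (R : comNzRingType) J (F : node -> R) :
  \prod_(v <- tree J | (0 < v.1)%N) F v =
  \prod_(v <- tree J | (v.1 < J)%N) (F (lchild v) * F (rchild v)).
Proof.
rewrite !big_tree big_nat_recl// [in RHS]big_nat_recr//=.
rewrite [X in X * _ = _]big_pred0// [X in _ = _ * X]big_pred0; last first.
  by move=> k; rewrite ltnn.
rewrite mul1r mulr1; apply: eq_big_nat => j /= jJ.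
under [RHS]eq_bigl do rewrite jJ; rewrite expnS mul2n.
elim: (2 ^ j)%N => [|n IH]; first by rewrite !big_geq.
by rewrite doubleS !big_nat_recr//= IH mulrA.
Qed.

End tree_order.

(** * Sums over configurations and prefixes of Markov trees *)

Section configurations.
Variable E : finType.
Implicit Types (x : node -> E) (s : seq node).

Definition updn x v b : node -> E := fun u => if u == v then b else x u.

(** Configurations are functions on all nodes, hence no finite type. Only the values on [s] are
    summed over, and [x] supplies the others. *)
Fixpoint csum (V : nmodType) s (F : (node -> E) -> V) x : V :=
  if s is v :: s' then \sum_(b : E) csum s' F (updn x v b) else F x.

Lemma csum_rcons (V : nmodType) s v (F : (node -> E) -> V) x :
  csum (rcons s v) F x = csum s (fun y => \sum_(b : E) F (updn y v b)) x.
Proof. by elim: s x => //= u s IH x; apply: eq_bigr => b _; rewrite IH. Qed.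

Lemma eq_csum (V : nmodType) s (F1 F2 : (node -> E) -> V) x :
  F1 =1 F2 -> csum s F1 x = csum s F2 x.
Proof. by move=> F12; elim: s x => //= v s IH x; apply: eq_bigr => b _. Qed.

Lemma csumZ (R : pzRingType) s (F : (node -> E) -> R) c x :
  csum s (fun y => c * F y) x = c * csum s F x.
Proof.
by elim: s x => //= v s IH x; rewrite mulr_sumr; apply: eq_bigr => b _.
Qed.

Section markov.
Variables (R : realType) (q0 : E -> R) (q : node -> E -> E -> R).

Definition MT_factor x v : R :=
  if (0 < v.1)%N then q v (x (parent v)) (x v) else q0 (x v).

(** On an initial segment of [tree J] with stochastic transitions, this is the marginal of the
    Markov tree. *)
Definition MT_prefix s x : R := \prod_(v <- s) MT_factor x v.

Lemma MT_probE J x : MT_prob J q0 q x = MT_prefix (tree J) x.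
Proof.
rewrite /MT_prob /MT_prefix big_root; congr (_ * _).
by apply: eq_bigr => v v0; rewrite /MT_factor v0.
Qed.

Hypothesis q0_prob : prob_vec q0.

Lemma parent_neq v : (0 < v.1)%N -> parent v != v.
Proof.
by case: v => -[|j] k// _; rewrite /parent/= xpair_eqE/= ltn_eqF.
Qed.

(** No earlier node is [v] or a child of [v], so the earlier factors do not see the new value. *)
Lemma MT_prefix_rcons J s1 v s2 x b : tree J = s1 ++ v :: s2 ->
  MT_prefix (rcons s1 v) (updn x v b) =
  MT_prefix s1 x * (if (0 < v.1)%N then q v (x (parent v)) b else q0 b).
Proof.
move=> /tree_split[vs1 ps1 _]; rewrite /MT_prefix -cats1 big_cat big_seq1.
congr (_ * _).
  rewrite big_seq [RHS]big_seq; apply: eq_bigr => u us1.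
  rewrite /MT_factor /updn (_ : (u == v) = false); last first.
    by apply/negbTE; apply: contra vs1 => /eqP <-.
  by case: ifP => // u0; rewrite (negbTE (ps1 _ us1 u0)).
rewrite /MT_factor /updn eqxx; case: ifP => // v0.
by rewrite (negbTE (parent_neq v0)).
Qed.

Lemma MT_prefix_sum J s1 v s2 x : tree J = s1 ++ v :: s2 ->
  ((0 < v.1)%N -> forall a, prob_vec (q v a)) ->
  \sum_b MT_prefix (rcons s1 v) (updn x v b) = MT_prefix s1 x.
Proof.
move=> e qv; under eq_bigr do rewrite (MT_prefix_rcons _ _ e).
rewrite -mulr_sumr; case: (boolP (0 < v.1)%N) => v0.
  by rewrite (proj2 (qv v0 _)) mulr1.
by rewrite (proj2 q0_prob) mulr1.
Qed.

Lemma csum_MT_prefix J x :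
  (forall v, v \in tree J -> (0 < v.1)%N -> forall a, prob_vec (q v a)) ->
  forall s1 s2, tree J = s1 ++ s2 -> csum s1 (MT_prefix s1) x = 1.
Proof.
move=> qJ; elim/last_ind => [|s v IH] s2; first by rewrite /= /MT_prefix big_nil.
rewrite cat_rcons => e; rewrite csum_rcons -(IH _ e).
apply: eq_csum => y; apply: (MT_prefix_sum _ e) => v0; apply: qJ => //.
by rewrite e mem_cat mem_head orbT.
Qed.

Lemma csum_MT J x :
  (forall v, v \in tree J -> (0 < v.1)%N -> forall a, prob_vec (q v a)) ->
  csum (tree J) (MT_prob J q0 q) x = 1.
Proof.
move=> qJ; rewrite (eq_csum _ _ (MT_probE J)).
by apply: (csum_MT_prefix _ qJ (s2 := [::])); rewrite cats0.
Qed.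

End markov.
End configurations.

(** * The recursion for phi and xi *)

Section posterior_tree.
Context {R : realType} {L : nat}.
Variables (J : nat) (G : 'I_L -> nat) (ng : combo G -> nat) (h : hyper R L).
Hypothesis h_valid : valid_hyper J h.
Hypothesis marg_gt0 : forall j (dv : 'cV[R]_(nobs ng)) (x : state L),
  0 < marg_lik h j dv x.
Implicit Types (D : node -> 'cV[R]_(nobs ng)) (x y : state L).

Lemma sum_state (f : bool -> R) (g : 'I_L -> bool -> R) :
  \sum_(y : state L) f y.1 * \prod_(l < L) g l (y.2 l) =
  (\sum_b f b) * \prod_(l < L) \sum_b g l b.
Proof.
rewrite bigA_distr_bigA mulr_suml/=.
rewrite -(pair_bigA _ (fun b (r : {ffun 'I_L -> bool}) => f b * \prod_(l < L) g l (r l)))/=.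
by apply: eq_bigr => b _; rewrite mulr_sumr.
Qed.

Lemma prior_init_prob : prob_vec (prior_init h).
Proof.
have [r0 r1] := rho0_prob h_valid; have [k0 k1] := kappa0_prob h_valid.
split; first by move=> y; rewrite mulr_ge0// prodr_ge0.
by rewrite (sum_state (rho0 h) (fun _ => kappa0 h)) r1 mul1r big1.
Qed.

Lemma prior_trans_prob v x : v \in tree J -> (0 < v.1)%N ->
  prob_vec (prior_trans h v x).
Proof.
move=> vJ v0; have [r0 r1] := rho_stoch h_valid vJ v0 x.1.
have kp := kappa_stoch h_valid vJ v0.
split; first by move=> y; rewrite mulr_ge0// prodr_ge0// => l _; exact: (proj1 (kp _)).
rewrite (sum_state (rho h v x.1) (fun l => kappa h v (x.2 l))) r1 mul1r.
by rewrite big1// => l _; exact: (proj2 (kp _)).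
Qed.

Lemma prob_vec_avg_gt0 (E : finType) (q f : E -> R) : prob_vec q ->
  (forall a, 0 < f a) -> 0 < \sum_a q a * f a.
Proof.
move=> [q0 q1] f0; have [x qx] : exists a, 0 < q a.
  apply/existsP; apply: contraPT q1; rewrite negb_exists => /forallP h0.
  rewrite big1 => [/eqP|x _]; first by rewrite eq_sym oner_eq0.
  by apply/eqP; rewrite eq_le q0 andbT leNgt h0.
rewrite (bigD1 x)//= ltr_pwDl ?mulr_gt0//.
by rewrite sumr_ge0// => y _; rewrite mulr_ge0// ltW.
Qed.

Lemma child_tree v : v \in tree J -> (v.1 < J)%N ->
  (lchild v \in tree J) * (rchild v \in tree J).
Proof.
rewrite !mem_tree /= => /andP[_ v2] vJ; rewrite vJ expnS mul2n ltn_double v2.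
by rewrite -doubleS leq_double.
Qed.

Lemma phi_gt0 D v x : v \in tree J -> 0 < phi J h D v x.
Proof.
(* Strong induction on the height of the node, since phi is computed from the children. *)
have [k] := ubnP (J - v.1); elim: k v x => // k IH v x kv vJ.
have [lt_vJ|] := ltnP v.1 J; last first.
  move=> Jv; rewrite phi_leaf//; apply/eqP; rewrite eqn_leq Jv andbT.
  by move: vJ; rewrite mem_tree => /andP[].
rewrite phi_inner//; have [lJ rJ] := child_tree vJ lt_vJ.
have kc : (J - v.1.+1 < k)%N by rewrite -ltnS (leq_trans _ kv)// ltnS ltn_sub2l.
rewrite /xi/=; apply: mulr_gt0; first apply: mulr_gt0; rewrite ?marg_gt0//.
  apply: prob_vec_avg_gt0; first exact: prior_trans_prob.
  by move=> y; apply: IH.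
apply: prob_vec_avg_gt0; first exact: prior_trans_prob.
by move=> y; apply: IH.
Qed.

Lemma xi_gt0 D v x : v \in tree J -> 0 < xi J h D v x.
Proof.
move=> vJ; rewrite /xi; case: ifPn => v0; apply: prob_vec_avg_gt0.
- exact: prior_trans_prob.
- by move=> y; exact: phi_gt0.
- exact: prior_init_prob.
- by move=> y; exact: phi_gt0.
Qed.

Lemma post_init_prob D : prob_vec (post_init J h D).
Proof.
have x0 := xi_gt0 D (false, [ffun=> false]) (root_tree J).
have [p0 p1] := prior_init_prob.
split => [y|].
  by rewrite mulr_ge0// divr_ge0// ltW// phi_gt0// root_tree.
under eq_bigr do rewrite /post_init mulrA.
by rewrite -mulr_suml divff// gt_eqF.
Qed.

Lemma post_trans_prob D v x : v \in tree J -> (0 < v.1)%N ->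
  prob_vec (post_trans J h D v x).
Proof.
move=> vJ v0; have x0 := xi_gt0 D x vJ; have [p0 p1] := prior_trans_prob x vJ v0.
split => [y|].
  by rewrite mulr_ge0// divr_ge0// ltW// phi_gt0.
under eq_bigr do rewrite /post_trans mulrA.
rewrite -mulr_suml; move: x0; rewrite /xi v0 => x0.
by rewrite divff// gt_eqF.
Qed.

(* The factors xi of the posterior transitions telescope along the tree. *)
Lemma post_MT_prob D (x : node -> state L) :
  MT_prob J (post_init J h D) (post_trans J h D) x *
    xi J h D rootn (false, [ffun=> false]) =
  MT_prob J (prior_init h) (prior_trans h) x *
    \prod_(v <- tree J) marg_lik h v.1 (D v) (x v).
Proof.
set Z := xi _ _ _ _ _; have Z0 : Z != 0 by rewrite gt_eqF// xi_gt0 ?root_tree.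
(* The product of the denominators of all posterior transitions. *)
pose X := \prod_(v <- tree J | (0 < v.1)%N) xi J h D v (x (parent v)).
have X0 : X != 0.
  rewrite /X prodf_seq_neq0; apply/allP => v vJ; apply/implyP => _.
  by rewrite gt_eqF// xi_gt0.
(* Regrouped by parent, the denominators are the pairs of xi that occur in the recursion for phi at
   inner nodes. *)
have phiE : \prod_(v <- tree J) phi J h D v (x v) =
    \prod_(v <- tree J) marg_lik h v.1 (D v) (x v) * X.
  rewrite /X big_children [X in _ = _ * X]big_mkcond/= -big_split/=.
  rewrite big_seq [RHS]big_seq; apply: eq_bigr => v vJ; case: ifPn => lt_vJ.
    rewrite phi_inner// mulrA /parent /=.
    by rewrite doubleK uphalf_double; case: (v).
  rewrite mulr1 phi_leaf//; apply/eqP; rewrite eqn_leq andbC leqNgt lt_vJ/=.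
  by move: vJ; rewrite mem_tree => /andP[].
rewrite /MT_prob.
have -> : \prod_(v <- tree J | (0 < v.1)%N) post_trans J h D v (x (parent v)) (x v) =
    \prod_(v <- tree J | (0 < v.1)%N) prior_trans h v (x (parent v)) (x v) *
    (\prod_(v <- tree J | (0 < v.1)%N) phi J h D v (x v) / X).
  by rewrite /X -prodfV -!big_split.
have phi_split : \prod_(v <- tree J) phi J h D v (x v) =
    phi J h D rootn (x rootn) * \prod_(v <- tree J | (0 < v.1)%N) phi J h D v (x v).
  exact: (big_root _ (fun v => phi J h D v (x v))).
move: phiE; rewrite phi_split => phiE.
rewrite /post_init -/Z.
rewrite (_ : \prod_(v <- tree J) marg_lik h v.1 (D v) (x v) =
  phi J h D rootn (x rootn) * \prod_(v <- tree J | (0 < v.1)%N) phi J h D v (x v) / X).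
  by field; rewrite X0 Z0.
by rewrite phiE mulfK.
Qed.

End posterior_tree.

(** * Conditioning on sub-sigma-algebras *)

Section sub_sigma_algebras.
Context d (Omega : measurableType d).
Implicit Types G : set (set Omega).

Lemma sigma_sub_measurable G : G `<=` measurable -> <<s G >> `<=` measurable.
Proof. by apply: smallest_sub; exact: sigma_algebra_measurable. Qed.

Lemma measurable_fun_gsigma d' (T : measurableType d') G (f : Omega -> T) :
  G `<=` measurable ->
  measurable_fun setT (f : g_sigma_algebraType G -> T) -> measurable_fun setT f.
Proof. by move=> Gm mf _ B mB; apply: (sigma_sub_measurable Gm); exact: mf. Qed.

Lemma measurable_fun_gsigmaS d' (T : measurableType d') G G' (f : Omega -> T) :
  G `<=` <<s G' >> ->
  measurable_fun setT (f : g_sigma_algebraType G -> T) ->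
  measurable_fun setT (f : g_sigma_algebraType G' -> T).
Proof.
move=> GG' mf _ B mB; rewrite setTI /measurable/=.
have sGG' : <<s G >> `<=` <<s G' >>.
  by apply: smallest_sub => //; exact: smallest_sigma_algebra.
by apply: sGG'; rewrite -[X in <<s _ >> X]setTI; exact: mf.
Qed.

Lemma measurable_fun_gen d' (T : measurableType d') G (f : Omega -> T) :
  gen f `<=` <<s G >> -> measurable_fun setT (f : g_sigma_algebraType G -> T).
Proof. by move=> fG _ B mB; apply: fG; exists B. Qed.

(** Both measures are pushed along the identity to the space with the smaller sigma-algebra, where
    they coincide. *)
Lemma integral_gsigma (R : realType) (m1 m2 : {measure set Omega -> \bar R}) G
    (h : Omega -> \bar R) : G `<=` measurable ->
  (forall A, <<s G >> A -> m1 A = m2 A) -> (forall w, 0 <= h w)%E ->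
  measurable_fun setT (h : g_sigma_algebraType G -> \bar R) ->
  (\int[m1]_w h w = \int[m2]_w h w)%E.
Proof.
move=> Gm m12 h0 mh.
have mid : measurable_fun setT (id : Omega -> g_sigma_algebraType G).
  by move=> _ B mB; rewrite setTI; exact: (sigma_sub_measurable Gm).
rewrite -(integral_image_measure m1 mid h0 mh).
rewrite -(integral_image_measure m2 mid h0 mh).
by apply: eq_measure_integral => A mA _; exact: m12.
Qed.

Lemma measurable_bigcap_seq (I : eqType) (s : seq I) (E : I -> set Omega) :
  (forall i, i \in s -> measurable (E i)) ->
  measurable [set w | forall i, i \in s -> E i w].
Proof. by move=> mE; apply: (@fin_bigcap_measurable _ _ _ [set` s]). Qed.

Lemma indic_bigcap_seq (R : realType) (I : eqType) (s : seq I) (E : I -> set Omega) w :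
  \1_[set w | forall i, i \in s -> E i w] w = \prod_(i <- s) \1_(E i) w :> R.
Proof.
elim: s => [|i s IH]; first by rewrite big_nil indicE mem_set.
rewrite big_cons -IH !indicE -natrM mulnb; congr (nat_of_bool _)%:R.
apply/idP/andP => [/set_mem h|[/set_mem h1 /set_mem h2]].
  by split; apply/mem_set; [|move=> j js]; apply: h; rewrite inE ?eqxx// js orbT.
by apply/mem_set => j; rewrite inE => /predU1P[->//|/h2].
Qed.

Variables (R : realType) (P : probability Omega R).

Lemma integral_indicM (f : Omega -> R) (F : set Omega) : measurable F ->
  (\int[P]_(w in F) (f w)%:E = \int[P]_w (\1_F w * f w)%:E)%E.
Proof.
move=> mF; rewrite integral_mkcond; apply: eq_integral => w _.
by rewrite patchE indicE; case: ifPn => _; rewrite ?mul1r ?mul0r.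
Qed.

Lemma probI_integral (E F : set Omega) : measurable E -> measurable F ->
  (P (F `&` E) = \int[P]_w (\1_F w * \1_E w)%:E)%E.
Proof. by move=> mE mF; rewrite -integral_indicM// integral_indic// setIC. Qed.

(* Both sides of the defining identity are finite measures in the conditioning
   event, so it suffices to check it on a pi-system. *)
Lemma cond_prob_pi (G PS : set (set Omega)) (E : set Omega) (f : Omega -> R) :
  G `<=` measurable -> measurable E -> (forall w, 0 <= f w) ->
  measurable_fun setT (f : g_sigma_algebraType G -> R) ->
  PS `<=` measurable -> setI_closed PS -> PS setT -> G `<=` <<s PS >> ->
  (forall F, PS F ->
    \int[P]_w (\1_F w * \1_E w)%:E = \int[P]_w (\1_F w * f w)%:E)%E ->
  cond_prob P G E f.
Proof.
move=> Gm mE f0 mf Pm PI PT GP eqP; split=> [B mB|F GF].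
  by rewrite -[X in <<s _ >> X]setTI; exact: mf.
have mf' := measurable_fun_gsigma Gm mf.
have mF := sigma_sub_measurable Gm GF.
have m1E : measurable_fun setT (\1_E : Omega -> R) by exact: measurable_indic.
have E0 w : 0 <= \1_E w :> R by rewrite indicE.
rewrite probI_integral// -integral_indicM//.
apply: (@finite_measure_unique _ _ _ (weighted P E0 m1E) (weighted P f0 mf') PS) => //.
- rewrite /= /weighted integral_indic// setIT.
  by rewrite (le_lt_trans (probability_le1 _ _))// ltry.
- move=> A PA; have mA := Pm _ PA; rewrite /= /weighted.
  by rewrite (integral_indicM _ mA) (integral_indicM f mA); exact: eqP.
- by move: F GF {mF}; apply: smallest_sub => //; exact: smallest_sigma_algebra.
Qed.

End sub_sigma_algebras.

(** * From product formulas on sets to product formulas on functions *)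

Section product_laws.
Context d d' (Omega : measurableType d) (T : measurableType d') (R : realType).
Variables (I : eqType) (C : set (set T)) (Y : I -> Omega -> T).
Variable Q : I -> {measure set T -> \bar R}.
Hypotheses (Cm : C `<=` measurable) (CI : setI_closed C) (CT : C setT).
Hypotheses (CG : measurable `<=` <<s C >>) (mY : forall i, measurable_fun setT (Y i)).
Hypothesis Q_lty : forall i, (Q i setT < +oo)%E.

(** The induction absorbs the factor at the head of [s] into the measure as a density, and its
    integral into the constant; this is why [mu] and [c] are arbitrary. *)
Lemma integral_prod_indep (s : seq I) (mu : {measure set Omega -> \bar R}) (c : R)
    (g : I -> T -> R) : uniq s -> 0 <= c ->
  (forall i x, 0 <= g i x) -> (forall i, measurable_fun setT (g i)) ->
  (forall i, \int[Q i]_x (g i x)%:E < +oo)%E ->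
  (forall A, (forall i, C (A i)) -> mu [set w | forall i, i \in s -> A i (Y i w)] =
    (c * \prod_(i <- s) fine (Q i (A i)))%:E) ->
  (\int[mu]_w (\prod_(i <- s) g i (Y i w))%:E =
    (c * \prod_(i <- s) fine (\int[Q i]_x (g i x)%:E))%:E)%E.
Proof.
move=> + + g0 mg gfin; elim: s mu c => [|i s IH] mu c us c0 muE.
  under eq_integral do rewrite big_nil.
  rewrite integral_cst// mul1e big_nil mulr1.
  have := muE (fun=> setT) (fun=> CT); rewrite big_nil mulr1 => <-.
  by congr (mu _); rewrite predeqE.
have /andP[is_ us'] := us.
have mgY j : measurable_fun setT (g j \o Y j) by exact: measurableT_comp.
have Qf j A : measurable A -> fine (Q j A) >= 0 by rewrite fine_ge0.
have mYA (A : I -> set T) j : measurable (A j) -> measurable (Y j @^-1` A j).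
  by move=> mA; rewrite -[X in measurable X]setTI; exact: mY.
have int_ge0 : (0 <= \int[Q i]_x (g i x)%:E)%E.
  by apply: integral_ge0 => x _; rewrite lee_fin.
transitivity (\int[weighted mu (fun w => g0 i (Y i w)) (mgY i)]_w
    (\prod_(j <- s) g j (Y j w))%:E)%E.
  rewrite integral_weighted//; last 2 first.
  - by move=> w; rewrite lee_fin prodr_ge0.
  - by apply/measurable_EFinP/measurable_prod => j _; exact: mgY.
  by apply: eq_integral => w _; rewrite big_cons mulrC EFinM.
rewrite (IH _ (c * fine (\int[Q i]_x (g i x)%:E))%R)//.
- by rewrite big_cons mulrA.
- by rewrite mulr_ge0// fine_ge0.
move=> A CA; set K := [set w | _].
have mK : measurable K.
  by apply: measurable_bigcap_seq => j _; apply: mYA; exact/Cm/CA.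
have K0 w : 0 <= \1_K w :> R by rewrite indicE.
have m1K : measurable_fun setT (\1_K : Omega -> R) by exact: measurable_indic.
have c'0 : 0 <= c * \prod_(j <- s) fine (Q j (A j)).
  by rewrite mulr_ge0// prodr_ge0// => j _; exact/Qf/Cm/CA.
(* The law of [Y i] under [mu] restricted to the remaining events [K] should be a multiple of [Q i];
   for finite measures this is checked on [C]. *)
pose nu1 : {measure set T -> \bar R} := image_measure (weighted mu K0 m1K) (mY i).
pose nu2 : {measure set T -> \bar R} := mscale (NngNum c'0) (Q i).
have nu1E B : measurable B -> nu1 B = mu (K `&` Y i @^-1` B).
  move=> mB; rewrite /nu1 /= /image_measure /pushforward /weighted.
  by rewrite integral_indic// -[X in measurable X]setTI; exact: mY.
have nu12 B : measurable B -> nu1 B = nu2 B.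
  move=> mB; apply: (@finite_measure_unique _ _ _ nu1 nu2 C) => //; last exact: CG.
    rewrite nu1E// preimage_setT setIT (@le_lt_trans _ _ (mu setT))//.
      by apply: le_measure; rewrite ?inE.
    have := muE (fun=> setT) (fun=> CT).
    rewrite (_ : [set w | _] = setT); last by rewrite predeqE.
    by move=> ->; rewrite ltry.
  move=> {mB}B CB; have mB := Cm CB; rewrite nu1E// /nu2 /= /mscale /=.
  (* Putting [B] in the slot of [i] makes the restricted event an instance of the product
     hypothesis. *)
  pose A' j := if j == i then B else A j.
  have CA' j : C (A' j) by rewrite /A'; case: ifP.
  have A's : {in s, A' =1 A}.
    by move=> j js; rewrite /A'; case: eqP js is_ => // -> ->.
  transitivity (mu [set w | forall j, j \in i :: s -> A' j (Y j w)]).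
    congr (mu _); rewrite predeqE => w; split => [[Kw Bw] j|h].
      by rewrite inE => /predU1P[->|js]; [rewrite /A' eqxx|rewrite A's//; exact: Kw].
    split; last by have := h i (mem_head _ _); rewrite /A' eqxx.
    by move=> j js; rewrite -(A's j js); apply: h; rewrite inE js orbT.
  rewrite muE// big_cons {1}/A' eqxx.
  rewrite (eq_big_seq (fun j => fine (Q j (A j)))); last first.
    by move=> j js; rewrite A's.
  rewrite mulrCA mulrC EFinM fineK// ge0_fin_numE//.
  by rewrite (le_lt_trans _ (Q_lty i))// le_measure ?inE.
rewrite /= /weighted.
transitivity (\int[nu1]_x (g i x)%:E)%E.
  rewrite integral_image_measure//; last 2 first.
  - by move=> x; rewrite lee_fin.
  - exact/measurable_EFinP.
  rewrite integral_weighted//; last 2 first.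
  - by move=> x; rewrite lee_fin.
  - by apply/measurable_EFinP; exact: mgY.
  rewrite integral_mkcond; apply: eq_integral => w _.
  by rewrite patchE indicE; case: ifPn => _; rewrite ?mule1 ?mule0.
rewrite (@eq_measure_integral _ _ _ _ nu2); last by move=> B mB _; exact: nu12.
rewrite ge0_integral_mscale//=; last 2 first.
- exact/measurable_EFinP.
- by move=> x _; rewrite lee_fin.
by rewrite [X in _ = X%:E]mulrAC [RHS]EFinM fineK// ge0_fin_numE.
Qed.

End product_laws.

(** * Laws of hidden Markov trees *)

Section grove.
Context d d' (Omega : measurableType d) (T : measurableType d') (R : realType).
Variables (P : probability Omega R) (E : finType) (J : nat).
Variables (H : node -> Omega -> E) (W : node -> Omega -> T) (x0 : node -> E).
Hypothesis mH : forall v e, measurable [set w | H v w = e].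
Hypothesis mW : forall v, measurable_fun setT (W v).

Local Notation Hev s x := [set w | forall v, v \in s -> H v w = x v].

Lemma measurable_Hev (s : seq node) (x : node -> E) : measurable (Hev s x).
Proof. by apply: measurable_bigcap_seq => v _; exact: mH. Qed.

Lemma indic_Hev (s : seq node) (x : node -> E) w :
  \1_(Hev s x) w = \prod_(v <- s) (x v == H v w)%:R :> R.
Proof.
rewrite (indic_bigcap_seq R s (fun v => [set w | H v w = x v])).
apply: eq_bigr => v _; rewrite indicE eq_sym; congr (nat_of_bool _)%:R.
by apply/idP/eqP => [/set_mem|h] //; exact/mem_set.
Qed.

(** The indicator is the prefix probability of a deterministic tree that moves to the states
    observed at [w], so indicators sum out by the same lemma as probabilities. *)
Lemma indic_MT s1 s2 (x : node -> E) w : tree J = s1 ++ s2 ->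
  \1_(Hev s1 x) w = MT_prefix (fun b => (b == H rootn w)%:R)
    (fun v _ b => (b == H v w)%:R) s1 x :> R.
Proof.
move=> e; rewrite indic_Hev /MT_prefix; apply: eq_big_seq => v vs.
rewrite /MT_factor; case: ifPn => // v0.
by rewrite (_ : v = rootn)//; apply: (@tree_level0 J); [rewrite e mem_cat vs|case: (v.1) v0].
Qed.

Let indicator_prob (a : E) : prob_vec (fun b => (b == a)%:R : R).
Proof.
split=> [b|]; first by [].
by rewrite (bigD1 a)//= eqxx big1 ?addr0// => b /negbTE ->.
Qed.

Lemma csum_indic s1 s2 w : tree J = s1 ++ s2 ->
  csum s1 (fun x => \1_(Hev s1 x) w) x0 = 1 :> R.
Proof.
move=> e; rewrite (eq_csum _ _ (fun x => indic_MT x w e)).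
by apply: (csum_MT_prefix (indicator_prob _) _ _ e) => v _ _ _; exact: indicator_prob.
Qed.

Lemma csum_ge0 (s : seq node) (f : (node -> E) -> R) x :
  (forall y, 0 <= f y) -> 0 <= csum s f x.
Proof. by move=> f0; elim: s x => //= v s IH x; exact: sumr_ge0. Qed.

Lemma measurable_csum (s : seq node) (f : (node -> E) -> Omega -> R) x :
  (forall y, measurable_fun setT (f y)) ->
  measurable_fun setT (fun w => csum s (f^~ w) x).
Proof. by move=> mf; elim: s x => //= v s IH x; exact: measurable_sum. Qed.

Lemma integral_csum (s : seq node) (f : (node -> E) -> Omega -> R) x :
  (forall y w, 0 <= f y w) -> (forall y, measurable_fun setT (f y)) ->
  (\int[P]_w (csum s (f^~ w) x)%:E = csum s (fun y => \int[P]_w (f y w)%:E) x)%E.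
Proof.
move=> f0 mf; elim: s x => //= v s IH x.
under eq_integral do rewrite -sumEFin.
rewrite ge0_integral_sum//; first by apply: eq_bigr => b _; exact: IH.
- by move=> b; apply/measurable_EFinP; exact: measurable_csum.
- by move=> b w _; rewrite lee_fin csum_ge0.
Qed.

(** The configurations on [s1] partition the sample space, so their indicators sum to 1. *)
Lemma integral_partition s1 s2 (f : Omega -> R) : tree J = s1 ++ s2 ->
  (forall w, 0 <= f w) -> measurable_fun setT f ->
  (\int[P]_w (f w)%:E = csum s1 (fun x => \int[P]_w (\1_(Hev s1 x) w * f w)%:E) x0)%E.
Proof.
move=> e f0 mf; rewrite -(integral_csum s1 (f := fun x w => \1_(Hev s1 x) w * f w)).
- apply: eq_integral => w _; congr (_%:E).
  rewrite (eq_csum _ _ (fun x => mulrC _ _)) csumZ.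
  by rewrite (csum_indic w e) mulr1.
- by move=> y w; rewrite indicE mulr_ge0.
- move=> y; apply: measurable_funM => //; apply: measurable_indic.
  exact: measurable_Hev.
Qed.

Lemma measurable_fun_state d2 (O : measurableType d2) (h : O -> E) (f : E -> O -> R) :
  (forall e, measurable [set w | h w = e]) -> (forall e, measurable_fun setT (f e)) ->
  measurable_fun setT (fun w => f (h w) w).
Proof.
move=> mh mf; rewrite (_ : (fun w => _) = fun w => \sum_e \1_[set w | h w = e] w * f e w).
  by apply: measurable_sum => e; apply: measurable_funM => //; exact: measurable_indic.
apply/funext => w; rewrite (bigD1 (h w))//= indicE mem_set// mul1r big1 ?addr0// => e he.
rewrite indicE memNset ?mul0r//= => e'; by rewrite e' eqxx in he.
Qed.

Section joint_law.
Variables (prior : (node -> E) -> R) (Q : node -> E -> {measure set T -> \bar R}).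
Variable C : set (set T).
Hypotheses (prior_ge0 : forall x, 0 <= prior x) (Q_lty : forall v e, (Q v e setT < +oo)%E).
Hypotheses (Cm : C `<=` measurable) (CI : setI_closed C) (CT : C setT).
Hypothesis CG : measurable `<=` <<s C >>.
Hypothesis joint : forall x A, (forall v, C (A v)) ->
  P (Hev (tree J) x `&` [set w | forall v, v \in tree J -> A v (W v w)]) =
  (prior x * \prod_(v <- tree J) fine (Q v (x v) (A v)))%:E.

Section integral.
Variable g : node -> E -> T -> R.
Hypotheses (g0 : forall v e q, 0 <= g v e q)
  (mg : forall v e, measurable_fun setT (g v e))
  (gfin : forall v e, (\int[Q v e]_q (g v e q)%:E < +oo)%E).

Lemma measurable_grove : measurable_fun setT
  (fun w => \prod_(v <- tree J) g v (H v w) (W v w)).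
Proof.
apply: measurable_prod => v _.
apply: (measurable_fun_state (f := fun e w => g v e (W v w))) => [e|e]; first exact: mH.
exact: measurableT_comp.
Qed.

(** On the configuration event the state [H v w] can be replaced by [x v]. Under P restricted to
    this event the [W v] obey a product formula with laws [Q v (x v)] and constant [prior x]. *)
Lemma grove_integral x :
  (\int[P]_w (\1_(Hev (tree J) x) w * \prod_(v <- tree J) g v (H v w) (W v w))%:E =
   (prior x * \prod_(v <- tree J) fine (\int[Q v (x v)]_q (g v (x v) q)%:E))%:E)%E.
Proof.
have h0 w : 0 <= \1_(Hev (tree J) x) w :> R by rewrite indicE.
have mh : measurable_fun setT (\1_(Hev (tree J) x) : Omega -> R).
  by apply: measurable_indic; exact: measurable_Hev.
have mgx v : measurable_fun setT (fun w => g v (x v) (W v w)) by exact: measurableT_comp.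
transitivity (\int[weighted P h0 mh]_w (\prod_(v <- tree J) g v (x v) (W v w))%:E)%E.
  rewrite integral_weighted//; last 2 first.
  - by move=> w; rewrite lee_fin prodr_ge0.
  - by apply/measurable_EFinP; exact: measurable_prod.
  apply: eq_integral => w _; rewrite -EFinM; congr (_%:E); rewrite mulrC indicE.
  case: (boolP (w \in _)) => [/set_mem Hw|_]; last by rewrite !mulr0.
  by rewrite !mulr1; apply: eq_big_seq => v vt; rewrite Hw.
apply: (integral_prod_indep Cm CI CT CG mW (fun v => Q_lty v (x v))
  (g := fun v => g v (x v))) => //.
- exact: tree_uniq.
- move=> A CA; rewrite -joint//= /weighted integral_indic//.
  + by apply: measurable_bigcap_seq => v _; rewrite -[X in measurable X]setTI; apply: mW => //; exact: Cm.
  + exact: measurable_Hev.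
Qed.

End integral.

(** Configuration by configuration both sides carry the same prior weight, so the comparison is made
    one node and one state at a time; this is how the nodes separate. *)
Lemma grove_eq (g1 g2 : node -> E -> T -> R) :
  (forall v e q, 0 <= g1 v e q) -> (forall v e q, 0 <= g2 v e q) ->
  (forall v e, measurable_fun setT (g1 v e)) ->
  (forall v e, measurable_fun setT (g2 v e)) ->
  (forall v e, \int[Q v e]_q (g1 v e q)%:E < +oo)%E ->
  (forall v e, \int[Q v e]_q (g1 v e q)%:E = \int[Q v e]_q (g2 v e q)%:E)%E ->
  (\int[P]_w (\prod_(v <- tree J) g1 v (H v w) (W v w))%:E =
   \int[P]_w (\prod_(v <- tree J) g2 v (H v w) (W v w))%:E)%E.
Proof.
move=> g10 g20 mg1 mg2 g1fin g12.
have g2fin v e : (\int[Q v e]_q (g2 v e q)%:E < +oo)%E by rewrite -g12.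
have e0 : tree J = tree J ++ [::] by rewrite cats0.
rewrite (integral_partition e0); last 2 first.
- by move=> w; exact: prodr_ge0.
- exact: measurable_grove.
rewrite [RHS](integral_partition e0); last 2 first.
- by move=> w; exact: prodr_ge0.
- exact: measurable_grove.
apply: eq_csum => x; rewrite !grove_integral//; congr ((_ * _)%:E).
by apply: eq_bigr => v _; rewrite g12.
Qed.


Let measurable_preW v (B : set T) : measurable B -> measurable (W v @^-1` B).
Proof. by move=> mB; rewrite -[X in measurable X]setTI; exact: mW. Qed.

Let measurable_preH v (Z : set E) : measurable (H v @^-1` Z).
Proof.
rewrite (_ : _ @^-1` _ = \bigcup_(e in Z) [set w | H v w = e]).
  by apply: fin_bigcup_measurable => //; exact: mH.
by rewrite predeqE => w; split => [|[e Ze /= ->]//]; exists (H v w).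
Qed.

Lemma integral_indic_lty (v : node) (e : E) (f : T -> R) :
  (forall q, 0 <= f q <= 1) -> measurable_fun setT f ->
  (\int[Q v e]_q (f q)%:E < +oo)%E.
Proof.
move=> f01 mf; apply: le_lt_trans (Q_lty v e).
rewrite -[leRHS]mul1e -[leRHS]integral_cst//; apply: ge0_le_integral => //.
- by move=> q _; rewrite lee_fin; case/andP: (f01 q).
- exact/measurable_EFinP.
- by move=> q _; rewrite lee_fin; case/andP: (f01 q).
Qed.

(** * Conditioning on hidden states and node variables *)

Section conditioning_on_states.
Variables (D : set (set T)) (G : set (set Omega)).
Hypotheses (Dm : D `<=` measurable) (DI : setI_closed D) (DT : D setT).
Hypothesis Gm : G `<=` measurable.
Hypothesis GD : forall F, G F -> exists Z : node -> set E, exists2 B : node -> set T,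
  (forall v, D (B v)) &
  F = [set w | forall v, v \in tree J -> Z v (H v w) /\ B v (W v w)].

Let PS := [set F | exists Z : node -> set E, exists2 B : node -> set T,
  (forall v, D (B v)) &
  F = [set w | forall v, v \in tree J -> Z v (H v w) /\ B v (W v w)]].

(** The test events prescribe at each node a set of states and a set in [D], and form a pi-system on
    which [grove_eq] applies. The class [D] encodes what is observed at a node: the data, or the
    data and the variance. *)
Lemma cond_prob_prod (A : node -> set T) (k : node -> E -> T -> R) :
  (forall v, measurable (A v)) -> (forall v e q, 0 <= k v e q <= 1) ->
  (forall v e, measurable_fun setT (k v e)) ->
  measurable_fun setT ((fun w => \prod_(v <- tree J) k v (H v w) (W v w))
    : g_sigma_algebraType G -> R) ->
  (forall v e B, D B -> \int[Q v e]_q (\1_B q * \1_(A v) q)%:E =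
    \int[Q v e]_q (\1_B q * k v e q)%:E)%E ->
  cond_prob P G [set w | forall v, v \in tree J -> A v (W v w)]
    (fun w => \prod_(v <- tree J) k v (H v w) (W v w)).
Proof.
move=> mA k01 mk mf eqk.
have k0 v e q : 0 <= k v e q by case/andP: (k01 v e q).
apply: (cond_prob_pi (PS := PS)) => //.
- by apply: measurable_bigcap_seq => v _; apply: measurable_preW.
- by move=> w; exact: prodr_ge0.
- move=> _ [Z [B DB ->]]; apply: measurable_bigcap_seq => v _.
  by apply: measurableI; [exact: measurable_preH|exact/measurable_preW/Dm].
- move=> _ _ [Z1 [B1 DB1 ->]] [Z2 [B2 DB2 ->]].
  exists (fun v => Z1 v `&` Z2 v); exists (fun v => B1 v `&` B2 v).
    by move=> v; exact: DI.
  rewrite predeqE => w; split => [[h1 h2] v vt|h].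
    by have [? ?] := h1 _ vt; have [? ?] := h2 _ vt.
  by split=> v vt; have [[? ?] [? ?]] := h _ vt.
- exists (fun=> setT); exists (fun=> setT) => //.
  by rewrite predeqE.
- by move=> F GF; apply: sub_sigma_algebra; exact: GD.
move=> _ [Z [B DB ->]].
have FE w : \1_[set w | forall v, v \in tree J -> Z v (H v w) /\ B v (W v w)] w =
    \prod_(v <- tree J) (\1_(Z v) (H v w) * \1_(B v) (W v w)) :> R.
  rewrite (indic_bigcap_seq R (tree J) (fun v => [set w | Z v (H v w) /\ B v (W v w)])).
  apply: eq_bigr => v _; rewrite !indicE -natrM mulnb; congr (nat_of_bool _)%:R.
  by apply/idP/andP => [/set_mem[? ?]|[/set_mem ? /set_mem ?]]; [split|]; apply/mem_set.
have AE w : \1_[set w | forall v, v \in tree J -> A v (W v w)] w =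
    \prod_(v <- tree J) \1_(A v) (W v w) :> R.
  exact: (indic_bigcap_seq R (tree J) (fun v => W v @^-1` A v)).
transitivity (\int[P]_w (\prod_(v <- tree J)
    (\1_(Z v) (H v w) * (\1_(B v) (W v w) * \1_(A v) (W v w))))%:E)%E.
  apply: eq_integral => w _; rewrite FE AE -big_split/=; congr (_%:E).
  by apply: eq_bigr => v _; rewrite mulrA.
transitivity (\int[P]_w (\prod_(v <- tree J)
    (\1_(Z v) (H v w) * (\1_(B v) (W v w) * k v (H v w) (W v w))))%:E)%E; last first.
  apply: eq_integral => w _; rewrite FE -big_split/=; congr (_%:E).
  by apply: eq_bigr => v _; rewrite mulrA.
have i01 (U : Type) (X : set U) q : 0 <= (\1_X q : R) <= 1 by rewrite indicE; case: (_ \in _); rewrite lexx ler01.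
have m1 X : D X -> measurable_fun setT (\1_X : T -> R) by move=> /Dm; exact: measurable_indic.
have m2 v : measurable_fun setT (\1_(A v) : T -> R) by exact: measurable_indic.
have M01 (x y : R) : 0 <= x <= 1 -> 0 <= y <= 1 -> 0 <= x * y <= 1.
  by move=> /andP[? ?] /andP[? ?]; rewrite mulr_ge0//= mulr_ile1.
apply: (grove_eq (g1 := fun v e q => \1_(Z v) e * (\1_(B v) q * \1_(A v) q))
  (g2 := fun v e q => \1_(Z v) e * (\1_(B v) q * k v e q))).
- by move=> v e q; have /andP[] := M01 _ _ (i01 _ (Z v) e) (M01 _ _ (i01 _ (B v) q) (i01 _ (A v) q)).
- by move=> v e q; have /andP[] := M01 _ _ (i01 _ (Z v) e) (M01 _ _ (i01 _ (B v) q) (k01 v e q)).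
- by move=> v e; apply: measurable_funM => //; apply: measurable_funM => //; exact: m1.
- by move=> v e; apply: measurable_funM => //; apply: measurable_funM => //; exact: m1.
- move=> v e; apply: integral_indic_lty => [q|]; first by apply: (M01 _ _) => //; apply: (M01 _ _).
  by apply: measurable_funM => //; apply: measurable_funM => //; exact: m1.
- move=> v e; rewrite indicE; case: (e \in Z v).
    under eq_integral do rewrite mul1r; under [RHS]eq_integral do rewrite mul1r.
    exact: eqk.
  by under eq_integral do rewrite mul0r; under [RHS]eq_integral do rewrite mul0r.
Qed.

Lemma cond_prob_node (v : node) (A : set T) (k : E -> T -> R) : v \in tree J ->
  measurable A -> (forall e q, 0 <= k e q <= 1) ->
  (forall e, measurable_fun setT (k e)) ->
  measurable_fun setT ((fun w => k (H v w) (W v w)) : g_sigma_algebraType G -> R) ->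
  (forall e B, D B -> \int[Q v e]_q (\1_B q * \1_A q)%:E =
    \int[Q v e]_q (\1_B q * k e q)%:E)%E ->
  cond_prob P G (W v @^-1` A) (fun w => k (H v w) (W v w)).
Proof.
move=> vt mA k01 mk mf eqk.
pose A' u := if u == v then A else setT.
pose k' u := if u == v then k else fun _ _ => 1.
have prodE w : \prod_(u <- tree J) k' u (H u w) (W u w) = k (H v w) (W v w).
  rewrite (bigD1_seq v vt (tree_uniq J)) big1 => [|u uv].
    by rewrite /k' eqxx; exact: mulr1.
  by rewrite /k' (negbTE uv).
rewrite (_ : W v @^-1` A = [set w | forall u, u \in tree J -> A' u (W u w)]); last first.
  rewrite predeqE => w; split => [Aw u _|/(_ _ vt)]; rewrite /A'; last by rewrite eqxx.
  by case: eqP => // ->.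
rewrite (_ : (fun w => _) = fun w => \prod_(u <- tree J) k' u (H u w) (W u w)); last first.
  by apply/funext => w; rewrite prodE.
apply: cond_prob_prod.
- by move=> u; rewrite /A'; case: ifP.
- by move=> u e q; rewrite /k'; case: ifP => // _; rewrite ler01 lexx.
- by move=> u e; rewrite /k'; case: ifP => // _; exact: measurable_cst.
- by rewrite (_ : (fun w => _) = fun w => k (H v w) (W v w))//; apply/funext => w; rewrite prodE.
- move=> u e B DB; rewrite /A' /k'; case: ifPn => [/eqP ->|_]; first exact: eqk.
  by apply: eq_integral => q _; rewrite indicT.
Qed.

End conditioning_on_states.

(** * The posterior of the hidden states *)

Section hidden_posterior.
Variables (D : set (set T)) (G : set (set Omega)) (M : node -> E -> T -> R).
Hypotheses (Dm : D `<=` measurable) (DI : setI_closed D) (DT : D setT).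
Hypothesis Gm : G `<=` measurable.
Hypothesis GD : forall F, G F -> exists2 B : node -> set T, (forall v, D (B v)) &
  F = [set w | forall v, v \in tree J -> B v (W v w)].
Hypotheses (M0 : forall v e q, 0 <= M v e q)
  (mM : forall v e, measurable_fun setT (M v e))
  (Mfin : forall v e e', (\int[Q v e']_q (M v e q)%:E < +oo)%E).
Hypothesis Msym : forall v e e' B, D B ->
  (\int[Q v e']_q (\1_B q * M v e q)%:E = \int[Q v e]_q (\1_B q * M v e' q)%:E)%E.

(** The unnormalised posterior weight of [x]; [Ha x y] is this weight on the event that the true
    configuration is [y]. *)
Let a x w := prior x * \prod_(v <- tree J) M v (x v) (W v w).
Let Ha x y w := \1_(Hev (tree J) y) w * a x w.

Let Ha_ge0 x y w : 0 <= Ha x y w.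
Proof. by rewrite /Ha /a indicE !mulr_ge0// prodr_ge0. Qed.

Let measurable_Ha x y : measurable_fun setT (Ha x y).
Proof.
apply: measurable_funM; first by apply: measurable_indic; exact: measurable_Hev.
apply: measurable_funM => //; apply: measurable_prod => v _.
exact: measurableT_comp.
Qed.

Let PS := [set F | exists2 B : node -> set T, (forall v, D (B v)) &
  F = [set w | forall v, v \in tree J -> B v (W v w)]].

Let integral_Ha x y B : (forall v, D (B v)) ->
  (\int[P]_(w in [set w | forall v, v \in tree J -> B v (W v w)]) (Ha x y w)%:E =
   (prior x * prior y * \prod_(v <- tree J)
     fine (\int[Q v (y v)]_q (\1_(B v) q * M v (x v) q)%:E))%:E)%E.
Proof.
move=> DB; rewrite integral_indicM; last first.
  by apply: measurable_bigcap_seq => v _; exact/measurable_preW/Dm.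
pose g v (e : E) q := \1_(B v) q * M v (x v) q.
have g0 v e q : 0 <= g v e q by rewrite /g indicE mulr_ge0.
have mg v e : measurable_fun setT (g v e).
  by apply: measurable_funM => //; apply: measurable_indic; exact: Dm.
have gfin v e : (\int[Q v e]_q (g v e q)%:E < +oo)%E.
  apply: le_lt_trans (Mfin v (x v) e); apply: ge0_le_integral => //.
  - by move=> q _; rewrite lee_fin.
  - exact/measurable_EFinP.
  - exact/measurable_EFinP.
  - by move=> q _; rewrite lee_fin /g indicE; case: (_ \in _); rewrite ?mul1r ?mul0r.
transitivity (\int[P]_w ((prior x)%:E * (\1_(Hev (tree J) y) w *
    \prod_(v <- tree J) g v (H v w) (W v w))%:E))%E.
  apply: eq_integral => w _.
  rewrite (indic_bigcap_seq R (tree J) (fun v => W v @^-1` B v)) /Ha /a /g big_split/=.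
  by rewrite -EFinM; congr (_%:E); ring.
rewrite ge0_integralZl//; last 3 first.
- apply/measurable_EFinP/measurable_funM; last exact: measurable_grove.
  by apply: measurable_indic; exact: measurable_Hev.
- by move=> w _; rewrite lee_fin mulr_ge0 ?indicE// prodr_ge0.
- by rewrite lee_fin.
by rewrite grove_integral// -EFinM mulrA.
Qed.

(** On the test events both integrals factor over the nodes with the common constant
    [prior x * prior y], and [Msym] exchanges the two states at each node. *)
Lemma posterior_sym x y (psi : Omega -> R) : (forall w, 0 <= psi w) ->
  measurable_fun setT (psi : g_sigma_algebraType G -> R) ->
  (\int[P]_w (psi w * Ha x y w)%:E = \int[P]_w (psi w * Ha y x w)%:E)%E.
Proof.
move=> psi0 mpsi; have mpsi' := measurable_fun_gsigma Gm mpsi.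
have E0 w : (0 <= (psi w)%:E)%E by rewrite lee_fin.
have mE : measurable_fun setT (fun w => (psi w)%:E) by exact/measurable_EFinP.
pose mu x y : {measure set Omega -> \bar R} := weighted P (Ha_ge0 x y) (measurable_Ha x y).
have muE x' y' : (\int[P]_w (psi w * Ha x' y' w)%:E = \int[mu x' y']_w (psi w)%:E)%E.
  by rewrite integral_weighted//; apply: eq_integral => w _; rewrite EFinM.
rewrite !muE; apply: (integral_gsigma (G := G)) => //; last exact/measurable_EFinP.
have muPS A : PS A -> mu x y A = mu y x A.
  move=> [B DB ->]; rewrite /mu /= /weighted !integral_Ha//; congr (_%:E).
  rewrite [prior x * _]mulrC; congr (_ * _); apply: eq_bigr => v _.
  by rewrite Msym.
have PT : PS setT by exists (fun=> setT) => //; rewrite predeqE.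
move=> A GA; apply: (@finite_measure_unique _ _ _ (mu x y) (mu y x) PS) => //.
- move=> _ [B DB ->]; apply: measurable_bigcap_seq => v _.
  exact/measurable_preW/Dm.
- move=> _ _ [B1 DB1 ->] [B2 DB2 ->]; exists (fun v => B1 v `&` B2 v).
    by move=> v; exact: DI.
  by rewrite predeqE => w; split => [[h1 h2] v vt|h];
    [split; [exact: h1|exact: h2]|split=> v /h[]].
- case: PT => B DB ->; rewrite /mu /= /weighted integral_Ha//; exact: ltry.
- move: A GA; apply: sub_sigma_algebra2; exact: GD.
Qed.

Variables (post : (node -> E) -> Omega -> R) (Z : Omega -> R).
Hypotheses (Z0 : forall w, 0 < Z w) (post0 : forall x w, 0 <= post x w).
Hypothesis mpost : forall x,
  measurable_fun setT (post x : g_sigma_algebraType G -> R).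
Hypothesis mZ : measurable_fun setT (Z : g_sigma_algebraType G -> R).
Hypothesis postZ : forall x w,
  post x w * Z w = prior x * \prod_(v <- tree J) M v (x v) (W v w).
Hypothesis post1 : forall w, csum (tree J) (fun x => post x w) x0 = 1.

(* Bayes without densities: swapping the roles of the configurations x and y
   in the unnormalised posterior and summing over y normalises it. *)
Lemma hidden_posterior x (psi : Omega -> R) : (forall w, 0 <= psi w) ->
  measurable_fun setT (psi : g_sigma_algebraType G -> R) ->
  (\int[P]_w (psi w * \1_(Hev (tree J) x) w)%:E = \int[P]_w (psi w * post x w)%:E)%E.
Proof.
move=> psi0 mpsi.
have mpsi' := measurable_fun_gsigma Gm mpsi.
have mpost' y := measurable_fun_gsigma Gm (mpost y).
have e0 : tree J = tree J ++ [::] by rewrite cats0.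
have mHev y : measurable_fun setT (\1_(Hev (tree J) y) : Omega -> R).
  by apply: measurable_indic; exact: measurable_Hev.
(* Dividing by the normalising constant turns [psi * post] into [chi * a], and [chi] is still
   measurable for [G], as the symmetry requires. *)
pose chi w := psi w / Z w.
have chi0 w : 0 <= chi w by rewrite divr_ge0// ltW.
have mchi : measurable_fun setT (chi : g_sigma_algebraType G -> R).
  by apply: measurable_funM => //; exact: measurable_inv.
have aE y w : a y w = Z w * post y w by rewrite /a -postZ mulrC.
rewrite [RHS](integral_partition e0); last 2 first.
- by move=> w; rewrite mulr_ge0.
- exact: measurable_funM.
transitivity (csum (tree J) (fun y => \int[P]_w
    (\1_(Hev (tree J) x) w * (psi w * post y w))%:E) x0)%E; last first.
  apply: eq_csum => y.
  have chiE w u v : u * (psi w * post v w) = chi w * (u * a v w).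
    by rewrite aE /chi; field; rewrite gt_eqF.
  under eq_integral do rewrite chiE; under [RHS]eq_integral do rewrite chiE.
  exact: posterior_sym.
rewrite -integral_csum//; last 2 first.
- by move=> y w; rewrite indicE !mulr_ge0.
- by move=> y; apply: measurable_funM => //; exact: measurable_funM.
apply: eq_integral => w _; congr (_%:E).
by rewrite csumZ csumZ post1 mulr1 mulrC.
Qed.

Variables (q0 : Omega -> E -> R) (q : Omega -> node -> E -> E -> R).
Hypotheses (q0_prob : forall w, prob_vec (q0 w))
  (q_prob : forall w v, v \in tree J -> (0 < v.1)%N -> forall e, prob_vec (q w v e)).
Hypothesis mq0 : forall e,
  measurable_fun setT ((fun w => q0 w e) : g_sigma_algebraType G -> R).
Hypothesis mq : forall v e e', v \in tree J -> (0 < v.1)%N ->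
  measurable_fun setT ((fun w => q w v e e') : g_sigma_algebraType G -> R).
Hypothesis postE : forall x w, post x w = MT_prob J (q0 w) (q w) x.

Let measurable_prefix s1 s2 x : tree J = s1 ++ s2 -> measurable_fun setT
  ((fun w => MT_prefix (q0 w) (q w) s1 x) : g_sigma_algebraType G -> R).
Proof.
move=> e; apply: measurable_prod => v vs; rewrite /MT_factor.
case: (boolP (0 < v.1)%N) => v0; last exact: mq0.
by apply: mq => //; rewrite e mem_cat vs.
Qed.

Let prefix_ge0 s1 s2 x w : tree J = s1 ++ s2 -> 0 <= MT_prefix (q0 w) (q w) s1 x.
Proof.
move=> e; rewrite /MT_prefix big_seq; apply: prodr_ge0 => v vs; rewrite /MT_factor.
case: ifPn => v0; last exact: (proj1 (q0_prob w)).
by apply: (proj1 (q_prob w _ v0 _)); rewrite e mem_cat vs.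
Qed.

(** By induction on the remaining nodes [s2], starting from the full tree: the value at the next
    node is summed out of the indicators on one side and of the posterior prefixes on the other. *)
Lemma prefix_posterior s1 s2 x (psi : Omega -> R) : tree J = s1 ++ s2 ->
  (forall w, 0 <= psi w) ->
  measurable_fun setT (psi : g_sigma_algebraType G -> R) ->
  (\int[P]_w (psi w * \1_(Hev s1 x) w)%:E =
   \int[P]_w (psi w * MT_prefix (q0 w) (q w) s1 x)%:E)%E.
Proof.
move=> + psi0 mpsi; have mpsi' := measurable_fun_gsigma Gm mpsi.
elim: s2 s1 x => [|v s2 IH] s1 x e.
  rewrite cats0 in e; rewrite -e hidden_posterior//.
  by apply: eq_integral => w _; rewrite postE MT_probE.
have e' : tree J = rcons s1 v ++ s2 by rewrite cat_rcons.
transitivity (\int[P]_w \sum_(b : E) (psi w * \1_(Hev (rcons s1 v) (updn x v b)) w)%:E)%E.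
  apply: eq_integral => w _; rewrite sumEFin -mulr_sumr; congr ((_ * _)%:E).
  rewrite (indic_MT _ _ e); under eq_bigr do rewrite (indic_MT _ _ e').
  by rewrite (MT_prefix_sum (indicator_prob _) _ e)// => _ b; exact: indicator_prob.
rewrite ge0_integral_sum//; last 2 first.
- move=> b; apply/measurable_EFinP/measurable_funM => //.
  by apply: measurable_indic; exact: measurable_Hev.
- by move=> b w _; rewrite lee_fin indicE mulr_ge0.
under eq_bigr do rewrite (IH _ _ e').
rewrite -ge0_integral_sum//; last 2 first.
- move=> b; apply/measurable_EFinP/measurable_funM => //.
  exact: (measurable_fun_gsigma Gm (measurable_prefix _ e')).
- by move=> b w _; rewrite lee_fin mulr_ge0// (prefix_ge0 _ _ e').
apply: eq_integral => w _; rewrite sumEFin -mulr_sumr; congr ((_ * _)%:E).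
apply: (MT_prefix_sum (q0_prob w) _ e) => v0; apply: q_prob => //.
by rewrite e mem_cat mem_head orbT.
Qed.

Lemma cond_prob_prefix s1 s2 x : tree J = s1 ++ s2 ->
  cond_prob P G (Hev s1 x) (fun w => MT_prefix (q0 w) (q w) s1 x).
Proof.
move=> e; split => [B mB|F GF].
  by rewrite -[X in <<s _ >> X]setTI; exact: (measurable_prefix x e).
have mF := sigma_sub_measurable Gm GF.
rewrite (probI_integral _ _ mF); last exact: measurable_Hev.
rewrite (integral_indicM _ _ mF); apply: (prefix_posterior _ e).
- by move=> w; rewrite indicE.
- exact: (@measurable_indic _ (g_sigma_algebraType G)).
Qed.

(** Test events combine the state of the parent with an event of [G]. Partitioning them by all
    states listed before [v] brings prefixes into play, and appending [v] multiplies a prefix by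
    exactly the transition from the parent. *)
Lemma cond_prob_trans (v : node) (y : E) (GH : set (set Omega)) :
  v \in tree J -> (0 < v.1)%N -> GH `<=` measurable ->
  (forall F, GH F -> exists Z : set E, F = H (parent v) @^-1` Z) ->
  (forall e, <<s GH >> [set w | H (parent v) w = e]) ->
  cond_prob P (GH `|` G) [set w | H v w = y] (fun w => q w v (H (parent v) w) y).
Proof.
move=> vt v0 GHm GHZ mGH.
have [s1 [s2 e]] : exists s1 s2, tree J = s1 ++ v :: s2.
  by case/splitPr: vt => s1 s2; exists s1, s2.
have [vs1 ps1 /(_ v0) pv1] := tree_split e.
have e' : tree J = rcons s1 v ++ s2 by rewrite cat_rcons.
have GHG : GH `|` G `<=` measurable by move=> F [/GHm|/Gm].
have G1 : G `<=` <<s GH `|` G >>.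
  by move=> F GF; apply: sub_sigma_algebra; right.
pose PS' := [set F | exists Z : set E, exists2 F', <<s G >> F' &
  F = H (parent v) @^-1` Z `&` F'].
have sGm := sigma_sub_measurable Gm.
have mqv b : measurable_fun setT (fun w => q w v b y).
  exact: (measurable_fun_gsigma Gm (mq b y vt v0)).
have qv0 w b : 0 <= q w v b y by exact: (proj1 (q_prob w vt v0 b)).
apply: (cond_prob_pi (PS := PS')) => //.
- apply: (@measurable_fun_state _ (g_sigma_algebraType (GH `|` G)) _
    (fun b w => q w v b y)) => [b|b].
    by apply: (@sub_sigma_algebra2 _ setT _ GH) => //; exact: subsetUl.
  exact: (measurable_fun_gsigmaS G1 (mq b y vt v0)).
- by move=> _ [Z' [F' /sGm mF' ->]]; apply: measurableI => //; exact: measurable_preH.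
- move=> _ _ [Z1 [F1 GF1 ->]] [Z2 [F2 GF2 ->]]; exists (Z1 `&` Z2); exists (F1 `&` F2).
    exact: (@measurableI _ (g_sigma_algebraType G)).
  by rewrite preimage_setI setIACA.
- exists setT; exists setT; first exact: (@measurableT _ (g_sigma_algebraType G)).
  by rewrite preimage_setT setTI.
- move=> F [/GHZ[Z' ->]|GF]; apply: sub_sigma_algebra.
    exists Z'; exists setT; last by rewrite setIT.
    exact: (@measurableT _ (g_sigma_algebraType G)).
  by exists setT; exists F; [exact: sub_sigma_algebra|rewrite preimage_setT setTI].
move=> _ [Z' [F' GF' ->]].
have mF' := sGm _ GF'.
have mZF : measurable (H (parent v) @^-1` Z' `&` F').
  by apply: measurableI => //; exact: measurable_preH.
have mqH : measurable_fun setT (fun w => q w v (H (parent v) w) y).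
  exact: (measurable_fun_state (f := fun b w => q w v b y) (mH _)).
rewrite (integral_partition e); last 2 first.
- by move=> w; rewrite !indicE mulr_ge0.
- by apply: measurable_funM; apply: measurable_indic.
rewrite [RHS](integral_partition e); last 2 first.
- by move=> w; rewrite indicE mulr_ge0.
- by apply: measurable_funM => //; apply: measurable_indic.
apply: eq_csum => x.
(* Since [s1] contains the parent, on the configuration [x] the condition on its state is constant,
   and the test function becomes measurable for [G]. *)
pose psi w : R := \1_Z' (x (parent v)) * \1_F' w.
have psi0 w : 0 <= psi w by rewrite /psi !indicE mulr_ge0.
have mpsi : measurable_fun setT (psi : g_sigma_algebraType G -> R).
  by apply: measurable_funM => //; exact: (@measurable_indic _ (g_sigma_algebraType G)).
have ZE w : Hev s1 x w -> \1_(H (parent v) @^-1` Z' `&` F') w = psi w.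
  move=> hw; rewrite indicI /psi; congr (_ * _); rewrite !indicE.
  congr (nat_of_bool _)%:R; rewrite -(hw _ pv1).
  by apply/idP/idP => /set_mem h; exact/mem_set.
transitivity (\int[P]_w (psi w * \1_(Hev (rcons s1 v) (updn x v y)) w)%:E)%E.
  apply: eq_integral => w _; congr (_%:E).
  rewrite (indic_MT _ _ e') (MT_prefix_rcons _ _ _ _ e) v0 -(indic_MT _ _ e).
  rewrite [\1_(Hev s1 x) w]indicE; case: (boolP (w \in _)) => [/set_mem hw|_]; last first.
    by rewrite !(mul0r, mulr0).
  rewrite !mul1r ZE//; congr (_ * _); rewrite indicE; congr (nat_of_bool _)%:R.
  by rewrite eq_sym; apply/idP/eqP => [/set_mem|h] //; exact/mem_set.
rewrite (prefix_posterior _ e')//.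
transitivity (\int[P]_w (psi w * q w v (x (parent v)) y * \1_(Hev s1 x) w)%:E)%E.
  rewrite (prefix_posterior _ e)//; last 2 first.
  - by move=> w; rewrite mulr_ge0.
  - by apply: measurable_funM => //; exact: mq.
  apply: eq_integral => w _; rewrite (MT_prefix_rcons _ _ _ _ e) v0.
  by congr (_%:E); ring.
apply: eq_integral => w _; congr (_%:E); rewrite mulrC.
rewrite [\1_(Hev s1 x) w]indicE; case: (boolP (w \in _)) => [/set_mem hw|_]; last first.
  by rewrite !(mul0r, mulr0).
by rewrite !mul1r ZE// hw.
Qed.

End hidden_posterior.

End joint_law.
End grove.

(** * The NIG-MG model *)

Section model_indices.
Context {R : realType} {L : nat}.
Variables (J : nat) (G : 'I_L -> nat) (ng : combo G -> nat) (h : hyper R L).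
Hypothesis h_valid : valid_hyper J h.

(** [tagnat.sig2] counts from 0 and the columns of a factor begin at level 2, hence the shift by
    two. *)
Definition coef_key (i : 'I_(ncoef G)) : option ('I_L * nat) :=
  match fintype.split i with
  | inl _ => None
  | inr k => Some (tagnat.sig1 k, (tagnat.sig2 k).+2)
  end.

Definition active (x : state L) (i : 'I_(ncoef G)) : bool :=
  if coef_key i is Some (l, _) then x.2 l else x.1.

(** The diagonal of [Lambda], so that [prec] at this row is [Lambda_star] by conversion. *)
Definition prior_prec (j : nat) : 'rV[R]_(ncoef G) :=
  row_mx (const_mx (tau_at h j)^-1)
    (\mxrow_(l < L) (const_mx (upsilon_at h j l)^-1 : 'rV_(G l).-1)).

Lemma coef_key_inj : injective coef_key.
Proof.
move=> i i'; rewrite /coef_key.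
case: (split_ordP i) => [k ->|k ->]; case: (split_ordP i') => [k' ->|k' ->] //.
  by rewrite (ord1 k) (ord1 k').
move=> [e1 e2]; congr (rshift _ _); rewrite -(tagnat.sig2K k) -(tagnat.sig2K k').
move: (tagnat.sig2 k) (tagnat.sig2 k') e2; rewrite e1 => a a' e2.
by congr (tagnat.Rank _ _); exact: val_inj.
Qed.

(** Links the list of names in which the model is stated with the column indices of the matrices, so
    that products over one can be taken over the other. *)
Lemma perm_coef_key : perm_eq (coef_idx G) [seq coef_key i | i <- enum 'I_(ncoef G)].
Proof.
apply: uniq_perm.
- rewrite /= allpairs_uniq_dep ?andbT; last 3 first.
  + exact: enum_uniq.
  + by move=> l _; exact: iota_uniq.
  + by move=> [l g] [l' g'] _ _ /= [-> ->].
  by apply/negP => /allpairsPdep[? [? []]].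
- by rewrite map_inj_uniq ?enum_uniq//; exact: coef_key_inj.
move=> c; apply/idP/mapP => [|[i _ ->]].
  rewrite inE => /predU1P[->|/allpairsPdep[l [g [_ + ->]]]].
    by exists (lshift _ ord0); rewrite ?mem_enum// /coef_key; case: split_ordP => // k /eqP; rewrite eq_lrshift.
  rewrite mem_iota => /andP[g2 gG].
  have gk : (g - 2 < (G l).-1)%N by rewrite ltn_subLR.
  exists (rshift 1 (tagnat.Rank l (Ordinal gk))); rewrite ?mem_enum// /coef_key.
  case: split_ordP => k /eqP; first by rewrite eq_rlshift.
  rewrite eq_rshift => /eqP <-; congr (Some (_, _)); first by rewrite tagnat.Rank1K.
  by rewrite tagnat.Rank2K/= -addn2 subnK.
rewrite /coef_key; case: split_ordP => k _; first exact: mem_head.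
rewrite inE; apply/orP; right; apply/allpairsPdep.
exists (tagnat.sig1 k); exists (tagnat.sig2 k).+2; split => //; first exact: mem_enum.
by rewrite mem_iota/= -[X in (X < _)%N]add2n ltn_add2l.
Qed.

Lemma prior_prec_key j i : (prior_prec j 0 i)^-1 =
  if coef_key i is Some (l, _) then upsilon_at h j l else tau_at h j.
Proof.
rewrite /prior_prec /coef_key; case: split_ordP => k ->.
  by rewrite row_mxEl mxE invrK.
by rewrite row_mxEr !mxE invrK.
Qed.

Lemma prior_prec_gt0 j i : 0 < prior_prec j 0 i.
Proof.
rewrite -invr_gt0 prior_prec_key; case: (coef_key i) => [[l _]|].
  by rewrite mulr_gt0 ?powR_gt0// (upsilon_gt0 h_valid).
by rewrite mulr_gt0 ?powR_gt0// (tau_gt0 h_valid).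
Qed.

Definition Xfull : 'M[R]_(nobs ng, ncoef G) := Xmat ng (true, [ffun=> true]).

Lemma XmatE x : Xmat ng x = \matrix_(o, i) (Xfull o i * (active x i)%:R).
Proof.
apply/matrixP => o i; rewrite [RHS]mxE /Xfull /Xmat /active /coef_key.
case: split_ordP => k ->; first by rewrite !row_mxEl !mxE mul1r.
by rewrite !row_mxEr !mxE ffunE mul1r mulrC.
Qed.

Lemma MmatE x : exists2 W : 'cV[R]_(ncoef G),
  forall i, W i 0 = (active x i)%:R & Mmat G x = W *m W^T.
Proof.
eexists; last by [].
move=> i; rewrite /active /coef_key; case: split_ordP => k ->.
  by rewrite col_mxEu mxE.
by rewrite col_mxEd !mxE.
Qed.

Lemma marg_likE j (dv : (nobs ng).-tuple R) x :
  marg_lik h j (tcol dv) x =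
  marg (Xmat ng x) (prior_prec j) (nu h + 1) (nu h * sigma02 h) dv.
Proof.
rewrite /marg_lik /marg.
have -> : nu h + (nobs ng)%:R / 2 + 1 = nu h + 1 + (nobs ng)%:R / 2 by ring.
by have -> : - nu h - (nobs ng)%:R / 2 - 1 = - (nu h + 1 + (nobs ng)%:R / 2) by ring.
Qed.

(* The level-1 effects carry no column: their coefficient is zero. *)
Lemma Xfull_mul (f : option ('I_L * nat) -> R) (o : 'I_(nobs ng)) :
  (forall l, f (Some (l, 1%N)) = 0) ->
  (Xfull *m \col_i f (coef_key i)) o 0 =
  f None + \sum_(l < L) f (Some (l, level (enum_val o : obs ng) l)).
Proof.
move=> f1; pose C := \mxcol_(l < L) \col_(g < (G l).-1) f (Some (l, g.+2)).
have -> : \col_i f (coef_key i) = col_mx (const_mx (f None)) C.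
  apply/matrixP => i j; rewrite (ord1 j) mxE /coef_key; case: split_ordP => k ->.
    by rewrite col_mxEu mxE.
  by rewrite col_mxEd !mxE.
rewrite /Xfull /Xmat mul_row_col mul_mxrow_mxcol mxE; congr (_ + _).
  by rewrite mxE big_ord1 !mxE mul1r.
rewrite summxE; apply: eq_bigr => l _; rewrite mxE.
under eq_bigr do rewrite !mxE ffunE mul1r.
rewrite /level; case: (tag (enum_val o : obs ng) l) => -[|g] /= gG.
  by rewrite f1 big1// => g _; rewrite mul0r.
have gG' : (g < (G l).-1)%N by case: (G l) gG.
rewrite (bigD1 (Ordinal gG'))//= eqxx mul1r big1 ?addr0// => g' gg'.
move: gg'; rewrite -(inj_eq val_inj) /= eq_sym => gg'.
by rewrite !eqSS (negbTE gg') mul0r.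
Qed.

End model_indices.

Section gen_tools.
Context d (Omega : measurableType d).

Lemma gen_measurable d' (T : measurableType d') (f : Omega -> T) :
  measurable_fun setT f -> gen f `<=` measurable.
Proof. by move=> mf _ [B mB <-]; exact: mf. Qed.

Lemma genfam_measurable d' (T : measurableType d') (I : eqType) (s : seq I)
    (f : I -> Omega -> T) : (forall i, measurable_fun setT (f i)) ->
  genfam s f `<=` measurable.
Proof. by move=> mf F [i _]; exact: gen_measurable. Qed.

Lemma genfam_gen d' (T : measurableType d') (I : eqType) (s : seq I)
    (f : I -> Omega -> T) i : i \in s -> gen (f i) `<=` genfam s f.
Proof. by move=> is_ F gF; exists i. Qed.

Lemma gsigma_bigcap_seq (G : set (set Omega)) (I : eqType) (s : seq I)
    (E : I -> set Omega) : (forall i, i \in s -> <<s G >> (E i)) ->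
  <<s G >> [set w | forall i, i \in s -> E i w].
Proof. by move=> mE; apply: (@measurable_bigcap_seq _ (g_sigma_algebraType G)). Qed.

Lemma gsigma_preimage d' (T : measurableType d') (G : set (set Omega)) (f : Omega -> T) B :
  gen f `<=` <<s G >> -> measurable B -> <<s G >> (f @^-1` B).
Proof. by move=> fG mB; apply: fG; exists B => //; rewrite setTI. Qed.

(** The defining identity says that two measures agree on sigma(G); hence they integrate test
    functions measurable for it alike. *)
Lemma cond_prob_integral (R : realType) (P : probability Omega R)
    (G : set (set Omega)) (E : set Omega) (f psi : Omega -> R) :
  G `<=` measurable -> measurable E -> (forall w, 0 <= f w) ->
  cond_prob P G E f -> (forall w, 0 <= psi w) ->
  measurable_fun setT (psi : g_sigma_algebraType G -> R) ->
  (\int[P]_w (psi w * \1_E w)%:E = \int[P]_w (psi w * f w)%:E)%E.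
Proof.
move=> Gm mE f0 [mf fE] psi0 mpsi.
have E0 w : 0 <= \1_E w :> R by rewrite indicE.
have m1E : measurable_fun setT (\1_E : Omega -> R) by exact: measurable_indic.
have mf' : measurable_fun setT f.
  by move=> _ B mB; rewrite setTI; apply: (sigma_sub_measurable Gm); exact: mf.
have mpsi' := measurable_fun_gsigma Gm mpsi.
have psiE w : (0 <= (psi w)%:E)%E by rewrite lee_fin.
transitivity (\int[weighted P E0 m1E]_w (psi w)%:E)%E.
  by rewrite integral_weighted//; exact/measurable_EFinP.
transitivity (\int[weighted P f0 mf']_w (psi w)%:E)%E; last first.
  by rewrite integral_weighted//; exact/measurable_EFinP.
apply: (integral_gsigma (G := G)) => //; last exact/measurable_EFinP.
move=> A GA; have mA := sigma_sub_measurable Gm GA.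
by rewrite /= /weighted -(fE _ GA) integral_indic// setIC.
Qed.

End gen_tools.

Lemma normal_law_le1 (R : realType) (m v : R) (B : set R) : measurable B ->
  (normal_law m v B <= 1)%E.
Proof.
move=> mB; rewrite /normal_law; case: ifP => _; last by rewrite diracE; case: (_ \in _).
exact: probability_le1.
Qed.

(** * The joint law of states, variances, coefficients and data *)

Section model_law.
Context {R : realType} {d : measure_display} {Omega : measurableType d}.
Variable P : probability Omega R.
Variables (J L : nat) (G : 'I_L -> nat) (ng : combo G -> nat) (h : hyper R L).
Variables (S : node -> {RV P >-> bool}) (Rh : 'I_L -> node -> {RV P >-> bool})
  (sig2 z : node -> {RV P >-> R}) (beta : 'I_L -> nat -> node -> {RV P >-> R})
  (u data : node -> obs ng -> {RV P >-> R}).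
Hypotheses (h_valid : valid_hyper J h) (model : NIG_MG J h S Rh sig2 z beta u data).

Local Notation H := (hidden S Rh).
Local Notation p := (ncoef G).
Local Notation n := (nobs ng).
Local Notation T := (R * (p.-tuple R * n.-tuple R))%type.
Local Notation cf := (coef z beta).

Definition data_tuple (v : node) (w : Omega) : n.-tuple R :=
  [tuple data v (enum_val i) w | i < n].

Definition node_obs (v : node) (w : Omega) : T :=
  (sig2 v w, (coef_tuple G z beta v w, data_tuple v w)).

Lemma tcol_data_tuple v w : tcol (data_tuple v w) = data_vec data w v.
Proof. by apply/matrixP => i j; rewrite !mxE tnth_mktuple. Qed.

Lemma shape_gt1 : 1 < nu h + 1.
Proof. by rewrite ltrDr (nu_gt0 h_valid). Qed.

Lemma scale_gt0 : 0 < nu h * sigma02 h.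
Proof. by rewrite mulr_gt0 ?(nu_gt0 h_valid)// (sigma02_gt0 h_valid). Qed.

Definition node_law (v : node) (x : state L) : {measure set T -> \bar R} :=
  nodeQ (prior_prec G h v.1) (nu h * sigma02 h) shape_gt1 (Xmat ng x) (active x).

Lemma measurable_coef c : measurable_fun setT (cf c).
Proof. by case: c => v [[l g]|]; exact: measurable_funPT. Qed.

Lemma coef_tuple_coef v w i :
  tnth (coef_tuple G z beta v w) i = cf (v, coef_key i) w.
Proof.
rewrite tnth_mktuple /coef_vec /coef_key /coef/=; case: split_ordP => k ->.
  by rewrite col_mxEu mxE.
by rewrite col_mxEd !mxE.
Qed.

Lemma measurable_coef_tuple v : measurable_fun setT (coef_tuple G z beta v).
Proof.
apply/measurable_fun_tnthP => i.
rewrite (_ : _ \o _ = cf (v, coef_key i)); first exact: measurable_coef.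
by apply/funext => w /=; rewrite coef_tuple_coef.
Qed.

Lemma measurable_data_tuple v : measurable_fun setT (data_tuple v).
Proof.
apply/measurable_fun_tnthP => i.
rewrite (_ : _ \o _ = data v (enum_val i)); first exact: measurable_funPT.
by apply/funext => w /=; rewrite tnth_mktuple.
Qed.

Lemma measurable_node_obs v : measurable_fun setT (node_obs v).
Proof.
apply: measurable_fun_pair; first exact: measurable_funPT.
by apply: measurable_fun_pair; [exact: measurable_coef_tuple|exact: measurable_data_tuple].
Qed.

Lemma gen_hidden_measurable s : gen_hidden S Rh s `<=` measurable.
Proof.
move=> F [|[l _]]; apply: genfam_measurable => v; exact: measurable_funPT.
Qed.

Lemma hidden_eq v w (e : state L) :
  H v w = e <-> S v w = e.1 /\ forall l, Rh l v w = e.2 l.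
Proof.
case: e => e1 e2; split=> [[<- <-]/=|[/= h1 h2]].
  by split => // l; rewrite ffunE.
by rewrite /hidden h1; congr (_, _); apply/ffunP => l; rewrite ffunE.
Qed.

Lemma gsigma_hidden (s : seq node) v e : v \in s -> <<s gen_hidden S Rh s >> [set w | H v w = e].
Proof.
move=> vs; rewrite (_ : [set w | _] = S v @^-1` [set e.1] `&`
    [set w | forall l, l \in enum 'I_L -> (Rh l v @^-1` [set e.2 l]) w]); last first.
  rewrite predeqE => w; split=> [/hidden_eq[h1 h2]|[h1 h2]]; first by split=> // l _; exact: h2.
  by apply/hidden_eq; split => // l; apply: h2; rewrite mem_enum.
apply: (@measurableI _ (g_sigma_algebraType (gen_hidden S Rh s))).
  apply: gsigma_preimage => //; apply: subset_trans (@sub_sigma_algebra _ setT _).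
  by move=> F gF; left; exact: (genfam_gen (f := S) vs).
apply: gsigma_bigcap_seq => l _; apply: (gsigma_preimage (f := Rh l v)) => //.
apply: subset_trans (@sub_sigma_algebra _ setT _).
by move=> F gF; right; exists l => //; exact: (genfam_gen (f := Rh l) vs).
Qed.

Lemma measurable_hidden v e : measurable [set w | H v w = e].
Proof.
apply: (sigma_sub_measurable (@gen_hidden_measurable [:: v])).
by apply: gsigma_hidden; exact: mem_head.
Qed.

Local Notation Hev x := [set w | forall v, v \in tree J -> H v w = x v].
Local Notation prior x := (MT_prob J (prior_init h) (prior_trans h) x).

Lemma prod_enum_option (F : option 'I_L -> R) :
  \prod_(o <- enum {: option 'I_L}) F o = F None * \prod_(l < L) F (Some l).
Proof.
have -> : \prod_(o <- enum {: option 'I_L}) F o =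
    \prod_(o <- None :: [seq Some l | l <- enum 'I_L]) F o.
  apply: perm_big; apply: uniq_perm; first exact: enum_uniq.
    rewrite /= map_inj_uniq ?enum_uniq ?andbT; last by move=> ? ? [].
    by apply/mapP => -[].
  move=> o; rewrite mem_enum inE; case: o => //= l; apply/esym/mapP.
  by exists l => //; rewrite mem_enum.
by rewrite big_cons big_map big_enum.
Qed.

(** Initial and transition probabilities on the product state space are products over the
    components, so independence merges the L + 1 trees into one. *)
Lemma hidden_prior (x : node -> state L) : P (Hev x) = (prior x)%:E.
Proof.
pose E o := if o is Some l then [set w | forall v, v \in tree J -> Rh l v w = (x v).2 l]
  else [set w | forall v, v \in tree J -> S v w = (x v).1].
have HE : Hev x = \bigcap_(o in [set` enum {: option 'I_L}]) E o.
  rewrite predeqE => w; split => [hx [l|] _ v vt|hE v vt].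
  - by have /hidden_eq[_ ->] := hx v vt.
  - by have /hidden_eq[-> _] := hx v vt.
  - apply/hidden_eq; split => [|l].
      by apply: (hE None) => //; rewrite /= mem_enum.
    by apply: (hE (Some l)) => //; rewrite /= mem_enum.
have Ef : fine (P (Hev x)) = prior x.
  rewrite HE (hidden_indep model) => [|o _]; last first.
    case: o => [l|]; apply: gsigma_bigcap_seq => v vt.
      apply: (gsigma_preimage (B := [set (x v).2 l])) => //.
      apply: subset_trans (@sub_sigma_algebra _ setT _).
      exact: (genfam_gen (f := Rh l) vt).
    apply: (gsigma_preimage (B := [set (x v).1])) => //.
    apply: subset_trans (@sub_sigma_algebra _ setT _).
    exact: (genfam_gen (f := S) vt).
  rewrite prod_enum_option /= (S_MT model (fun v => (x v).1)) /=.
  under eq_bigr do rewrite (R_MT model _ (fun v => (x v).2 _)) /=.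
  rewrite /MT_prob big_split/= exchange_big/= mulrACA -big_split/=.
  by [].
rewrite -Ef fineK// fin_num_measure//.
by apply: measurable_bigcap_seq => v _; exact: measurable_hidden.
Qed.

(* In the coordinates (variance, coefficients, noise) the joint law is explicit
   on rectangles, and these generate. *)
Definition rect (D : set R) (B : 'I_p -> set R) (C : 'I_n -> set R) : set T :=
  [set q | [/\ D q.1, forall i, B i (tnth q.2.1 i) &
    forall o, C o (tnth q.2.2 o - (@Xfull R L G ng *m tcol q.2.1) o 0)]].

Definition rects : set (set T) := [set A | exists t : set R * ('I_p -> set R) * ('I_n -> set R),
  [/\ measurable t.1.1, forall i, measurable (t.1.2 i), forall o, measurable (t.2 o) &
    A = rect t.1.1 t.1.2 t.2]].

Let noise_coord (o : 'I_n) (q : T) : R := tnth q.2.2 o - (@Xfull R L G ng *m tcol q.2.1) o 0.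

Let measurable_noise_coord o : measurable_fun setT (noise_coord o).
Proof.
apply: measurable_funB.
  by apply: (measurableT_comp (measurable_tnth o)); apply: measurableT_comp.
by apply: vmeasurable_mul; apply: vmeasurable_tcol; apply: measurableT_comp.
Qed.

Let rectE D B C : rect D B C = (fst @^-1` D) `&`
  ([set q | forall i, i \in enum 'I_p -> (B i) (tnth q.2.1 i)] `&`
   [set q | forall o, o \in enum 'I_n -> (C o) (noise_coord o q)]).
Proof.
rewrite predeqE => q; split => [[h1 h2 h3]|[h1 [h2 h3]]].
  by split=> //; split=> [i _|o _]; [exact: h2|exact: h3].
by split => // [i|o]; [apply: h2|apply: h3]; rewrite mem_enum.
Qed.

Lemma rects_measurable : rects `<=` measurable.
Proof.
move=> _ [[[D B] C] [/= mD mB mC ->]]; rewrite rectE; apply: measurableI.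
  by rewrite -[X in measurable X]setTI; exact: measurable_fst.
apply: measurableI; apply: measurable_bigcap_seq => i _.
  rewrite -[X in measurable X]setTI.
  apply: (measurableT_comp (measurable_tnth i) (measurableT_comp measurable_fst measurable_snd)) => //.
by rewrite -[X in measurable X]setTI; exact: measurable_noise_coord.
Qed.

Lemma rects_setI : setI_closed rects.
Proof.
move=> _ _ [[[D1 B1] C1] [/= mD1 mB1 mC1 ->]] [[[D2 B2] C2] [/= mD2 mB2 mC2 ->]].
exists (D1 `&` D2, fun i => B1 i `&` B2 i, fun o => C1 o `&` C2 o); split => /=.
- exact: measurableI.
- by move=> i; exact: measurableI.
- by move=> o; exact: measurableI.
rewrite predeqE => q; split => [[[? h1 h2] [? h3 h4]]|[[? ?] h1 h2]].
  by split => // i; split.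
by split; split => // i; [have [] := h1 i|have [] := h2 i|have [] := h1 i|have [] := h2 i].
Qed.

Lemma rects_setT : rects setT.
Proof. by exists (setT, fun=> setT, fun=> setT); split => //=; rewrite predeqE. Qed.

(** Variance, coefficients and noise are measurable for the rectangles, and the data are recovered
    by adding the regression term back to the noise. *)
Lemma rects_generate : measurable `<=` <<s rects >>.
Proof.
pose T' := g_sigma_algebraType rects.
have pre D B C : measurable D -> (forall i, measurable (B i)) -> (forall o, measurable (C o)) ->
    <<s rects >> (rect D B C).
  by move=> mD mB mC; apply: sub_sigma_algebra; exists (D, B, C).
have m1 : measurable_fun setT (fun q : T' => (q : T).1).
  move=> _ D mD; rewrite setTI.
  rewrite (_ : _ @^-1` _ = rect D (fun=> setT) (fun=> setT)); first exact: pre.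
  by rewrite predeqE => q; split => [|[]].
have m2 i : measurable_fun setT (fun q : T' => tnth (q : T).2.1 i).
  move=> _ D mD; rewrite setTI.
  rewrite (_ : _ @^-1` _ = rect setT (fun j => if j == i then D else setT) (fun=> setT)).
    by apply: pre => // j; case: ifP.
  rewrite predeqE => q; split => [Dq|[_ /(_ i)]]; last by rewrite eqxx.
  by split => // j; case: eqP => // ->.
have m3 o : measurable_fun setT (fun q : T' => noise_coord o (q : T)).
  move=> _ D mD; rewrite setTI.
  rewrite (_ : _ @^-1` _ = rect setT (fun=> setT) (fun j => if j == o then D else setT)).
    by apply: pre => // j; case: ifP.
  rewrite predeqE => q; split => [Dq|[_ _ /(_ o)]]; last by rewrite eqxx.
  by split => // j; case: eqP => // ->.
have m21 : measurable_fun setT (fun q : T' => (q : T).2.1).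
  by apply/measurable_fun_tnthP => i; exact: m2.
have m22 : measurable_fun setT (fun q : T' => (q : T).2.2).
  apply/measurable_fun_tnthP => o.
  rewrite (_ : _ \o _ = fun q : T' => noise_coord o (q : T) +
      (@Xfull R L G ng *m tcol (q : T).2.1) o 0); last first.
    by apply/funext => q; rewrite /= /noise_coord subrK.
  apply: measurable_funD; first exact: m3.
  by apply: vmeasurable_mul; apply: vmeasurable_tcol.
have mid : measurable_fun setT (fun q : T' => (q : T)).
  rewrite (_ : (fun q : T' => _) = fun q : T' => ((q : T).1, ((q : T).2.1, (q : T).2.2))).
    by apply: measurable_fun_pair => //; exact: measurable_fun_pair.
  by apply/funext => -[? []].
by move=> A mA; rewrite -[X in <<s _ >> X]setTI; exact: mid.
Qed.

Lemma indic_rect D B C (q : T) : \1_(rect D B C) q = \1_D q.1 *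
  \prod_i \1_(B i) (tnth q.2.1 i) * \prod_o \1_(C o) (noise_coord o q) :> R.
Proof.
rewrite rectE -mulrA !indicI/=; congr (_ * _).
rewrite (indic_bigcap_seq R (enum 'I_p) (fun i => [set q : T | B i (tnth q.2.1 i)])).
rewrite (indic_bigcap_seq R (enum 'I_n) (fun o => [set q : T | C o (noise_coord o q)])).
by rewrite !big_enum.
Qed.

Lemma noise_coordE v w o : v \in tree J ->
  noise_coord o (node_obs v w) = u v (enum_val o) w.
Proof.
move=> vt; rewrite /noise_coord /= tnth_mktuple (data_eq model)//.
have -> : tcol (coef_tuple G z beta v w) = \col_i cf (v, coef_key i) w.
  by apply/matrixP => i j; rewrite !mxE coef_tuple_coef.
rewrite (Xfull_mul (f := fun c => cf (v, c) w) o).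
  by rewrite /coef/= addrC addKr.
by move=> l; rewrite /coef/= (beta1 model).
Qed.

Lemma coef_prior_active v w x i : H v w = x ->
  coef_prior h S Rh sig2 (v, coef_key i) w =
  normal_law 0 ((active x i)%:R * (sig2 v w / prior_prec G h v.1 0 i)).
Proof.
move=> <-; rewrite prior_prec_key /coef_prior /active /=.
case: (coef_key i) => [[l g]|] /=; congr (normal_law _ _).
  by rewrite ffunE -mulrA [upsilon_at _ _ _ * _]mulrC.
by rewrite -mulrA [tau_at _ _ * _]mulrC.
Qed.

Lemma prod_coef_idx (F : option ('I_L * nat) -> R) :
  \prod_(c <- coef_idx G) F c = \prod_(i < p) F (coef_key i).
Proof. by rewrite (perm_big _ (@perm_coef_key L G)) big_map big_enum. Qed.

Let sig2_kernel : {measure set R -> \bar R} :=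
  weighted lebR (fun s => igpdf_ge0 (nu h * sigma02 h) s shape_gt1)
    (measurable_igpdf (nu h + 1) (@measurable_cst _ _ _ _ setT (nu h * sigma02 h))
      (@measurable_id _ _ setT)).

Let sig2_kernelE A : measurable A ->
  sig2_kernel A = inv_gamma (nu h + 1) (nu h * sigma02 h) A.
Proof.
move=> mA; rewrite inv_gammaE ?shape_gt1// /sig2_kernel /= /weighted integral_mkcond.
apply: eq_integral => s _.
by rewrite patchE indicE; case: ifPn => _; rewrite ?mulr1 ?mulr0.
Qed.

Let sig2_kernelT : sig2_kernel setT = 1%E.
Proof.
rewrite /sig2_kernel /= /weighted integral_igpdf ?shape_gt1 ?scale_gt0//.
Qed.

(** The variances are independent of each other and jointly of the hidden states, so
    [integral_prod_indep] applies under P restricted to the configuration event, with constant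
    [prior x]. *)
Lemma integral_sig2 (x : node -> state L) (phi : node -> R -> R) :
  (forall v s, 0 <= phi v s <= 1) -> (forall v, measurable_fun setT (phi v)) ->
  (\int[P]_w (\1_(Hev x) w * \prod_(v <- tree J) phi v (sig2 v w))%:E =
   (prior x * \prod_(v <- tree J) fine (\int[lebR]_s
     (igpdf (nu h + 1) (nu h * sigma02 h) s * phi v s)%:E))%:E)%E.
Proof.
move=> phi01 mphi.
have phi0 v s : 0 <= phi v s by case/andP: (phi01 v s).
have mHev : measurable (Hev x).
  by apply: measurable_bigcap_seq => v _; exact: measurable_hidden.
have h0 w : 0 <= \1_(Hev x) w :> R by rewrite indicE.
have mh : measurable_fun setT (\1_(Hev x) : Omega -> R) by exact: measurable_indic.
have kerE v : (\int[sig2_kernel]_s (phi v s)%:E =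
    \int[lebR]_s (igpdf (nu h + 1) (nu h * sigma02 h) s * phi v s)%:E)%E.
  rewrite integral_weighted//; last 2 first.
  - by move=> s; rewrite lee_fin.
  - exact/measurable_EFinP.
  by apply: eq_integral => s _; rewrite -EFinM mulrC.
transitivity (\int[weighted P h0 mh]_w (\prod_(v <- tree J) phi v (sig2 v w))%:E)%E.
  rewrite integral_weighted//; last 2 first.
  - by move=> w; rewrite lee_fin prodr_ge0.
  - apply/measurable_EFinP/measurable_prod => v _.
    by apply: measurableT_comp => //; exact: measurable_funPT.
  by apply: eq_integral => w _; rewrite -EFinM mulrC.
under [in RHS]eq_bigr do rewrite -kerE.
apply: (integral_prod_indep (C := measurable) (Y := sig2) (Q := fun=> sig2_kernel)) => //.
- by move=> A B; exact: measurableI.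
- by move=> _; rewrite sig2_kernelT ltry.
- exact: tree_uniq.
- by rewrite -lee_fin -hidden_prior.
- move=> v; rewrite (@le_lt_trans _ _ 1%E) ?ltry// -[leRHS]sig2_kernelT.
  rewrite -[leRHS]mul1e -[leRHS]integral_cst//; apply: ge0_le_integral => //.
  + by move=> s _; rewrite lee_fin.
  + exact/measurable_EFinP.
  + by move=> s _; rewrite lee_fin; case/andP: (phi01 v s).
move=> A mA.
have mK : measurable [set w | forall v, v \in tree J -> A v (sig2 v w)].
  by apply: measurable_bigcap_seq => v _; apply: measurable_funPTI.
rewrite [LHS](_ : _ = P (Hev x `&` [set w | forall v, v \in tree J -> A v (sig2 v w)])); last first.
  by rewrite /= /weighted integral_indic.
pose E o := if o is Some v then sig2 v @^-1` A v else Hev x.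
have EE : Hev x `&` [set w | forall v, v \in tree J -> A v (sig2 v w)] =
    \bigcap_(o in [set` None :: [seq Some v | v <- tree J]]) E o.
  rewrite predeqE => w; split => [[hx hA] [v|] //|hE].
  - move=> vin; have {vin} : Some v \in None :: [seq Some v | v <- tree J] := vin.
    by rewrite in_cons => /predU1P[//|/mapP[v' vt [->]]]; exact: hA.
  - split; first by apply: (hE None); exact: mem_head.
    move=> v vt; apply: (hE (Some v)).
    change (is_true (Some v \in None :: [seq Some v | v <- tree J])).
    by rewrite in_cons map_f// orbT.
rewrite EE -[LHS]fineK; last first.
  rewrite fin_num_measure// -EE; exact: measurableI.
congr (_%:E); rewrite (sig2_indep model) => [|o].
  rewrite big_cons big_map /= hidden_prior; congr (_ * _).
  by apply: eq_big_seq => v vt; rewrite (sig2_law model)// sig2_kernelE.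
rewrite inE => /predU1P[->|/mapP[v vt ->]] /=.
  by apply: gsigma_bigcap_seq => v vt; exact: gsigma_hidden.
by apply: gsigma_preimage => //; exact: sub_sigma_algebra.
Qed.

(** A rectangle restricts states and variances, coefficients, and noise separately. Conditioning
    replaces the noise and then the coefficients by normal probabilities that depend on the
    variances only; [integral_sig2] integrates these, and [nodeQ_rect] recognises the node law. *)
Lemma node_joint (x : node -> state L) (A : node -> set T) : (forall v, rects (A v)) ->
  P (Hev x `&` [set w | forall v, v \in tree J -> A v (node_obs v w)]) =
  (prior x * \prod_(v <- tree J) fine (node_law v (x v) (A v)))%:E.
Proof.
move=> /boolp.choice[t tA].
pose D v := (t v).1.1; pose B v := (t v).1.2; pose C v := (t v).2.
have mD v : measurable (D v) by case: (tA v).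
have mB v i : measurable (B v i) by have [_ h1 _ _] := tA v; exact: h1.
have mC v o : measurable (C v o) by have [_ _ h1 _] := tA v; exact: h1.
have AE v : A v = rect (D v) (B v) (C v) by case: (tA v).
pose fB v s := \prod_i fine (normal_law 0 ((active (x v) i)%:R * (s / prior_prec G h v.1 0 i)) (B v i)).
pose fC v s := \prod_o fine (normal_law 0 s (C v o)).
pose phi v s := \1_(D v) s * fB v s * fC v s.
have law01 m s (X : set R) : measurable X -> 0 <= fine (normal_law m s X) <= 1.
  move=> mX; rewrite fine_ge0 ?normal_law_ge0//= -lee_fin fineK ?normal_law_fin//.
  exact: normal_law_le1.
have fB01 v s : 0 <= fB v s <= 1.
  apply/andP; split; last by apply: prodr_ile1 => i _; exact: law01.
  by apply: prodr_ge0 => i _; rewrite fine_ge0 ?normal_law_ge0.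
have fC01 v s : 0 <= fC v s <= 1.
  apply/andP; split; last by apply: prodr_ile1 => i _; exact: law01.
  by apply: prodr_ge0 => i _; rewrite fine_ge0 ?normal_law_ge0.
have phi01 v s : 0 <= phi v s <= 1.
  have /andP[? ?] := fB01 v s; have /andP[? ?] := fC01 v s.
  rewrite /phi indicE; case: (_ \in _); rewrite ?mul1r ?mul0r ?lexx ?ler01//.
  by rewrite mulr_ge0//= mulr_ile1.
have mlaw d' (O : measurableType d') (f : O -> R) X : measurable_fun setT f -> measurable X ->
    measurable_fun setT (fun w => fine (normal_law 0 (f w) X)).
  move=> mf mX; apply: (measurableT_comp (fine_measurable measurableT)).
  exact: measurable_normal_law.
have mfB v : measurable_fun setT (fB v).
  apply: measurable_prod => i _; apply: mlaw => //.
  by apply: measurable_funM => //; exact: measurable_funM.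
have mfC d' (O : measurableType d') v (f : O -> R) : measurable_fun setT f ->
    measurable_fun setT (fun w => fC v (f w)).
  by move=> mf; apply: measurable_prod => o _; exact: mlaw.
have mphi v : measurable_fun setT (phi v).
  apply: measurable_funM; last exact: mfC.
  by apply: measurable_funM => //; exact: measurable_indic.
transitivity (\int[P]_w (\1_(Hev x) w * \prod_(v <- tree J) phi v (sig2 v w))%:E)%E; last first.
  rewrite integral_sig2//; congr ((_ * _)%:E); apply: eq_bigr => v _.
  rewrite -(nodeQ_rect (nu h * sigma02 h) (prior_prec_gt0 h_valid v.1) shape_gt1
    (XmatE ng (x v)) (mD v) (mB v) (mC v)).
  rewrite -[in RHS](setIT (A v)) -integral_indic//; last first.
    exact: rects_measurable (ex_intro _ _ (tA v)).
  by congr fine; apply: eq_integral => q _; rewrite AE indic_rect.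
(* The sets indexed by columns are transported to coefficient names; a name outside the image of
   [coef_key] gets no constraint. *)
pose B' (i : node * option ('I_L * nat)) : set R :=
  if [pick k | coef_key k == i.2] is Some k then B i.1 k else setT.
have mB' i : measurable (B' i) by rewrite /B'; case: pickP.
have B'E v k : B' (v, coef_key k) = B v k.
  rewrite /B' /=; case: pickP => [k' /eqP/coef_key_inj -> //|/(_ k)].
  by rewrite eqxx.
pose C' (i : node * obs ng) := C i.1 (enum_rank i.2).
pose F1 := Hev x `&` [set w | forall v, v \in tree J -> D v (sig2 v w)].
pose FB := [set w | forall i, i \in [seq (v, c) | v <- tree J, c <- coef_idx G] -> B' i (cf i w)].
pose FC := [set w | forall i, i \in [seq (v, o) | v <- tree J, o <- enum {: obs ng}] -> C' i (u i.1 i.2 w)].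
have setE : Hev x `&` [set w | forall v, v \in tree J -> A v (node_obs v w)] = (F1 `&` FB) `&` FC.
  rewrite predeqE => w; split => [[hx hA]|[[[hx hD] hB] hC]].
    split; [split; [split => // v vt|]|].
    - by have := hA v vt; rewrite AE => -[].
    - move=> _ /allpairsPdep[v [c [vt + ->]]].
      rewrite (perm_mem (@perm_coef_key L G)) => /mapP[k _ ->]; rewrite B'E -coef_tuple_coef.
      by have := hA v vt; rewrite AE => -[_ + _]; exact.
    - move=> _ /allpairsPdep[v [ob [vt _ ->]]]; rewrite /C' /=.
      have := hA v vt; rewrite AE => -[_ _ /(_ (enum_rank ob))].
      by rewrite -/(noise_coord _ _) noise_coordE// enum_rankK.
  split => // v vt; rewrite AE; split; first exact: hD.
  - move=> k; rewrite coef_tuple_coef -B'E; apply: hB; apply/allpairsPdep.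
    exists v; exists (coef_key k); split => //.
    by rewrite (perm_mem (@perm_coef_key L G)) map_f// mem_enum.
  - move=> o; rewrite -/(noise_coord _ _) noise_coordE//.
    have oi : (v, enum_val o) \in [seq (v, o) | v <- tree J, o <- enum {: obs ng}].
      by apply/allpairsPdep; exists v; exists (enum_val o); split => //; rewrite mem_enum.
    by have := hC _ oi; rewrite /C'/= enum_valK.
pose G1 := gen_hidden S Rh (tree J) `|` genfam (tree J) sig2.
have G1m : G1 `<=` measurable.
  move=> F [|]; first exact: gen_hidden_measurable.
  by apply: genfam_measurable => v; exact: measurable_funPT.
have F1G : <<s G1 >> F1.
  apply: (@measurableI _ (g_sigma_algebraType G1)).
    apply: gsigma_bigcap_seq => v vt; apply: (@sub_sigma_algebra2 _ setT G1 (gen_hidden S Rh (tree J))).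
      exact: subsetUl.
    exact: gsigma_hidden.
  apply: gsigma_bigcap_seq => v vt; apply: (gsigma_preimage (f := sig2 v)) => //.
  apply: subset_trans (@sub_sigma_algebra _ setT _).
  by apply: subset_trans (@subsetUr _ _ _); exact: (genfam_gen (f := sig2) vt).
have mF1 := sigma_sub_measurable G1m F1G.
have mFB : measurable FB.
  by apply: measurable_bigcap_seq => i _; rewrite -[X in measurable X]setTI; exact: measurable_coef.
have mFC : measurable FC.
  by apply: measurable_bigcap_seq => i _; apply: (measurable_funPTI (u i.1 i.2)); exact: mC.
pose hu w := \prod_(v <- tree J) fC v (sig2 v w).
have hu0 w : 0 <= hu w by apply: prodr_ge0 => v _; case/andP: (fC01 v (sig2 v w)).
have mhu : measurable_fun setT (hu : g_sigma_algebraType G1 -> R).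
  apply: measurable_prod => v vt; apply: mfC; apply: measurable_fun_gen.
  apply: subset_trans (@sub_sigma_algebra _ setT _).
  by apply: subset_trans (@subsetUr _ _ _); exact: (genfam_gen (f := sig2) vt).
have mhu' := measurable_fun_gsigma G1m mhu.
have huE w : \prod_(i <- [seq (v, o) | v <- tree J, o <- enum {: obs ng}])
    fine (normal_law 0 (sig2 i.1 w) (C' i)) = hu w.
  rewrite big_allpairs_dep/=; apply: eq_bigr => v _.
  rewrite big_enum big_enum_val/=; apply: eq_bigr => o _.
  by rewrite /C'/= enum_valK.
have mF1B : measurable (F1 `&` FB) by exact: measurableI.
(* Given everything else, the noise event has probability [hu], a function of the variances. *)
have [_ noise] := noise_law model (B := C') (fun i => mC i.1 (enum_rank i.2)).
rewrite setE noise; last first.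
  apply: (@measurableI _ (g_sigma_algebraType (G1 `|` gen_coef G z beta (tree J)))).
    by move: F1G; apply: sub_sigma_algebra2; exact: subsetUl.
  apply: gsigma_bigcap_seq => i it; apply: (gsigma_preimage (f := cf i)) => //.
  apply: subset_trans (@sub_sigma_algebra _ setT _).
  by apply: subset_trans (@subsetUr _ _ _); exact: (genfam_gen (f := cf) it).
under eq_integral do rewrite huE.
rewrite integral_indicM//.
pose fcoef w := \prod_(i <- [seq (v, c) | v <- tree J, c <- coef_idx G])
  fine (coef_prior h S Rh sig2 i w (B' i)).
have fcoef0 w : 0 <= fcoef w.
  apply: prodr_ge0 => -[v [[l g]|]] _; rewrite /coef_prior/=.
    by rewrite fine_ge0 ?normal_law_ge0.
  by rewrite fine_ge0 ?normal_law_ge0.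
transitivity (\int[P]_w ((\1_F1 w * hu w) * \1_FB w)%:E)%E.
  by apply: eq_integral => w _; rewrite indicI/=; congr (_%:E); ring.
have m1F : measurable_fun setT (\1_F1 : g_sigma_algebraType G1 -> R).
  exact: (@measurable_indic _ (g_sigma_algebraType G1)).
(* As [hu] is measurable for states and variances, it is an admissible test function when the
   coefficients are conditioned on these. *)
rewrite (cond_prob_integral (f := fcoef) G1m mFB fcoef0); last 3 first.
- exact: (coef_law model mB').
- by move=> w; rewrite indicE mulr_ge0.
- exact: (measurable_funM m1F mhu).
apply: eq_integral => w _; congr (_%:E).
rewrite /F1 indicI/= (indic_bigcap_seq R (tree J) (fun v => sig2 v @^-1` D v)).
rewrite [\1_(Hev x) w]indicE; case: (boolP (w \in _)) => [/set_mem hx|_]; last by rewrite !mul0r.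
rewrite !mul1r (_ : fcoef w = \prod_(v <- tree J) fB v (sig2 v w)); last first.
  rewrite /fcoef big_allpairs_dep/=; apply: eq_big_seq => v vt.
  rewrite prod_coef_idx; apply: eq_bigr => k _.
  by rewrite B'E (coef_prior_active _ (hx v vt)).
by rewrite /hu -!big_split/=; apply: eq_bigr => v _; rewrite /phi mulrAC.
Qed.

End model_law.

(** * The posterior *)

Section posterior.
Context {R : realType} {d : measure_display} {Omega : measurableType d}.
Variable P : probability Omega R.
Variables (J L : nat) (G : 'I_L -> nat) (ng : combo G -> nat) (h : hyper R L).
Variables (S : node -> {RV P >-> bool}) (Rh : 'I_L -> node -> {RV P >-> bool})
  (sig2 z : node -> {RV P >-> R}) (beta : 'I_L -> nat -> node -> {RV P >-> R})
  (u data : node -> obs ng -> {RV P >-> R}).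
Hypotheses (h_valid : valid_hyper J h) (model : NIG_MG J h S Rh sig2 z beta u data).

Local Notation H := (hidden S Rh).
Local Notation D := (data_vec data).
Local Notation GD := (gen_data J data).
Local Notation GH := (gen_hidden S Rh).
Local Notation p := (ncoef G).
Local Notation n := (nobs ng).
Local Notation T := (R * (p.-tuple R * n.-tuple R))%type.
Local Notation W := (node_obs sig2 z beta data).
Local Notation a := (nu h + 1).
Local Notation b := (nu h * sigma02 h).
Local Notation X := (@Xmat R L G ng).
Local Notation lam v := (prior_prec G h v.1).
Local Notation Q := (node_law ng h_valid).
Local Notation dt := (data_tuple data).

Let a1 : 1 < a := shape_gt1 h_valid.
Let b0 : 0 < b := scale_gt0 h_valid.
Let lam0 (v : node) := prior_prec_gt0 h_valid (G := G) v.1.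
Let x0 : node -> state L := fun=> (false, [ffun=> false]).

Let joint := node_joint h_valid model.
Let mH : forall v e, measurable [set w | H v w = e] := measurable_hidden S Rh.
Let mW : forall v, measurable_fun setT (W v) := measurable_node_obs sig2 z beta data.

Let prior_ge0 (x : node -> state L) : 0 <= MT_prob J (prior_init h) (prior_trans h) x.
Proof. by rewrite -lee_fin -(hidden_prior model). Qed.

(** The rectangle without constraints in [nodeQ_rect] reduces the total mass to that of the inverse
    gamma law. *)
Let Q_lty v e : (Q v e setT < +oo)%E.
Proof.
suff -> : Q v e setT = 1%E by exact: ltry.
rewrite -[setT]setIT -integral_indic//.
transitivity (\int[Q v e]_q (\1_setT q.1 * \prod_(i < p) \1_setT (tnth q.2.1 i) *
    \prod_(o < n) \1_setT (tnth q.2.2 o - (@Xfull R L G ng *m tcol q.2.1) o 0)%R)%:E)%E.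
  apply: eq_integral => q _; congr (_%:E).
  have i1 (U : Type) (x : U) : \1_[set: U] x = 1 :> R by rewrite indicE in_setT.
  rewrite !i1 mul1r big1 => [|i _]; last exact: i1.
  by rewrite mul1r big1// => i _; exact: i1.
rewrite (nodeQ_rect b (lam0 v) a1 (XmatE ng e))//.
rewrite -(integral_igpdf a1 b0); apply: eq_integral => s _; congr (_%:E).
rewrite indicT mul1r big1 => [|i _]; last by rewrite normal_lawT.
by rewrite mul1r big1 ?mulr1// => i _; rewrite normal_lawT.
Qed.

(** Node events about the data only; [D2] adds the variance, for the conditioning in (iii). *)
Let D1 : set (set T) := [set B | exists2 C : set (n.-tuple R), measurable C &
  B = [set q | C q.2.2]].
Let D2 : set (set T) := [set B | exists A : set R, exists C : set (n.-tuple R),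
  [/\ measurable A, measurable C & B = [set q | A q.1 /\ C q.2.2]]].

Let D12 : D1 `<=` D2.
Proof.
move=> _ [C mC ->]; exists setT; exists C; split => //.
by rewrite predeqE => q; split => [|[]].
Qed.

Let D2m : D2 `<=` measurable.
Proof.
move=> _ [A [C [mA mC ->]]]; apply: measurableI; rewrite -[X in measurable X]setTI.
  exact: measurable_fst.
exact: (measurableT_comp measurable_snd measurable_snd).
Qed.

Let D1m : D1 `<=` measurable. Proof. by move=> B /D12/D2m. Qed.

Let D1I : setI_closed D1.
Proof. by move=> _ _ [C1 m1 ->] [C2 m2 ->]; exists (C1 `&` C2) => //; exact: measurableI. Qed.

Let D2I : setI_closed D2.
Proof.
move=> _ _ [A1 [C1 [mA1 mC1 ->]]] [A2 [C2 [mA2 mC2 ->]]].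
exists (A1 `&` A2); exists (C1 `&` C2); split; [exact: measurableI..|].
by rewrite predeqE => q; split => [[[? ?] [? ?]]|[[? ?] [? ?]]].
Qed.

Let D1T : D1 setT. Proof. by exists setT. Qed.
Let D2T : D2 setT. Proof. exact: D12. Qed.

Let data_set F : GD F -> exists v, exists2 C : set (n.-tuple R),
  v \in tree J /\ measurable C & F = [set w | C (dt v w)].
Proof.
move=> [i /allpairsPdep[v [ob [vt _ ->]]] [A mA <-]].
exists v; exists [set t | A (tnth t (enum_rank ob))].
  split => //; rewrite -[X in measurable X]setTI.
  exact: (measurable_tnth (enum_rank ob)).
by rewrite setTI predeqE => w; rewrite /mkset /= tnth_mktuple enum_rankK.
Qed.

Let GDm : GD `<=` measurable.
Proof. by apply: genfam_measurable => -[v o]; exact: measurable_funPT. Qed.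

Let shape_data F : GD F -> exists2 B : node -> set T, (forall v, D1 (B v)) &
  F = [set w | forall v, v \in tree J -> B v (W v w)].
Proof.
move=> /data_set[v [C [vt mC] ->]].
exists (fun v' => [set q | if v' == v then C q.2.2 else True]).
  move=> v'; case: (v' == v); [by exists C|by exists setT].
rewrite predeqE => w; split=> [Cw v' _|/(_ v vt)] /=; last by rewrite eqxx.
by case: eqP => // ->.
Qed.

Let shape (DD : set (set T)) F := exists Z : node -> set (state L),
  exists2 B : node -> set T, (forall v, DD (B v)) &
  F = [set w | forall v, v \in tree J -> Z v (H v w) /\ B v (W v w)].

Let shape_GD DD F : D1 `<=` DD -> GD F -> shape DD F.
Proof.
move=> sub /shape_data[B DB ->]; exists (fun=> setT); exists B; first by move=> v; exact: sub.
by rewrite predeqE => w; split => h1 v vt; [split => //|]; have := h1 v vt => // -[].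
Qed.

Let hidden_set s F : GH s F -> exists2 v, v \in s & exists Z, F = H v @^-1` Z.
Proof.
case=> [[v vs]|[l _ [v vs]]] [A _ <-]; exists v => //; rewrite setTI.
  by exists [set e | A e.1].
by exists [set e : state L | A (e.2 l)]; rewrite predeqE => w; rewrite /= ffunE.
Qed.

Let shape_GH (DD : set (set T)) s F : {subset s <= tree J} -> DD setT -> GH s F -> shape DD F.
Proof.
move=> st DDT /hidden_set[v /st vt [Z ->]].
exists (fun v' => if v' == v then Z else setT); exists (fun=> setT) => //.
rewrite predeqE => w; split=> [Zw v' _|/(_ v vt)[]]; last by rewrite eqxx.
by split => //; case: eqP => // ->.
Qed.

Let shape_sig2 v F : v \in tree J -> gen (sig2 v) F -> shape D2 F.
Proof.
move=> vt [A mA <-]; rewrite setTI; exists (fun=> setT).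
exists (fun v' => [set q | if v' == v then A q.1 else True]).
  move=> v'; case: (v' == v); last exact: D2T.
  by exists A; exists setT; split => //; rewrite predeqE => q; split => [|[]].
rewrite predeqE => w; split=> [Aw v' _|/(_ v vt)[_]] /=; last by rewrite eqxx.
by split => //; case: eqP => // ->.
Qed.

Let data_tuple_GD v : v \in tree J ->
  measurable_fun setT (dt v : g_sigma_algebraType GD -> n.-tuple R).
Proof.
move=> vt; apply/measurable_fun_tnthP => i.
rewrite (_ : _ \o _ = data v (enum_val i)); last first.
  by apply/funext => w; rewrite /= tnth_mktuple.
apply: measurable_fun_gen; apply: subset_trans (@sub_sigma_algebra _ setT _).
apply: (genfam_gen (f := fun i => data i.1 i.2) (i := (v, enum_val i))).
by apply/allpairsPdep; exists v; exists (enum_val i); split => //; rewrite mem_enum.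
Qed.

Lemma marg_lik_gt0 j (dv : 'cV[R]_n) (x : state L) : 0 < marg_lik h j dv x.
Proof.
have -> : dv = tcol [tuple dv i 0 | i < n].
  by apply/matrixP => i k; rewrite mxE tnth_mktuple (ord1 k).
rewrite marg_likE; apply: marg_gt0 => // i; exact: (prior_prec_gt0 h_valid).
Qed.

Let measurable_marg_lik v x : v \in tree J ->
  measurable_fun setT ((fun w => marg_lik h v.1 (D w v) x) : g_sigma_algebraType GD -> R).
Proof.
move=> vt.
rewrite (_ : (fun w => _) = fun w => marg (X x) (lam v) a b (dt v w)); last first.
  by apply/funext => w; rewrite -marg_likE tcol_data_tuple.
apply: measurable_marg; exact: data_tuple_GD.
Qed.

(** The relation between level and depth keeps the recursion inside the tree, where the data are
    measurable for [GD]. *)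
Let measurable_phi_rec i v x : v \in tree J -> (v.1 + i = J)%N ->
  measurable_fun setT ((fun w => phi_rec h i (D w) v x) : g_sigma_algebraType GD -> R).
Proof.
elim: i v x => [|i IH] v x vt vi /=; first exact: measurable_marg_lik.
have vJ : (v.1 < J)%N by rewrite -vi addnS ltnS leq_addr.
have [lt rt] := child_tree vt vJ.
apply: measurable_funM; first apply: measurable_funM.
- exact: measurable_marg_lik.
- apply: measurable_sum => y; apply: measurable_funM => //.
  by apply: IH => //; rewrite /= addSnnS.
- apply: measurable_sum => y; apply: measurable_funM => //.
  by apply: IH => //; rewrite /= addSnnS.
Qed.

Let measurable_phi v x : v \in tree J ->
  measurable_fun setT ((fun w => phi J h (D w) v x) : g_sigma_algebraType GD -> R).
Proof.
move=> vt; apply: measurable_phi_rec => //; apply: subnKC.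
by move: vt; rewrite mem_tree => /andP[].
Qed.

Let measurable_xi v x : v \in tree J ->
  measurable_fun setT ((fun w => xi J h (D w) v x) : g_sigma_algebraType GD -> R).
Proof.
move=> vt; rewrite /xi; case: (0 < v.1)%N; apply: measurable_sum => y;
  by apply: measurable_funM => //; exact: measurable_phi.
Qed.

Let q0_prob w := post_init_prob h_valid marg_lik_gt0 (D w).
Let q_prob w v (vt : v \in tree J) (v0 : (0 < v.1)%N) e :=
  post_trans_prob h_valid marg_lik_gt0 (D w) e vt v0.

Let mq0 e : measurable_fun setT
  ((fun w => post_init J h (D w) e) : g_sigma_algebraType GD -> R).
Proof.
apply: measurable_funM => //; apply: measurable_div.
  by apply: measurable_phi; exact: root_tree.
by apply: measurable_xi; exact: root_tree.
Qed.

Let mq v e e' : v \in tree J -> (0 < v.1)%N -> measurable_fun setT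
  ((fun w => post_trans J h (D w) v e e') : g_sigma_algebraType GD -> R).
Proof.
move=> vt v0; apply: measurable_funM => //.
by apply: measurable_div; [exact: measurable_phi|exact: measurable_xi].
Qed.

Let M (v : node) (e : state L) (q : T) : R := marg (X e) (lam v) a b q.2.2.

Let M0 v e q : 0 <= M v e q.
Proof. by apply: ltW; apply: marg_gt0 => //; exact: lam0. Qed.

Let mM v e : measurable_fun setT (M v e).
Proof. by apply: measurable_marg; exact: (measurableT_comp measurable_snd measurable_snd). Qed.

Let Mfin v e e' : (\int[Q v e']_q (M v e q)%:E < +oo)%E.
Proof.
set K := (b `^ a * gamma_fun (a + n%:R / 2)) / ((2 * pi) `^ (n%:R / 2) * gamma_fun a)
  * (Num.sqrt (\det (diag_mx (lam v))) / Num.sqrt (\det (prec (X e) (lam v))))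
  * b `^ (- (a + n%:R / 2)).
apply: (@le_lt_trans _ _ (K%:E * Q v e' setT)%E).
  rewrite -integral_cst//; apply: ge0_le_integral => //.
  - by move=> q _; rewrite lee_fin.
  - exact/measurable_EFinP.
  - by move=> q _; rewrite lee_fin; apply: marg_le => //; exact: lam0.
have Qf : Q v e' setT \is a fin_num by rewrite ge0_fin_numE.
by rewrite -(fineK Qf) -EFinM ltry.
Qed.

(** In state [e'] the data of the node have density [M v e'], so both sides integrate
    [M v e * M v e'] over the same data set. *)
Let Msym v e e' B : D1 B ->
  (\int[Q v e']_q (\1_B q * M v e q)%:E = \int[Q v e]_q (\1_B q * M v e' q)%:E)%E.
Proof.
move=> [C mC ->].
have mm f : measurable_fun setT (fun y => \1_C y * marg (X f) (lam v) a b y).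
  by apply: measurable_funM; [exact: measurable_indic|exact: measurable_marg].
have mm0 f y : 0 <= \1_C y * marg (X f) (lam v) a b y.
  by rewrite indicE mulr_ge0//; apply: ltW; apply: marg_gt0 => //; exact: lam0.
transitivity (\int[Q v e']_q ((\1_C q.2.2 * marg (X e) (lam v) a b q.2.2)%R)%:E)%E.
  by apply: eq_integral => q _; rewrite !indicE.
etransitivity; first exact: (integral_nodeQ_data (lam0 v) a1 b0 (X e') (active e') (mm0 e) (mm e)).
transitivity (\int[Q v e]_q ((\1_C q.2.2 * marg (X e') (lam v) a b q.2.2)%R)%:E)%E; last first.
  by apply: eq_integral => q _; rewrite !indicE.
etransitivity; last first.
  exact/esym/(integral_nodeQ_data (lam0 v) a1 b0 (X e) (active e) (mm0 e') (mm e')).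
have cA (r s t : R) : r * (s * t) = t * (s * r) by ring.
by apply: eq_integral => y _; exact: (congr1 EFin (cA _ _ _)).
Qed.

Let post x w := MT_prob J (post_init J h (D w)) (post_trans J h (D w)) x.
Let Z w := xi J h (D w) rootn (false, [ffun=> false]).

Let Z0 w : 0 < Z w.
Proof. exact: (xi_gt0 h_valid marg_lik_gt0 _ _ (root_tree J)). Qed.

Let post0 x w : 0 <= post x w.
Proof.
rewrite /post MT_probE /MT_prefix big_seq; apply: prodr_ge0 => v vt; rewrite /MT_factor.
case: ifPn => v0; last exact: (proj1 (q0_prob w)).
exact: (proj1 (q_prob w vt v0 _)).
Qed.

Let mpost x : measurable_fun setT (post x : g_sigma_algebraType GD -> R).
Proof.
rewrite (_ : post x = fun w => MT_prefix (post_init J h (D w)) (post_trans J h (D w)) (tree J) x).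
  apply: measurable_prod => v vt; rewrite /MT_factor.
  by case: (boolP (0 < v.1)%N) => v0; [exact: mq|exact: mq0].
by apply/funext => w; rewrite /post MT_probE.
Qed.

Let mZ : measurable_fun setT (Z : g_sigma_algebraType GD -> R).
Proof. by apply: measurable_xi; exact: root_tree. Qed.

Let postZ x w : post x w * Z w = MT_prob J (prior_init h) (prior_trans h) x *
  \prod_(v <- tree J) M v (x v) (W v w).
Proof.
have ME v : marg_lik h v.1 (D w v) (x v) = M v (x v) (W v w).
  by rewrite -tcol_data_tuple; exact: marg_likE.
rewrite [LHS](post_MT_prob h_valid marg_lik_gt0 (D w) x).
exact: (congr1 (fun r => _ * r) (eq_bigr _ (fun v _ => ME v))).
Qed.

Let post1 w : csum (tree J) (fun x => post x w) x0 = 1.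
Proof. by apply: (csum_MT (q0_prob w)) => v vt v0 e; exact: (q_prob w vt v0). Qed.

Let q_prob' w v : v \in tree J -> (0 < v.1)%N -> forall e, prob_vec (post_trans J h (D w) v e).
Proof. by move=> vt v0 e; exact: q_prob. Qed.

Let cond_prefix s1 s2 x (e : tree J = s1 ++ s2) :=
  cond_prob_prefix mH mW prior_ge0 Q_lty (@rects_measurable R L G ng)
    (@rects_setI R L G ng) (@rects_setT R L G ng) (@rects_generate R L G ng) joint
    D1m D1I D1T GDm shape_data M0 mM Mfin Msym Z0 post0 mpost mZ postZ post1
    (q0 := fun w => post_init J h (D w)) (q := fun w => post_trans J h (D w))
    q0_prob q_prob' mq0 mq (fun x w => erefl) x e.

Lemma posterior_MT : cond_is_MT P GD J (fun w => post_init J h (D w))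
  (fun w => post_trans J h (D w)) H.
Proof.
move=> x; have := cond_prefix x (esym (cats0 (tree J))).
rewrite (_ : (fun w => MT_prefix _ _ _ _) = fun w => MT_prob J
  (post_init J h (D w)) (post_trans J h (D w)) x)//.
by apply/funext => w; rewrite MT_probE.
Qed.

(** The root alone is the shortest nonempty initial segment of the tree. *)
Lemma posterior_root (x : state L) :
  cond_prob P GD [set w | H rootn w = x] (fun w => post_init J h (D w) x).
Proof.
have := @cond_prefix [:: rootn] _ (fun=> x) (treeE J).
rewrite (_ : [set w | forall v, v \in [:: rootn] -> H v w = x] = [set w | H rootn w = x]).
  rewrite (_ : (fun w => MT_prefix _ _ _ _) = fun w => post_init J h (D w) x)//.
  by apply/funext => w; rewrite /MT_prefix big_seq1.
rewrite predeqE => w; split => [|h1 v]; first by apply; exact: mem_head.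
by rewrite inE => /eqP ->.
Qed.

Lemma posterior_trans v (y : state L) : v \in tree J -> (0 < v.1)%N ->
  cond_prob P (GH [:: parent v] `|` GD) [set w | H v w = y]
    (fun w => post_trans J h (D w) v (H (parent v) w) y).
Proof.
move=> vt v0.
apply: (cond_prob_trans mH mW prior_ge0 Q_lty (@rects_measurable R L G ng)
    (@rects_setI R L G ng) (@rects_setT R L G ng) (@rects_generate R L G ng) joint
    D1m D1I D1T GDm shape_data M0 mM Mfin Msym Z0 post0 mpost mZ postZ post1
    (q0 := fun w => post_init J h (D w)) (q := fun w => post_trans J h (D w))
    q0_prob q_prob' mq0 mq (fun x w => erefl)) => //.
- exact: gen_hidden_measurable.
- by move=> F /hidden_set[v' + [Z' ->]]; rewrite inE => /eqP ->; exists Z'.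
- by move=> e; apply: gsigma_hidden; exact: mem_head.
Qed.

(** * Posterior laws at the nodes and their independence *)

Section conditional_laws.
Variable s : seq node.
Hypothesis s_tree : {subset s <= tree J}.

Let GHDm : GH s `|` GD `<=` measurable.
Proof. by move=> F [/gen_hidden_measurable|/GDm]. Qed.

Let shape_GHD DD : D1 `<=` DD -> forall F, (GH s `|` GD) F -> shape DD F.
Proof.
move=> sub F [|]; last exact: shape_GD.
by apply: shape_GH => //; exact: sub.
Qed.

Let gsigma_GHD (G' : set (set Omega)) v e : GH s `<=` <<s G' >> -> v \in s ->
  <<s G' >> [set w | H v w = e].
Proof.
move=> sub vs; have : <<s GH s >> [set w | H v w = e] by exact: gsigma_hidden.
move: [set w | _].
by apply: smallest_sub => //; exact: smallest_sigma_algebra.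
Qed.

Let data_tuple_gsigma (G' : set (set Omega)) v : GD `<=` <<s G' >> -> v \in tree J ->
  measurable_fun setT (dt v : g_sigma_algebraType G' -> n.-tuple R).
Proof. by move=> sub vt; exact: (measurable_fun_gsigmaS sub (data_tuple_GD vt)). Qed.

Let pj (v : node) (e : state L) (y : n.-tuple R) (A : set (R * p.-tuple R)) : R :=
  fine (post_joint (lam v) a b (X e) (active e) y A).

Let pj01 v e y A : measurable A -> 0 <= pj v e y A <= 1.
Proof.
move=> mA; rewrite /pj fine_ge0/=; last exact: post_joint_ge0.
rewrite -lee_fin fineK; first exact: (post_joint_le1 (lam0 v) a1 b0).
exact: (post_joint_fin (lam0 v) a1 b0).
Qed.

Let measurable_pj d' (O : measurableType d') v e (f : O -> n.-tuple R) A :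
  measurable_fun setT f -> measurable A ->
  measurable_fun setT (fun q => pj v e (f q) A).
Proof.
move=> mf mA; apply: (measurableT_comp (fine_measurable measurableT)).
exact: measurable_post_joint_fun.
Qed.

Let measurable_pj_state (G' : set (set Omega)) v A : GH s `|` GD `<=` <<s G' >> ->
  v \in s -> measurable A ->
  measurable_fun setT ((fun w => pj v (H v w) (dt v w) A) : g_sigma_algebraType G' -> R).
Proof.
move=> sub vs mA.
apply: (@measurable_fun_state _ _ _ (g_sigma_algebraType G') (H v)
  (fun e w => pj v e (dt v w) A)) => e.
  by apply: gsigma_GHD => // F GF; apply: sub; left.
apply: measurable_pj => //; apply: data_tuple_gsigma; last exact: s_tree.
by move=> F GF; apply: sub; right.
Qed.

Let pair12 (q : T) : R * p.-tuple R := (q.1, q.2.1).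

Let measurable_pair12 A : measurable A -> measurable [set q | A (pair12 q)].
Proof.
move=> mA; rewrite -[X in measurable X]setTI.
have m12 : measurable_fun setT pair12.
  apply: measurable_fun_pair; first exact: measurable_fst.
  exact: (measurableT_comp measurable_fst measurable_snd).
exact: m12.
Qed.

Let pj_law v e A B : measurable A -> D1 B ->
  (\int[Q v e]_q (\1_B q * \1_[set q | A (pair12 q)] q)%:E =
   \int[Q v e]_q (\1_B q * pj v e q.2.2 A)%:E)%E.
Proof.
move=> mA [C mC ->]; etransitivity; last first.
  exact: (nodeQ_joint (lam0 v) a1 b0 (X e) (active e) mA mC).
by apply: eq_integral => q _; rewrite mulrC.
Qed.

(** The kernel involves only the state and the data of [v], so the same version serves every
    conditioning set [s] containing [v]. *)
Lemma posterior_node v A : v \in s -> measurable A ->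
  cond_prob P (GH s `|` GD) [set w | A (sig2 v w, coef_tuple G z beta v w)]
    (fun w => pj v (H v w) (dt v w) A).
Proof.
move=> vs mA.
apply: (cond_prob_node x0 mH mW prior_ge0 Q_lty (@rects_measurable R L G ng)
  (@rects_setI R L G ng) (@rects_setT R L G ng) (@rects_generate R L G ng) joint
  D1m D1I D1T GHDm (shape_GHD (fun B => id))
  (A := [set q | A (pair12 q)]) (k := fun e q => pj v e q.2.2 A)).
- exact: s_tree.
- exact: measurable_pair12.
- by move=> e q; exact: pj01.
- by move=> e; apply: measurable_pj => //; exact: (measurableT_comp measurable_snd measurable_snd).
- by apply: measurable_pj_state => //; exact: ts.
- by move=> e B; exact: pj_law.
Qed.

Lemma posterior_sig2 v : v \in s ->
  cond_law P (GH s `|` GD) (sig2 v)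
    (fun w => inv_gamma (nu h + 1 + n%:R / 2)
      (nu h * sigma02 h + Upsilon h v.1 (D w v) (H v w))).
Proof.
move=> vs B mB.
have mB' : measurable ((fst : R * p.-tuple R -> R) @^-1` B).
  by rewrite -[X in measurable X]setTI; exact: measurable_fst.
have := posterior_node vs mB'.
rewrite (_ : (fun w => pj _ _ _ _) = fun w => fine (inv_gamma (nu h + 1 + n%:R / 2)
  (nu h * sigma02 h + Upsilon h v.1 (D w v) (H v w)) B))//.
apply/funext => w; congr fine; rewrite -tcol_data_tuple.
exact: (post_joint_var b (lam0 v) a1).
Qed.

(** [coefK] is the required normal law where the variance is positive; the exceptional event is null
    because the inverse gamma law lives on positive reals. *)
Lemma posterior_coef v : v \in s -> exists K : Omega -> probability (p.-tuple R) R,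
  {ae P, forall w, is_mvnormal (mu_star h v.1 (D w v) (H v w))
     (sig2 v w *: hadamard (Mmat G (H v w))
                    (invmx (Lambda_star ng h v.1 (H v w)))) (K w)}
  /\ cond_law P (GH s `|` GD `|` gen (sig2 v)) (coef_tuple G z beta v) K.
Proof.
move=> vs; have vt := s_tree vs.
exists (fun w => coefK (lam0 v) (X (H v w)) (active (H v w)) (dt v w) (sig2 v w)); split.
  exists [set w | sig2 v w <= 0]; split.
  - by rewrite -[X in measurable X]setTI; apply: measurable_fun_le => //; exact: measurable_funPT.
  - have := sig2_law model vt (A := [set r | r <= 0]).
    rewrite /preimage/= => ->; last first.
      by rewrite -[X in measurable X]setTI; apply: measurable_fun_le.
    rewrite /inv_gamma (_ : _ `&` _ = set0) ?integral_set0//.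
    by rewrite predeqE => r; split => // -[] /=; rewrite leNgt => /negbTE ->.
  - move=> w; apply: contra_notP => /negP; rewrite -ltNge => s0.
    have [Wt WtE WE] := MmatE (R := R) G (H v w).
    rewrite /mkset WE -tcol_data_tuple.
    exact: (coefK_normal (lam0 v) (XmatE ng (H v w)) (dt v w) s0 WtE).
move=> B mB.
set G' := GH s `|` GD `|` gen (sig2 v).
have G'm : G' `<=` measurable.
  by move=> F [/GHDm//|]; apply: gen_measurable; exact: measurable_funPT.
(* Conditioning on the variance as well enlarges the class of node events from [D1] to [D2]. *)
have shapeG F : G' F -> shape D2 F.
  by move=> [|]; [exact: shape_GHD|exact: shape_sig2].
have sub : GH s `|` GD `<=` <<s G' >> by move=> F GF; apply: sub_sigma_algebra; left.
have k01 e (q : T) : 0 <= fine (coefK (lam0 v) (X e) (active e) q.2.2 q.1 B) <= 1.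
  rewrite fine_ge0//= -lee_fin fineK ?fin_num_measure//.
  exact: probability_le1.
apply: (cond_prob_node x0 mH mW prior_ge0 Q_lty (@rects_measurable R L G ng)
  (@rects_setI R L G ng) (@rects_setT R L G ng) (@rects_generate R L G ng) joint
  D2m D2I D2T G'm shapeG vt
  (A := [set q : T | B q.2.1])
  (k := fun e q => fine (coefK (lam0 v) (X e) (active e) q.2.2 q.1 B))).
- rewrite -[X in measurable X]setTI.
  exact: (measurableT_comp measurable_fst measurable_snd).
- exact: k01.
- move=> e; have m1 : measurable_fun setT (fun q : T => q.1) by exact: measurable_fst.
  have m2 : measurable_fun setT (fun q : T => q.2.2).
    exact: (measurableT_comp measurable_snd measurable_snd).
  exact: (measurable_coefK (lam0 v) (X e) (active e) m2 m1 mB).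
- apply: (@measurable_fun_state _ _ _ (g_sigma_algebraType G') (H v)
    (fun e w => fine (coefK (lam0 v) (X e) (active e) (dt v w) (sig2 v w) B))) => e.
    by apply: gsigma_GHD => // F GF; apply: sub; left.
  apply: measurable_coefK => //.
  + by apply: data_tuple_gsigma => // F GF; apply: sub; right.
  + apply: measurable_fun_gen; apply: subset_trans (@sub_sigma_algebra _ setT _).
    exact: subsetUr.
- move=> e _ [A [C [mA mC ->]]].
  transitivity (\int[Q v e]_q (\1_A q.1 * \1_B q.2.1 * \1_C q.2.2)%:E)%E.
    apply: eq_integral => q _; congr (_%:E).
    rewrite (_ : \1_[set q | A q.1 /\ C q.2.2] q = \1_A q.1 * \1_C q.2.2); last first.
      rewrite !indicE -natrM mulnb; congr (nat_of_bool _)%:R.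
      by apply/idP/andP => [/set_mem[? ?]|[/set_mem ? /set_mem ?]]; [split|]; apply/mem_set.
    by rewrite -mulrA [RHS]mulrAC -mulrA; congr (_ * (_ * _)); rewrite !indicE.
  etransitivity; first exact: (nodeQ_coef (lam0 v) a1 b0 (X e) (active e) mA mB mC).
  apply: eq_integral => q _; congr ((_ * _)%:E).
  rewrite !indicE -natrM mulnb; congr (nat_of_bool _)%:R.
  by apply/andP/idP => [[/set_mem ? /set_mem ?]|/set_mem[? ?]]; [|split]; apply/mem_set.
Qed.

Lemma posterior_indep : {subset tree J <= s} -> cond_indep P (GH s `|` GD) (tree J)
  (fun v => gen_coef G z beta [:: v] `|` gen (sig2 v)).
Proof.
move=> ts E EC.
have mU v : measurable_fun setT (fun w => (sig2 v w, coef_tuple G z beta v w)).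
  apply: measurable_fun_pair; first exact: measurable_funPT.
  exact: measurable_coef_tuple.
(* Every event of the sigma-algebra of a node is the preimage of a measurable set under the pair
   (variance, coefficient tuple); this reduces independence to [cond_prob_prod]. *)
have EA v : exists A : set (R * p.-tuple R), measurable A /\
    (v \in tree J -> E v = [set w | A (sig2 v w, coef_tuple G z beta v w)]).
  case: (boolP (v \in tree J)) => [vt|_]; last by exists setT.
  suff : preimage_set_system setT (fun w => (sig2 v w, coef_tuple G z beta v w)) measurable (E v).
    by move=> [A mA <-]; exists A; split => // _; rewrite setTI.
  move: (E v) (EC v vt); apply: smallest_sub.
    exact/sigma_algebra_preimage/sigma_algebra_measurable.
  move=> F [|[A mA <-]]; last first.
    exists (A `*` setT); first exact: measurableX.
    by rewrite !setTI predeqE => w; split => [[]|].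
  move=> [_ /allpairsPdep[v' [c [+ cidx ->]]] [A mA <-]].
  rewrite inE => /eqP ->; rewrite setTI.
  have := cidx; rewrite (perm_mem (@perm_coef_key L G)) => /mapP[i _ ->].
  exists (setT `*` [set t | A (tnth t i)]).
    apply: measurableX => //; rewrite -[X in measurable X]setTI.
    exact: (measurable_tnth i).
  by rewrite setTI predeqE => w; rewrite /mkset /= coef_tuple_coef; split => [[]|].
have [A AE] := boolp.choice EA.
have mA v : measurable (A v) by case: (AE v).
exists (fun v w => pj v (H v w) (dt v w) (A v)).
split => [v vt|].
  by have [_ ->] := AE v; [apply: posterior_node => //; exact: ts|exact: vt].
rewrite (_ : \bigcap_(i in [set` tree J]) E i =
  [set w | forall v, v \in tree J -> [set q : T | A v (pair12 q)] (W v w)]); last first.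
  rewrite predeqE => w; split => h1 v vt; have := h1 v vt; by rewrite (proj2 (AE v) vt).

apply: (cond_prob_prod x0 mH mW prior_ge0 Q_lty (@rects_measurable R L G ng)
  (@rects_setI R L G ng) (@rects_setT R L G ng) (@rects_generate R L G ng) joint
  D1m D1I D1T GHDm (shape_GHD (fun B => id))
  (A := fun v => [set q | A v (pair12 q)]) (k := fun v e q => pj v e q.2.2 (A v))).
- by move=> v; exact: measurable_pair12.
- by move=> v e q; exact: pj01.
- by move=> v e; apply: measurable_pj => //; exact: (measurableT_comp measurable_snd measurable_snd).
- have mpj v : v \in tree J -> measurable_fun setT ((fun w =>
      pj v (H v w) (dt v w) (A v)) : g_sigma_algebraType (GH s `|` GD) -> R).
    by move=> vt; apply: measurable_pj_state => //; exact: ts.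
  by apply: measurable_prod => v vt; exact: mpj.
- by move=> v e B; exact: pj_law.
Qed.

End conditional_laws.
End posterior.

Theorem theorem3 (R : realType) (d : measure_display) (Omega : measurableType d)
    (P : probability Omega R) (J L : nat) (G : 'I_L -> nat)
    (ng : combo G -> nat) (h : hyper R L)
    (S : node -> {RV P >-> bool}) (Rh : 'I_L -> node -> {RV P >-> bool})
    (sig2 z : node -> {RV P >-> R})
    (beta : 'I_L -> nat -> node -> {RV P >-> R})
    (u data : node -> obs ng -> {RV P >-> R})
    (L_ge1 : (1 <= L)%N) (G_ge2 : forall l, (2 <= G l)%N)
    (h_valid : valid_hyper J h)
    (model : NIG_MG J h S Rh sig2 z beta u data) :
  let H := hidden S Rh in
  let D := data_vec data in
  let n : R := (nobs ng)%:R in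
  let GD := gen_data J data in
  let GH := gen_hidden S Rh in
  (* (i) *)
  [/\ (forall w, prob_vec (post_init J h (D w))),
      (forall w (v : node) x, v \in tree J -> (0 < v.1)%N ->
         prob_vec (post_trans J h (D w) v x)),
      cond_is_MT P GD J (fun w => post_init J h (D w))
        (fun w => post_trans J h (D w)) H,
      (forall x : state L,
         cond_prob P GD [set w | H rootn w = x]
           (fun w => post_init J h (D w) x)) &
      (forall (v : node) (y : state L), v \in tree J -> (0 < v.1)%N ->
         cond_prob P (GH [:: parent v] `|` GD) [set w | H v w = y]
           (fun w => post_trans J h (D w) v (H (parent v) w) y))]
  /\
  (* independence in (ii) *)
  cond_indep P (GH (tree J) `|` GD) (tree J)
    (fun v => gen_coef G z beta [:: v] `|` gen (sig2 v))
  /\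
  (* laws in (ii) and (iii): s = [:: v] conditions on the hidden state of v
     alone, s = tree J on all hidden states *)
  (forall (v : node) (s : seq node), v \in tree J -> v \in s ->
     {subset s <= tree J} ->
     cond_law P (GH s `|` GD) (sig2 v)
       (fun w => inv_gamma (nu h + 1 + n / 2)
                   (nu h * sigma02 h + Upsilon h v.1 (D w v) (H v w)))
     /\
     exists K : Omega -> probability ((ncoef G).-tuple R) R,
       {ae P, forall w,
          is_mvnormal (mu_star h v.1 (D w v) (H v w))
            (sig2 v w *: hadamard (Mmat G (H v w))
                           (invmx (Lambda_star ng h v.1 (H v w)))) (K w)}
       /\ cond_law P (GH s `|` GD `|` gen (sig2 v))
            (coef_tuple G z beta v) K).
Proof.
split.
  split.
  - by move=> w; exact: (post_init_prob h_valid (marg_lik_gt0 h_valid)).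
  - by move=> w v x; exact: (post_trans_prob h_valid (marg_lik_gt0 h_valid)).
  - exact: (posterior_MT h_valid model).
  - exact: (posterior_root h_valid model).
  - exact: (posterior_trans h_valid model).
split; first exact: (posterior_indep h_valid model).
move=> v s vt vs st; split; first exact: (posterior_sig2 h_valid model st vs).
exact: (posterior_coef h_valid model st vs).
Qed.
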